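(* Let $(k_r)_{r\ge 0}$ and $(m_r)_{r\ge 0}$ be arbitrary sequences of complex numbers, and let the complex numbers $(g_r)_{r\ge 0}$ be determined by the system of equations $$G_r+H_r+M_r+2P_r+2R_r+2S_r=0,\qquad r=0,1,2,\ldots,$$ i.e. $(g_r)_{r\ge0}$ satisfies this system, where $G_r,H_r,M_r,P_r,R_r,S_r$ are the polynomial expressions in $k_0,\dots,k_r,m_0,\dots,m_r,g_0,\dots,g_r$ defined in the context. Put $\xi_r=\xi_r(x,y,z):=k_rx+m_ry+g_rz$ for $r=0,1,2,\ldots$ and $(x,y,z)\in\mathbb{R}^3$. Let $D$ be a domain in $\mathbb{C}$ and let $\Pi:=\{(x,y,z)\in\mathbb{R}^3:\ \xi_0(x,y,z)\in D\}$. Then on $\Pi$ the three-dimensional biharmonic equation $\Delta^2U(x,y,z)=0$ has the infinite-dimensional family of exact solutions $$\left\{\frac{1}{2\pi i}\int_\Gamma F(t)\,A_k\,dt\right\}_{k=0}^{\infty},$$ that is, for every $k=0,1,2,\ldots$ and every holomorphic function $F:D\to\mathbb{C}$, the function $$U_k(x,y,z)=\frac{1}{2\pi i}\int_\Gamma F(t)\,A_k(t;x,y,z)\,dt,\qquad (x,y,z)\in\Pi,$$ satisfies $\Delta^2U_k=0$ on $\Pi$. Here $\Gamma$ is a closed Jordan rectifiable curve in $D$ that surrounds the point $\xi_0=\xi_0(x,y,z)$ (with the region bounded by $\Gamma$ contained in $D$), and the coefficients $A_k=A_k(t;x,y,z)$ are given by the recurrence relations $$A_0=\frac{1}{t-\xi_0},\qquad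 A_s=\frac{1}{t-\xi_0}\left(\xi_sA_0+\xi_{s-1}A_1+\cdots+\xi_1A_{s-1}\right),\quad s=1,2,\ldots.$$
   Context: The three-dimensional biharmonic operator is $$\Delta^2U=\left(\frac{\partial^2}{\partial x^2}+\frac{\partial^2}{\partial y^2}+\frac{\partial^2}{\partial z^2}\right)^2U=\frac{\partial^4 U}{\partial x^4}+\frac{\partial^4 U}{\partial y^4}+\frac{\partial^4 U}{\partial z^4}+2\frac{\partial^4 U}{\partial x^2\partial y^2}+2\frac{\partial^4 U}{\partial x^2\partial z^2}+2\frac{\partial^4 U}{\partial y^2\partial z^2},$$ acting on complex-valued functions of real variables $x,y,z$. For complex numbers $a_0,a_1,\ldots,a_r$ define $$B_r(a_0,\ldots,a_r):=\sum_{j=0}^{r}a_ja_{r-j},$$ so that $B_0=a_0^2$, $B_1=2a_0a_1$, $B_2=a_1^2+2a_0a_2$, and so on. For given sequences $(k_r),(m_r),(g_r)$ put $$B_r:=B_r(k_0,\ldots,k_r),\quad C_r:=B_r(m_0,\ldots,m_r),\quad D_r:=B_r(g_0,\ldots,g_r),$$ and $$G_r:=\sum_{j=0}^rB_jB_{r-j},\quad H_r:=\sum_{j=0}^rC_jC_{r-j},\quad M_r:=\sum_{j=0}^rD_jD_{r-j},$$ $$P_r:=\sum_{j=0}^rB_jC_{r-j},\quad R_r:=\sum_{j=0}^rB_jD_{r-j},\quad S_r:=\sum_{j=0}^rC_jD_{r-j}.$$ (The numbers $D_r$ are unrelated to the domain $D\subset\mathbb{C}$.) A domain in $\mathbb{C}$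 is a nonempty connected open set. *)

(* Defs.v *)
From Stdlib Require Import Reals List.
From Coquelicot Require Export Coquelicot.

Local Open Scope R_scope.

(** * The algebraic system *)

Definition conv (a b : nat -> C) (r : nat) : C :=
  sum_n (fun j => (a j * b (r - j)%nat)%C) r.

(** With B, C, D = [conv k k], [conv m m], [conv g g], the six summands are
    G, H, M, P, R, S in this order. *)
Definition characteristic_system (k m g : nat -> C) : Prop :=
  forall r : nat,
    let Bs := conv k k in
    let Cs := conv m m in
    let Ds := conv g g in
    (conv Bs Bs r + conv Cs Cs r + conv Ds Ds r
     + 2 * conv Bs Cs r + 2 * conv Bs Ds r + 2 * conv Cs Ds r = 0)%C.

Definition xi (k m g : nat -> C) (r : nat) (x y z : R) : C :=
  (k r * x + m r * y + g r * z)%C.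

(** [A s t x y z] is the coefficient A_s(t; x, y, z), constrained only where
    t <> xi_0; the sum in the second clause is
    xi_{s+1} A_0 + xi_s A_1 + ... + xi_1 A_s. *)
Definition coefficient_recurrence (k m g : nat -> C)
    (A : nat -> C -> R -> R -> R -> C) : Prop :=
  forall (t : C) (x y z : R), t <> xi k m g 0 x y z ->
    A 0%nat t x y z = (/ (t - xi k m g 0 x y z))%C /\
    forall s : nat,
      A (S s) t x y z =
        (/ (t - xi k m g 0 x y z) *
         sum_n (fun j => (xi k m g (S s - j) x y z * A j t x y z)%C) s)%C.

(** * Plane topology *)

Definition connected_in_C (S : C -> Prop) : Prop :=
  forall V W : C -> Prop, open V -> open W ->
    (forall z, S z -> V z \/ W z) ->
    (exists z, S z /\ V z) -> (exists z, S z /\ W z) ->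
    exists z, S z /\ V z /\ W z.

Definition domain_in_C (D : C -> Prop) : Prop :=
  (exists z, D z) /\ open D /\ connected_in_C D.

Definition holomorphic_on (D : C -> Prop) (F : C -> C) : Prop :=
  forall z : C, D z -> ex_derive (K := C_AbsRing) (V := C_NormedModule) F z.

(** * Closed Jordan rectifiable curves, parametrized by [0, 1] *)

Definition closed_jordan (gamma : R -> C) : Prop :=
  (forall t : R, 0 <= t <= 1 ->
     filterlim gamma (within (fun s => 0 <= s <= 1) (locally t))
       (locally (gamma t))) /\
  gamma 0 = gamma 1 /\
  (forall s t : R, 0 <= s < 1 -> 0 <= t < 1 -> gamma s = gamma t -> s = t).

(** Finite subdivisions are written as monotone sequences in [0, 1], of which
    only the points of index at most n + 1 are used. *)
Definition rectifiable (gamma : R -> C) : Prop :=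
  exists L : R, forall (sigma : nat -> R) (n : nat),
    (forall i, 0 <= sigma i <= 1) ->
    (forall i, sigma i <= sigma (S i)) ->
    sum_n (fun i => Cmod (gamma (sigma (S i)) - gamma (sigma i))%C) n <= L.

Definition trace (gamma : R -> C) (w : C) : Prop :=
  exists t : R, 0 <= t <= 1 /\ gamma t = w.

(** The region bounded by [gamma]: the points off the curve whose connected
    component in the complement of the curve is bounded. *)
Definition jordan_interior (gamma : R -> C) (w : C) : Prop :=
  ~ trace gamma w /\
  exists M : R, forall S : C -> Prop,
    connected_in_C S -> S w -> (forall v, S v -> ~ trace gamma v) ->
    forall v, S v -> Cmod v <= M.

(** * Integrals along rectifiable curves *)

(** The analogue of [Riemann_sum] for the integral of f(t) dt along [gamma]:
    the sum of (gamma(x_{i+1}) - gamma(x_i)) f(gamma(y_i)). *)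
Definition contour_sum (gamma : R -> C) (f : C -> C) (ptd : SF_seq (T := R)) : C :=
  fold_right Cplus (RtoC 0)
    (seq.pairmap
       (fun p q : R * R => ((gamma (fst q) - gamma (fst p)) * f (gamma (snd q)))%C)
       (SF_h ptd, 0) (SF_t ptd)).

Definition is_contour_int (gamma : R -> C) (f : C -> C) (I : C) : Prop :=
  filterlim (contour_sum gamma f) (Riemann_fine 0 1) (locally I).

(** As for [RInt], the value is meaningful when the integral exists, which is
    the case for a rectifiable curve and an integrand continuous along it. *)
Definition contour_int (gamma : R -> C) (f : C -> C) : C :=
  iota (T := C_R_CompleteNormedModule) (is_contour_int gamma f).

Definition winding (gamma : R -> C) (w : C) : C :=
  (/ (2 * PI * Ci) * contour_int gamma (fun t => / (t - w)))%C.

Definition positively_oriented (gamma : R -> C) : Prop :=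
  forall w : C, jordan_interior gamma w -> winding gamma w = RtoC 1.

(** [gamma] is an admissible curve of integration in [D] around [w]. *)
Definition surrounding_curve (D : C -> Prop) (w : C) (gamma : R -> C) : Prop :=
  closed_jordan gamma /\ rectifiable gamma /\ positively_oriented gamma /\
  jordan_interior gamma w /\
  (forall v, trace gamma v -> D v) /\
  (forall v, jordan_interior gamma v -> D v).

(** * Partial derivatives of complex-valued functions of three real variables *)

Definition CDerive (f : R -> C) (t : R) : C :=
  (Derive (fun s => Re (f s)) t, Derive (fun s => Im (f s)) t).

Definition dx (U : R -> R -> R -> C) : R -> R -> R -> C :=
  fun x y z => CDerive (fun s => U s y z) x.
Definition dy (U : R -> R -> R -> C) : R -> R -> R -> C :=
  fun x y z => CDerive (fun s => U x s z) y.
Definition dz (U : R -> R -> R -> C) : R -> R -> R -> C :=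
  fun x y z => CDerive (fun s => U x y s) z.

Definition C_ex_derive (f : R -> C) (t : R) : Prop :=
  ex_derive (K := R_AbsRing) (V := C_R_NormedModule) f t.

(** [class_C n Om U]: all partial derivatives of [U] of order at most [n] exist
    and are continuous at the points of [Om]. *)
Fixpoint class_C (n : nat) (Om : R -> R -> R -> Prop) (U : R -> R -> R -> C) : Prop :=
  (forall x y z : R, Om x y z ->
     continuous (fun p : R * R * R => U (fst (fst p)) (snd (fst p)) (snd p))
       ((x, y), z)) /\
  match n with
  | O => True
  | S n' =>
      (forall x y z : R, Om x y z ->
         C_ex_derive (fun s => U s y z) x /\
         C_ex_derive (fun s => U x s z) y /\
         C_ex_derive (fun s => U x y s) z) /\
      class_C n' Om (dx U) /\ class_C n' Om (dy U) /\ class_C n' Om (dz U)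
  end.

Definition biharmonic (U : R -> R -> R -> C) (x y z : R) : C :=
  (dx (dx (dx (dx U))) x y z
   + dy (dy (dy (dy U))) x y z
   + dz (dz (dz (dz U))) x y z
   + 2 * dx (dx (dy (dy U))) x y z
   + 2 * dx (dx (dz (dz U))) x y z
   + 2 * dy (dy (dz (dz U))) x y z)%C.

(** Classical solutions: the total operator [biharmonic] only has its intended
    meaning when the derivatives exist. *)
Definition biharmonic_solution (Om : R -> R -> R -> Prop) (U : R -> R -> R -> C) : Prop :=
  class_C 4 Om U /\ forall x y z : R, Om x y z -> biharmonic U x y z = RtoC 0.

(* Main.v *)
Require Import Defs.
From Stdlib Require Import Reals List Lra Lia Psatz Classical IndefiniteDescription.
From Coquelicot Require Import Coquelicot.
Local Open Scope R_scope.

(** Let [k(eps)], [m(eps)], [g(eps)] be the formal power series with coefficients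
    [k r], [m r], [g r], and let
    [xi(eps) = k(eps) x + m(eps) y + g(eps) z = xi_0 + eta(eps)]. The left-hand
    sides of the characteristic system are the coefficients of the square of
    [k^2 + m^2 + g^2], so the system says that this square is zero. The recurrence
    for the [A s] says that [A_0 + A_1 eps + ...] is the expansion of
    [1 / (t - xi(eps))]. By Cauchy's formula the n-th function of the family is
    then the coefficient of [eps^n] in [F (xi(eps))], and formally
    [Delta^2 F (xi) = (k^2 + m^2 + g^2)^2 F'''' (xi) = 0].

    The algebraic half makes this precise with convolutions of sequences.
    [coefficient_expansion] expands [A n] into powers of [1 / (t - xi_0)] whose
    coefficients are those of the powers of [eta]; integrated against [F] it gives
    [compose T n], where [T i] is the i-th Taylor coefficient of [F].
    [compose_derive] is the chain rule for this coefficient of a composition, and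
    [solution_biharmonic] adds up the six fourth-order derivatives.

    The analytic half is [taylor_coefficient_integral]: for every curve [gamma]
    surrounding [w] in [D], the integral of [F t / (t - w)^(j + 1)] along [gamma]
    is [2 PI i] times the j-th Taylor coefficient of [F] at [w]. In particular the
    integral depends on the point only, although the curve may change with
    [(x, y, z)] in an arbitrary way, and it is a smooth function of the point.
    The curve is only continuous and rectifiable, so the contour integral is a
    Stieltjes integral; it exists because the sums for step functions telescope
    ([stieltjes_cauchy_continuous]). Goursat's lemma gives primitives on discs, and
    a contraction of the integrand towards [w] gives Cauchy's formula there
    ([cauchy_formula_C1]), hence the smoothness of holomorphic functions. A point
    outside [D] is off the curve and not in its interior, so it is connected to
    points far away without crossing the curve, and the index at it is zero
    ([index_exterior]). This is the hypothesis of Cauchy's formula in its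
    homological form, which is proved by Dixon's argument
    ([cauchy_formula_homology]). *)

(** Finite sums have the carrier of an abelian monoid as their type, which [ring]
    does not recognize as [C]; the neutral summand makes the type explicit. *)
Ltac C_ring :=
  match goal with |- ?a = ?b => refine (eq_trans (A := C) (eq_sym (Cplus_0_l a)) _) end; ring.

Lemma Cmod_sub_sym (a b : C) : Cmod (a - b) = Cmod (b - a).
Proof. rewrite <- Cmod_opp. f_equal. ring. Qed.

Lemma Cmod_sub_triangle (b a c : C) : Cmod (a - c) <= Cmod (a - b) + Cmod (b - c).
Proof.
  replace (a - c)%C with ((a - b) + (b - c))%C by ring. apply Cmod_triangle.
Qed.

Lemma Cmod_sub_diag (a : C) : Cmod (a - a) = 0.
Proof. replace (a - a)%C with (RtoC 0) by ring. apply Cmod_0. Qed.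

Lemma Cmod_sub_eq (a b : C) : (forall eps, 0 < eps -> Cmod (a - b) <= eps) -> a = b.
Proof.
  intros H. assert (Cmod (a - b) = 0).
  { apply Rle_antisym; [|apply Cmod_ge_0]. apply Rnot_lt_le. intros Hp.
    specialize (H (Cmod (a - b) / 2)). lra. }
  apply Cmod_eq_0 in H0. replace a with ((a - b) + b)%C by ring. rewrite H0. ring.
Qed.

Lemma Csub_neq_0 (a b : C) : a <> b -> (a - b)%C <> 0%C.
Proof.
  intros H E. apply H. replace a with ((a - b) + b)%C by ring. rewrite E. ring.
Qed.

Lemma locally_C (w : C) (P : C -> Prop) :
  locally w P <-> exists d, 0 < d /\ forall v, Cmod (v - w) < d -> P v.
Proof.
  split.
  - intros H. destruct (locally_norm_le_locally (V := C_NormedModule) w P H) as [d K].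
    clear H. rename K into H. exists d. split; [apply cond_pos|]. intros v Hv. apply H. exact Hv.
  - intros [d [Hd H]]. apply (locally_le_locally_norm (V := C_NormedModule) w P).
    exists (mkposreal d Hd). intros v Hv. apply H. exact Hv.
Qed.

Lemma filterlim_C {T : Type} {F : (T -> Prop) -> Prop} {FF : Filter F} (f : T -> C) (l : C) :
  filterlim f F (locally l) <-> forall eps, 0 < eps -> F (fun x => Cmod (f x - l) < eps).
Proof.
  rewrite (filterlim_locally_ball_norm (U := C_NormedModule)). split.
  - intros H eps He. exact (H (mkposreal eps He)).
  - intros H eps. exact (H eps (cond_pos eps)).
Qed.

Lemma continuous_C (f : C -> C) (w : C) :
  continuous f w <-> forall eps, 0 < eps ->
    exists d, 0 < d /\ forall v, Cmod (v - w) < d -> Cmod (f v - f w) < eps.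
Proof.
  unfold continuous. rewrite filterlim_C.
  split; intros H eps He; apply locally_C; apply H; exact He.
Qed.

(** Compactness of the unit interval as the existence of a Lebesgue number. All
    uniform estimates along a path are instances, with [P d u] an estimate at the
    parameter [u] on the scale [d]. *)
Lemma unit_interval_uniform (P : R -> R -> Prop) :
  (forall d d' u, d' <= d -> P d u -> P d' u) ->
  (forall s, 0 <= s <= 1 -> exists d, 0 < d /\
     forall u, 0 <= u <= 1 -> Rabs (u - s) < d -> P d u) ->
  exists d, 0 < d /\ forall u, 0 <= u <= 1 -> P d u.
Proof.
  intros Hmon Hloc.
  assert (Hex : forall s, exists d : posreal, 0 <= s <= 1 ->
            forall u, 0 <= u <= 1 -> Rabs (u - s) < d -> P d u).
  { intros s. destruct (classic (0 <= s <= 1)) as [Hs|Hs].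
    - destruct (Hloc s Hs) as [d [Hd H]]. exists (mkposreal d Hd). auto.
    - exists (mkposreal 1 Rlt_0_1). tauto. }
  destruct (functional_choice _ Hex) as [delta Hdelta].
  destruct (compactness_value_1d 0 1 delta) as [d Hd].
  exists d. split; [apply cond_pos|]. intros u Hu.
  apply NNPP. intros Hn. apply (Hd u Hu). intros [t [Ht [Hut Hdt]]].
  apply Hn. apply (Hmon (delta t)); auto.
Qed.

Lemma sum_n_first {G : AbelianMonoid} (a : nat -> G) (n : nat) :
  sum_n a (S n) = plus (a 0%nat) (sum_n (fun i => a (S i)) n).
Proof.
  induction n as [|n IH].
  - now rewrite sum_Sn, !sum_O.
  - rewrite sum_Sn, IH, (sum_Sn (fun i => a (S i))). now rewrite plus_assoc.
Qed.

(** * Stieltjes sums along a path *)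

(** The encoding of a tagged subdivision of the interval from [h] to [1] is that
    of Coquelicot's [SF_t]: the right end and the tag of each cell. Lists allow
    induction on the cells, which the index-based [pointed_subdiv] does not. *)
Fixpoint fine_subdivision (d h : R) (l : list (R * R)) : Prop :=
  match l with
  | nil => h = 1
  | (x, y) :: l' => h <= y <= x /\ x - h < d /\ fine_subdivision d x l'
  end.

Fixpoint stieltjes_sum (gamma : R -> C) (phi : R -> C) (h : R) (l : list (R * R)) : C :=
  match l with
  | nil => 0%C
  | (x, y) :: l' => ((gamma x - gamma h) * phi y + stieltjes_sum gamma phi x l')%C
  end.

Fixpoint variation_sum (gamma : R -> C) (h : R) (l : list (R * R)) : R :=
  match l with
  | nil => 0
  | (x, y) :: l' => Cmod (gamma x - gamma h) + variation_sum gamma x l'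
  end.

Lemma contour_sum_stieltjes (gamma : R -> C) (f : C -> C) (h : R) (l : list (R * R)) :
  contour_sum gamma f (mkSF_seq h l) = stieltjes_sum gamma (fun s => f (gamma s)) h l.
Proof.
  unfold contour_sum. cbn [SF_h SF_t].
  (* The tag attached to the left end of a cell is never read. *)
  generalize (0 : R) at 2 as a. revert h.
  induction l as [|[x y] l IH]; intros h a; [reflexivity|].
  cbn. f_equal. apply IH.
Qed.

Lemma fine_subdivision_spec (d h : R) (l : list (R * R)) : 0 < d ->
  (fine_subdivision d h l <->
   pointed_subdiv (mkSF_seq h l) /\ seq.last h (SF_lx (mkSF_seq h l)) = 1 /\
   seq_step (SF_lx (mkSF_seq h l)) < d).
Proof.
  intros Hd. revert h. induction l as [|[x y] l IH]; intros h.
  - cbn. split.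
    + intros ->. split; [|split; [reflexivity|exact Hd]].
      intros i Hi. exfalso. unfold SF_size in Hi. cbn in Hi. lia.
    + now intros [_ [H _]].
  - cbn [fine_subdivision]. rewrite IH. clear IH.
    assert (Hp : pointed_subdiv (mkSF_seq h ((x, y) :: l)) <->
                 h <= y <= x /\ pointed_subdiv (mkSF_seq x l)).
    { split.
      - intros H. split.
        + apply (H 0%nat). unfold SF_size. cbn. lia.
        + intros i Hi. apply (H (S i)). unfold SF_size in *. cbn in *. lia.
      - intros [H0 H] [|i] Hi; [exact H0|]. apply (H i). unfold SF_size in *. cbn in *. lia. }
    rewrite Hp. unfold seq_step. cbn. split.
    + intros [H1 [H2 [H3 [H4 H5]]]]. split; [now split|]. split; [exact H4|].
      apply Rmax_lub_lt; [|exact H5]. rewrite Rabs_pos_eq; lra.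
    + intros [[H1 H2] [H3 H4]]. apply Rmax_Rlt in H4. destruct H4 as [H4 H5].
      rewrite Rabs_pos_eq in H4 by lra. auto.
Qed.

Lemma Riemann_fine_spec (Q : SF_seq (T := R) -> Prop) :
  Riemann_fine 0 1 Q <-> exists d, 0 < d /\
    forall l, fine_subdivision d 0 l -> Q (mkSF_seq 0 l).
Proof.
  unfold Riemann_fine, within, locally_dist.
  rewrite Rmin_left, Rmax_right by lra. split.
  - intros [d H]. exists d. split; [apply cond_pos|]. intros l Hl.
    apply fine_subdivision_spec in Hl; [|apply cond_pos]. destruct Hl as [H1 [H2 H3]].
    apply H; auto.
  - intros [d [Hd H]]. exists (mkposreal d Hd). intros [h l] H1 [H2 [H3 H4]].
    cbn [SF_h] in *. subst h. apply H. apply fine_subdivision_spec; auto.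
Qed.

Lemma fine_subdivision_le (d h : R) (l : list (R * R)) : fine_subdivision d h l -> h <= 1.
Proof.
  revert h. induction l as [|[x y] l IH]; intros h; cbn.
  - intros ->; lra.
  - intros [H1 [_ H2]]. apply IH in H2. lra.
Qed.

Lemma fine_subdivision_mono (d d' h : R) (l : list (R * R)) :
  d <= d' -> fine_subdivision d h l -> fine_subdivision d' h l.
Proof.
  intros Hd. revert h. induction l as [|[x y] l IH]; intros h; cbn; [auto|].
  intros [H1 [H2 H3]]. repeat split; try apply H1; try apply IH; auto; lra.
Qed.

Lemma stieltjes_sum_bound (gamma phi : R -> C) (M d h : R) (l : list (R * R)) :
  0 <= h -> fine_subdivision d h l ->
  (forall u, 0 <= u <= 1 -> Cmod (phi u) <= M) ->
  Cmod (stieltjes_sum gamma phi h l) <= M * variation_sum gamma h l.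
Proof.
  intros Hh Hl HM. revert h Hh Hl. induction l as [|[x y] l IH]; intros h Hh; cbn.
  - intros _. rewrite Cmod_0. lra.
  - intros [H1 [_ H2]].
    assert (Hx := fine_subdivision_le _ _ _ H2).
    eapply Rle_trans; [apply Cmod_triangle|]. rewrite Rmult_plus_distr_l.
    apply Rplus_le_compat.
    + rewrite Cmod_mult, Rmult_comm. apply Rmult_le_compat_r; [apply Cmod_ge_0|].
      apply HM. lra.
    + apply IH; [lra|exact H2].
Qed.

(** The nodes are read as the infinite sequence that stays at [1] after the last
    one; the additional summand is zero. *)
Lemma variation_sum_sequence (gamma : R -> C) (d h : R) (l : list (R * R)) :
  fine_subdivision d h l ->
  variation_sum gamma h l =
  sum_n (fun i => Cmod (gamma (nth (S i) (h :: map fst l) 1%R)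
                        - gamma (nth i (h :: map fst l) 1%R))) (length l).
Proof.
  revert h. induction l as [|[x y] l IH]; intros h.
  - cbn -[sum_n]. intros ->. now rewrite sum_O, Cmod_sub_diag.
  - intros [H1 [_ H2]]. cbn [length]. rewrite sum_n_first.
    cbn [variation_sum]. rewrite (IH _ H2). reflexivity.
Qed.

Lemma fine_subdivision_nodes (d h : R) (l : list (R * R)) :
  0 <= h -> fine_subdivision d h l -> forall i,
  0 <= nth i (h :: map fst l) 1 <= 1 /\
  nth i (h :: map fst l) 1 <= nth (S i) (h :: map fst l) 1.
Proof.
  revert h. induction l as [|[x y] l IH]; intros h Hh Hl i.
  - cbn in Hl. subst h. destruct i as [|[|i]]; cbn; lra.
  - assert (Hh1 := fine_subdivision_le _ _ _ Hl).
    destruct Hl as [H1 [_ H2]]. destruct i as [|i].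
    + cbn. lra.
    + apply (IH x); [lra|exact H2].
Qed.

Definition path (gamma : R -> C) : Prop :=
  (forall t : R, 0 <= t <= 1 ->
     filterlim gamma (within (fun s => 0 <= s <= 1) (locally t)) (locally (gamma t))) /\
  rectifiable gamma.

Lemma path_continuous (gamma : R -> C) : path gamma ->
  forall s, 0 <= s <= 1 -> forall eps, 0 < eps ->
  exists d, 0 < d /\ forall u, 0 <= u <= 1 -> Rabs (u - s) < d ->
    Cmod (gamma u - gamma s) < eps.
Proof.
  intros [H _] s Hs eps He. specialize (H s Hs).
  assert (FF : Filter (within (fun s => 0 <= s <= 1) (locally s)))
    by (apply within_filter, locally_filter).
  rewrite (filterlim_C gamma (gamma s)) in H. specialize (H eps He).
  destruct H as [d H]. exists d. split; [apply cond_pos|]. intros u Hu Hus. apply H; auto.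
Qed.

Definition length_bound (gamma : R -> C) (L : R) : Prop :=
  forall (sigma : nat -> R) (n : nat),
    (forall i, 0 <= sigma i <= 1) -> (forall i, sigma i <= sigma (S i)) ->
    sum_n (fun i => Cmod (gamma (sigma (S i)) - gamma (sigma i))%C) n <= L.

Lemma path_length_bound (gamma : R -> C) : path gamma -> exists L, 0 < L /\ length_bound gamma L.
Proof.
  intros [_ [L HL]]. exists (Rmax L 1). split.
  - apply Rlt_le_trans with 1; [lra|apply Rmax_r].
  - intros sigma n H1 H2. eapply Rle_trans; [apply HL; auto|apply Rmax_l].
Qed.

Lemma variation_sum_le (gamma : R -> C) (L d : R) (l : list (R * R)) :
  length_bound gamma L -> fine_subdivision d 0 l -> variation_sum gamma 0 l <= L.
Proof.
  intros HL Hl. rewrite (variation_sum_sequence _ _ _ _ Hl).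
  apply (HL (fun i => nth i (0 :: map fst l) 1)); intros i;
    apply (fine_subdivision_nodes _ _ _ (Rle_refl 0) Hl i).
Qed.

Lemma stieltjes_sum_sub (gamma phi psi : R -> C) (h : R) (l : list (R * R)) :
  (stieltjes_sum gamma phi h l - stieltjes_sum gamma psi h l)%C =
  stieltjes_sum gamma (fun u => phi u - psi u)%C h l.
Proof.
  revert h. induction l as [|[x y] l IH]; intros h; cbn; [ring|]. rewrite <- IH. ring.
Qed.

Lemma stieltjes_sum_lin (gamma phi psi : R -> C) (a : C) (h : R) (l : list (R * R)) :
  stieltjes_sum gamma (fun u => phi u + a * psi u)%C h l =
  (stieltjes_sum gamma phi h l + a * stieltjes_sum gamma psi h l)%C.
Proof.
  revert h. induction l as [|[x y] l IH]; intros h; cbn; [ring|]. rewrite IH. ring.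
Qed.

Lemma stieltjes_sum_one (gamma : R -> C) (d h : R) (l : list (R * R)) :
  fine_subdivision d h l ->
  stieltjes_sum gamma (fun _ => 1%C) h l = (gamma 1 - gamma h)%C.
Proof.
  revert h. induction l as [|[x y] l IH]; intros h; cbn.
  - intros ->. ring.
  - intros [_ [_ H]]. rewrite (IH x H). ring.
Qed.

Definition before (b u : R) : C := if Rlt_dec u b then 1%C else 0%C.

Lemma stieltjes_sum_before_0 (gamma : R -> C) (d b h : R) (l : list (R * R)) :
  b <= h -> fine_subdivision d h l -> stieltjes_sum gamma (before b) h l = 0%C.
Proof.
  revert h. induction l as [|[x y] l IH]; intros h Hb; cbn; [reflexivity|].
  intros [H1 [_ H2]]. rewrite (IH x) by (try lra; auto).
  unfold before. destruct (Rlt_dec y b); [lra|ring].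
Qed.

(** The sum telescopes up to the cell in which the tags pass [b]. *)
Lemma stieltjes_sum_before (gamma : R -> C) (d b h : R) (l : list (R * R)) :
  0 < d -> h <= b <= 1 -> fine_subdivision d h l ->
  exists x, h <= x <= 1 /\ Rabs (x - b) < d /\
    stieltjes_sum gamma (before b) h l = (gamma x - gamma h)%C.
Proof.
  intros Hd. revert h. induction l as [|[x y] l IH]; intros h Hb.
  - cbn. intros ->. exists 1. repeat split; try lra.
    + replace b with 1 by lra. rewrite Rminus_diag, Rabs_R0. exact Hd.
    + ring.
  - intros Hl. assert (Hh := fine_subdivision_le _ _ _ Hl).
    destruct Hl as [H1 [H2 H3]]. assert (Hx := fine_subdivision_le _ _ _ H3). cbn.
    destruct (Rlt_dec x b) as [Hxb|Hxb].
    + destruct (IH x) as [z [Hz1 [Hz2 ->]]]; [lra|exact H3|].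
      exists z. repeat split; try lra; try exact Hz2.
      unfold before. destruct (Rlt_dec y b); [ring|lra].
    + rewrite (stieltjes_sum_before_0 _ d) by (try lra; auto).
      unfold before. destruct (Rlt_dec y b).
      * exists x. repeat split; try lra; [|ring]. rewrite Rabs_pos_eq; lra.
      * exists h. repeat split; try lra; [|ring]. rewrite <- Rabs_Ropp, Rabs_pos_eq; lra.
Qed.

(** The Cauchy criterion with a centre [c] that may depend on [eps]: in this form
    it is stable under linear combinations and uniform limits. *)
Definition stieltjes_cauchy (gamma phi : R -> C) : Prop :=
  forall eps, 0 < eps -> exists c d, 0 < d /\ forall l, fine_subdivision d 0 l ->
    Cmod (stieltjes_sum gamma phi 0 l - c) < eps.

Lemma stieltjes_cauchy_lin (gamma phi psi : R -> C) (a : C) :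
  stieltjes_cauchy gamma phi -> stieltjes_cauchy gamma psi ->
  stieltjes_cauchy gamma (fun u => phi u + a * psi u)%C.
Proof.
  intros H1 H2 eps He.
  assert (Ha := Cmod_ge_0 a).
  destruct (H1 (eps / 2)) as [c1 [d1 [Hd1 K1]]]; [lra|].
  destruct (H2 (eps / (2 * (Cmod a + 1)))) as [c2 [d2 [Hd2 K2]]].
  { apply Rdiv_lt_0_compat; lra. }
  exists (c1 + a * c2)%C, (Rmin d1 d2). split; [now apply Rmin_glb_lt|].
  intros l Hl. rewrite stieltjes_sum_lin.
  assert (E1 := K1 l (fine_subdivision_mono _ _ _ _ (Rmin_l _ _) Hl)).
  assert (E2 := K2 l (fine_subdivision_mono _ _ _ _ (Rmin_r _ _) Hl)).
  set (s1 := stieltjes_sum gamma phi 0 l) in *. set (s2 := stieltjes_sum gamma psi 0 l) in *.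
  replace (s1 + a * s2 - (c1 + a * c2))%C with ((s1 - c1) + a * (s2 - c2))%C by ring.
  eapply Rle_lt_trans; [apply Cmod_triangle|]. rewrite Cmod_mult.
  assert (Cmod a * Cmod (s2 - c2) <= eps / 2).
  { apply Rle_trans with ((Cmod a + 1) * (eps / (2 * (Cmod a + 1)))).
    - apply Rmult_le_compat; try apply Cmod_ge_0; lra.
    - right. field. lra. }
  lra.
Qed.

Lemma stieltjes_cauchy_before (gamma : R -> C) (b : R) :
  path gamma -> 0 <= b -> stieltjes_cauchy gamma (before b).
Proof.
  intros Hg Hb eps He. destruct (Rle_dec b 1) as [Hb1|Hb1].
  - destruct (path_continuous gamma Hg b (conj Hb Hb1) eps He) as [d [Hd H]].
    exists (gamma b - gamma 0)%C, d. split; [exact Hd|]. intros l Hl.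
    destruct (stieltjes_sum_before gamma d b 0 l Hd (conj Hb Hb1) Hl) as [x [H1 [H2 ->]]].
    replace (gamma x - gamma 0 - (gamma b - gamma 0))%C with (gamma x - gamma b)%C by ring.
    now apply H.
  - exists (gamma 1 - gamma 0)%C, 1. split; [lra|]. intros l Hl.
    assert (E : forall h, 0 <= h -> fine_subdivision 1 h l ->
              stieltjes_sum gamma (before b) h l = stieltjes_sum gamma (fun _ => 1%C) h l).
    { clear Hl. induction l as [|[x y] l IH]; intros h Hh; cbn; [reflexivity|].
      intros [H1 [_ H2]]. assert (Hx := fine_subdivision_le _ _ _ H2).
      rewrite IH; [|lra|exact H2]. unfold before. destruct (Rlt_dec y b); [reflexivity|lra]. }
    rewrite E, (stieltjes_sum_one gamma 1) by (auto; lra). now rewrite Cmod_sub_diag.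
Qed.

Lemma stieltjes_cauchy_uniform_limit (gamma phi : R -> C) :
  path gamma ->
  (forall eps, 0 < eps -> exists psi, stieltjes_cauchy gamma psi /\
     forall u, 0 <= u <= 1 -> Cmod (phi u - psi u) <= eps) ->
  stieltjes_cauchy gamma phi.
Proof.
  intros Hg H eps He. destruct (path_length_bound gamma Hg) as [L [HL0 HL]].
  destruct (H (eps / (2 * L))) as [psi [H1 H2]]; [apply Rdiv_lt_0_compat; lra|].
  destruct (H1 (eps / 2)) as [c [d [Hd K]]]; [lra|].
  exists c, d. split; [exact Hd|]. intros l Hl.
  eapply Rle_lt_trans; [apply (Cmod_sub_triangle (stieltjes_sum gamma psi 0 l))|].
  rewrite stieltjes_sum_sub.
  assert (E := stieltjes_sum_bound gamma (fun u => phi u - psi u)%C _ d 0 l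
                 (Rle_refl 0) Hl H2).
  assert (V := variation_sum_le gamma L d l HL Hl). specialize (K l Hl).
  assert (eps / (2 * L) * variation_sum gamma 0 l <= eps / 2).
  { apply Rle_trans with (eps / (2 * L) * L).
    - apply Rmult_le_compat_l; [|exact V]. apply Rlt_le, Rdiv_lt_0_compat; lra.
    - right. field. lra. }
  lra.
Qed.

(** Continuous functions are uniform limits of step functions, and for step
    functions the sums telescope: this is where the integral comes from. *)
Lemma stieltjes_cauchy_continuous (gamma phi : R -> C) :
  path gamma ->
  (forall s, 0 <= s <= 1 -> forall eps, 0 < eps ->
     exists d, 0 < d /\ forall u, 0 <= u <= 1 -> Rabs (u - s) < d ->
       Cmod (phi u - phi s) < eps) ->
  stieltjes_cauchy gamma phi.
Proof.
  intros Hg Hphi. apply stieltjes_cauchy_uniform_limit; [exact Hg|]. intros eps He.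
  destruct (unit_interval_uniform (fun d u => forall v, 0 <= v <= 1 -> Rabs (v - u) < d ->
              Cmod (phi v - phi u) <= eps)) as [d [Hd H]].
  { intros d d' u Hd H v Hv Hvu. apply H; auto. lra. }
  { intros s Hs. destruct (Hphi s Hs (eps / 2)) as [d [Hd H]]; [lra|].
    exists (d / 2). split; [lra|]. intros u Hu Hus v Hv Hvu.
    assert (H1 := H u Hu ltac:(lra)).
    assert (Rabs (v - s) < d).
    { replace (v - s) with ((v - u) + (u - s)) by ring.
      eapply Rle_lt_trans; [apply Rabs_triang|]. lra. }
    assert (H2 := H v Hv ltac:(auto)).
    assert (H3 := Cmod_sub_triangle (phi s) (phi v) (phi u)).
    rewrite (Cmod_sub_sym (phi s)) in H3. lra. }
  assert (Hk : forall k, exists psi, stieltjes_cauchy gamma psi /\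
     forall u, 0 <= u <= 1 -> (u < INR k * d -> Cmod (phi u - psi u) <= eps) /\
                              (INR k * d <= u -> psi u = 0%C)).
  { induction k as [|k [psi [IH1 IH2]]].
    - exists (before 0). split.
      + apply stieltjes_cauchy_before; [exact Hg|lra].
      + intros u Hu. cbn [INR]. split; [intros; lra|]. intros _.
        unfold before. destruct (Rlt_dec u 0); [lra|reflexivity].
    - assert (Hkd : 0 <= INR k * d) by (apply Rmult_le_pos; [apply pos_INR|lra]).
      rewrite S_INR.
      destruct (Rle_dec (INR k * d) 1) as [Hb|Hb].
      + set (b := INR k * d) in *.
        replace ((INR k + 1) * d) with (b + d) by (unfold b; ring).
        exists (fun u => (psi u + phi b * before (b + d) u) + (- phi b) * before b u)%C.
        split.
        * repeat apply stieltjes_cauchy_lin; [exact IH1| |];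
            apply stieltjes_cauchy_before; auto; lra.
        * intros u Hu. destruct (IH2 u Hu) as [I1 I2]. unfold before.
          destruct (Rlt_dec u (b + d)), (Rlt_dec u b); split; intros; try lra.
          -- match goal with |- Cmod ?x <= _ => replace x with (phi u - psi u)%C by ring end.
             auto.
          -- rewrite I2 by lra.
             match goal with |- Cmod ?x <= _ => replace x with (phi u - phi b)%C by ring end.
             apply H; try lra. rewrite Rabs_pos_eq; lra.
          -- rewrite I2 by lra. ring.
      + exists psi. split; [exact IH1|]. intros u Hu. destruct (IH2 u Hu) as [I1 I2].
        split; intros; [apply I1; lra|]. exfalso. nra. }
  destruct (Rcomplements.nfloor_ex (/ d)) as [k [_ Hkd]]; [apply Rlt_le, Rinv_0_lt_compat, Hd|].
  destruct (Hk (S k)) as [psi [H1 H2]]. exists psi. split; [exact H1|].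
  intros u Hu. apply (H2 u Hu). rewrite S_INR.
  apply Rle_lt_trans with (/ d * d); [rewrite Rinv_l; lra|].
  apply Rmult_lt_compat_r; lra.
Qed.

Definition continuous_along (gamma : R -> C) (f : C -> C) : Prop :=
  forall s, 0 <= s <= 1 -> forall eps, 0 < eps ->
  exists d, 0 < d /\ forall u, 0 <= u <= 1 -> Rabs (u - s) < d ->
    Cmod (f (gamma u) - f (gamma s)) < eps.

Definition continuous_on_trace (gamma : R -> C) (f : C -> C) : Prop :=
  forall w, trace gamma w -> continuous f w.

Lemma trace_at (gamma : R -> C) (s : R) : 0 <= s <= 1 -> trace gamma (gamma s).
Proof. intros Hs. now exists s. Qed.

Lemma continuous_on_trace_along (gamma : R -> C) (f : C -> C) :
  path gamma -> continuous_on_trace gamma f -> continuous_along gamma f.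
Proof.
  intros Hg Hf s Hs eps He.
  destruct (proj1 (continuous_C f (gamma s)) (Hf _ (trace_at _ _ Hs)) eps He) as [e [Hpe H]].
  destruct (path_continuous gamma Hg s Hs e Hpe) as [d [Hd K]].
  exists d. split; [exact Hd|]. auto.
Qed.

Lemma contour_int_spec (gamma : R -> C) (f : C -> C) :
  path gamma -> continuous_along gamma f ->
  forall eps, 0 < eps -> exists d, 0 < d /\ forall l, fine_subdivision d 0 l ->
    Cmod (stieltjes_sum gamma (fun s => f (gamma s)) 0 l - contour_int gamma f) < eps.
Proof.
  intros Hg Hf.
  assert (Hc := stieltjes_cauchy_continuous gamma (fun s => f (gamma s)) Hg Hf).
  assert (PF := Riemann_fine_filter 0 1).
  destruct (proj1 (filterlim_locally_cauchy (U := C_R_CompleteNormedModule)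
                     (F := Riemann_fine 0 1) (contour_sum gamma f))) as [y Hy].
  { intros eps. destruct (Hc (eps / 2)) as [c [d [Hd K]]]; [assert (H := cond_pos eps); lra|].
    exists (fun ptd => Cmod (contour_sum gamma f ptd - c) < eps / 2). split.
    - apply Riemann_fine_spec. exists d. split; [exact Hd|]. intros l Hl.
      rewrite contour_sum_stieltjes. auto.
    - intros u v Hu Hv. apply C_NormedModule_mixin_compat1.
      change (Cmod (contour_sum gamma f v - contour_sum gamma f u) < eps).
      eapply Rle_lt_trans; [apply (Cmod_sub_triangle c)|].
      rewrite (Cmod_sub_sym c). lra. }
  assert (E : contour_int gamma f = y).
  { apply (iota_filterlim_locally (V := C_R_CompleteNormedModule)).
    exact Hy. }
  rewrite E. intros eps He.
  apply (proj1 (filterlim_C (contour_sum gamma f) y)) with (eps := eps) in Hy; [|exact He].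
  apply Riemann_fine_spec in Hy. destruct Hy as [d [Hd K]]. exists d. split; [exact Hd|].
  intros l Hl. specialize (K l Hl). now rewrite contour_sum_stieltjes in K.
Qed.

(** * The contour integral as a limit of midpoint sums *)

Definition node (N i : nat) : R := INR i / (INR N + 1).
Definition midtag (N i : nat) : R := (INR i + / 2) / (INR N + 1).

(** Placing the tags in the middle makes these sums exactly compatible with
    reversing and with halving a segment, and makes them explicit on a circle. *)
Definition midpoint_sum (gamma : R -> C) (f : C -> C) (N : nat) : C :=
  sum_n (fun i => ((gamma (node N (S i)) - gamma (node N i)) * f (gamma (midtag N i)))%C) N.

Lemma Csum_Sn (a : nat -> C) (n : nat) : sum_n a (S n) = (sum_n a n + a (S n))%C.
Proof. exact (sum_Sn a n). Qed.

Lemma Csum_first (a : nat -> C) (n : nat) :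
  sum_n a (S n) = (a 0%nat + sum_n (fun i => a (S i)) n)%C.
Proof. exact (sum_n_first a n). Qed.

Lemma Csum_plus (a b : nat -> C) (n : nat) :
  sum_n (fun i => a i + b i)%C n = (sum_n a n + sum_n b n)%C.
Proof. exact (sum_n_plus a b n). Qed.

Lemma Csum_mult_l (c : C) (a : nat -> C) (n : nat) :
  sum_n (fun i => c * a i)%C n = (c * sum_n a n)%C.
Proof. exact (sum_n_mult_l (K := C_Ring) c a n). Qed.

Lemma Csum_minus (a b : nat -> C) (n : nat) :
  sum_n (fun i => a i - b i)%C n = (sum_n a n - sum_n b n)%C.
Proof.
  induction n as [|n IH]; [now rewrite !sum_O|]. rewrite !Csum_Sn, IH. C_ring.
Qed.

Lemma Csum_rev (u : nat -> C) (n : nat) : sum_n u n = sum_n (fun i => u (n - i)%nat) n.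
Proof.
  induction n as [|n IH]; [now rewrite !sum_O|].
  rewrite (Csum_first (fun i => u (S n - i)%nat)), Csum_Sn, IH. cbn [Nat.sub]. C_ring.
Qed.

Lemma Csum_split (u : nat -> C) (n m : nat) :
  sum_n u (n + S m) = (sum_n u n + sum_n (fun i => u (S n + i)%nat) m)%C.
Proof.
  induction m as [|m IH].
  - rewrite sum_O, Nat.add_1_r, Nat.add_0_r. apply Csum_Sn.
  - rewrite (Nat.add_succ_r n (S m)), !Csum_Sn, IH.
    replace (S n + S m)%nat with (S (n + S m)) by lia. C_ring.
Qed.

Lemma Csum_telescope (u : nat -> C) (n : nat) :
  sum_n (fun i => u (S i) - u i)%C n = (u (S n) - u 0%nat)%C.
Proof.
  induction n as [|n IH]; [now rewrite sum_O|]. rewrite Csum_Sn, IH. C_ring.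
Qed.

Lemma Csum_bound (a : nat -> C) (b : nat -> R) (M : R) (n : nat) :
  (forall i, (i <= n)%nat -> Cmod (a i) <= M * b i) ->
  Cmod (sum_n a n) <= M * sum_n b n.
Proof.
  induction n as [|n IH]; intros H.
  - rewrite !sum_O. apply H. lia.
  - rewrite Csum_Sn, sum_Sn. unfold plus at 1; cbn.
    eapply Rle_trans; [apply Cmod_triangle|]. rewrite Rmult_plus_distr_l.
    apply Rplus_le_compat; [apply IH; auto|apply H; lia].
Qed.

Lemma INR_succ_pos (N : nat) : 0 < INR N + 1.
Proof. assert (H := pos_INR N). lra. Qed.

Lemma node_bounds (N i : nat) : (i <= S N)%nat -> 0 <= node N i <= 1.
Proof.
  intros Hi. assert (H := INR_succ_pos N). unfold node. split.
  - apply Rdiv_le_0_compat; [apply pos_INR|exact H].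
  - apply Rmult_le_reg_r with (INR N + 1); [exact H|].
    unfold Rdiv. rewrite Rmult_assoc, Rinv_l, Rmult_1_r, Rmult_1_l by lra.
    rewrite <- S_INR. now apply le_INR.
Qed.

Lemma node_S (N i : nat) : node N (S i) = node N i + / (INR N + 1).
Proof. unfold node. rewrite S_INR. assert (H := INR_succ_pos N). field. lra. Qed.

Lemma midtag_node (N i : nat) : midtag N i = node N i + / 2 * / (INR N + 1).
Proof. unfold node, midtag. assert (H := INR_succ_pos N). field. lra. Qed.

Lemma node_0 (N : nat) : node N 0 = 0.
Proof. unfold node. cbn. field. assert (H := INR_succ_pos N). lra. Qed.

Lemma node_last (N : nat) : node N (S N) = 1.
Proof. unfold node. rewrite S_INR. field. assert (H := INR_succ_pos N). lra. Qed.

Lemma inv_succ_pos (N : nat) : 0 < / (INR N + 1).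
Proof. apply Rinv_0_lt_compat, INR_succ_pos. Qed.

Lemma midtag_between (N i : nat) : node N i <= midtag N i <= node N (S i).
Proof. rewrite node_S, midtag_node. assert (H := inv_succ_pos N). lra. Qed.

Lemma midtag_bounds (N i : nat) : (i <= N)%nat -> 0 <= midtag N i <= 1.
Proof.
  intros Hi. assert (H := midtag_between N i).
  assert (H1 := node_bounds N i ltac:(lia)). assert (H2 := node_bounds N (S i) ltac:(lia)). lra.
Qed.

Lemma inv_succ_small (d : R) : 0 < d ->
  exists N0, forall N, (N0 <= N)%nat -> / (INR N + 1) < d.
Proof.
  intros Hd. destruct (Rcomplements.nfloor_ex (/ d)) as [k [_ Hk]];
    [apply Rlt_le, Rinv_0_lt_compat, Hd|].
  exists k. intros N HN. apply le_INR in HN.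
  rewrite <- (Rinv_inv d). apply Rinv_lt_contravar; [|lra].
  apply Rmult_lt_0_compat; [apply Rinv_0_lt_compat, Hd|apply INR_succ_pos].
Qed.

(** [k] is the first cell and [n] the number of cells. *)
Fixpoint uniform_cells (N k n : nat) : list (R * R) :=
  match n with
  | O => nil
  | S n' => (node N (S k), midtag N k) :: uniform_cells N (S k) n'
  end.

Lemma uniform_cells_fine (d : R) (N k n : nat) :
  / (INR N + 1) < d -> (k + n = S N)%nat -> fine_subdivision d (node N k) (uniform_cells N k n).
Proof.
  intros Hd. revert k. induction n as [|n IH]; intros k Hk.
  - cbn. replace k with (S N) by lia. apply node_last.
  - cbn. split; [apply midtag_between|]. split; [rewrite node_S; lra|]. apply IH. lia.
Qed.

Lemma uniform_cells_sum (gamma : R -> C) (f : C -> C) (N k n : nat) :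
  stieltjes_sum gamma (fun s => f (gamma s)) (node N k) (uniform_cells N k (S n)) =
  sum_n (fun i => ((gamma (node N (S (k + i))) - gamma (node N (k + i)))
                   * f (gamma (midtag N (k + i))))%C) n.
Proof.
  revert k. induction n as [|n IH]; intros k.
  - rewrite sum_O. cbn. rewrite Nat.add_0_r. ring.
  - rewrite Csum_first. rewrite Nat.add_0_r.
    change (stieltjes_sum gamma (fun s => f (gamma s)) (node N k) (uniform_cells N k (S (S n))))
      with ((gamma (node N (S k)) - gamma (node N k)) * f (gamma (midtag N k)) +
        stieltjes_sum gamma (fun s => f (gamma s)) (node N (S k)) (uniform_cells N (S k) (S n)))%C.
    rewrite IH. f_equal. apply sum_n_ext. intros i.
    now replace (S k + i)%nat with (k + S i)%nat by lia.
Qed.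

Lemma contour_int_lim_along (gamma : R -> C) (f : C -> C) :
  path gamma -> continuous_along gamma f ->
  filterlim (midpoint_sum gamma f) eventually (locally (contour_int gamma f)).
Proof.
  intros Hg Hf. apply (filterlim_C (midpoint_sum gamma f)). intros eps He.
  destruct (contour_int_spec gamma f Hg Hf eps He) as [d [Hd H]].
  destruct (inv_succ_small d Hd) as [N0 HN0].
  exists N0. intros N HN.
  assert (E := uniform_cells_sum gamma f N 0 N). cbn [Nat.add] in E.
  unfold midpoint_sum. rewrite <- E, node_0. apply H. rewrite <- (node_0 N).
  apply uniform_cells_fine; [auto|lia].
Qed.

Lemma contour_int_lim (gamma : R -> C) (f : C -> C) :
  path gamma -> continuous_on_trace gamma f ->
  filterlim (midpoint_sum gamma f) eventually (locally (contour_int gamma f)).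
Proof.
  intros Hg Hf. apply contour_int_lim_along; [exact Hg|]. now apply continuous_on_trace_along.
Qed.

Lemma Clim_unique (u : nat -> C) (l l' : C) :
  filterlim u eventually (locally l) -> filterlim u eventually (locally l') -> l = l'.
Proof. exact (filterlim_locally_unique (V := C_NormedModule) (F := eventually) u l l'). Qed.

Lemma contour_int_unique (gamma : R -> C) (f : C -> C) (l : C) :
  path gamma -> continuous_on_trace gamma f ->
  filterlim (midpoint_sum gamma f) eventually (locally l) -> contour_int gamma f = l.
Proof.
  intros Hg Hf H. eapply Clim_unique; [apply contour_int_lim; assumption|exact H].
Qed.

Lemma Clim_lin (u v : nat -> C) (a l m : C) :
  filterlim u eventually (locally l) -> filterlim v eventually (locally m) ->
  filterlim (fun n => u n + a * v n)%C eventually (locally (l + a * m)%C).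
Proof.
  intros Hu Hv.
  assert (Hv' : filterlim (fun n => a * v n)%C eventually (locally (a * m)%C)).
  { exact (filterlim_comp _ _ _ v (fun z => a * z)%C eventually _ _ Hv
             (filterlim_scal_r (V := C_NormedModule) a m)). }
  exact (filterlim_comp_2 _ _ _ Hu Hv' (filterlim_plus (V := C_NormedModule) l (a * m)%C)).
Qed.

Lemma midpoint_sum_ext (gamma : R -> C) (f g : C -> C) (N : nat) :
  (forall w, trace gamma w -> f w = g w) -> midpoint_sum gamma f N = midpoint_sum gamma g N.
Proof.
  intros H. apply sum_n_ext_loc. intros i Hi. f_equal. apply H, trace_at, midtag_bounds, Hi.
Qed.

Lemma contour_int_ext (gamma : R -> C) (f g : C -> C) :
  path gamma -> continuous_on_trace gamma g -> (forall w, trace gamma w -> f w = g w) ->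
  contour_int gamma f = contour_int gamma g.
Proof.
  intros Hg Hc He. assert (Ha := continuous_on_trace_along gamma g Hg Hc).
  eapply Clim_unique; [apply contour_int_lim_along; [exact Hg|]|].
  - intros s Hs eps Heps. destruct (Ha s Hs eps Heps) as [d [Hd H]].
    exists d. split; [exact Hd|]. intros u Hu Hus.
    rewrite !He by now apply trace_at. auto.
  - eapply filterlim_ext; [|apply contour_int_lim; [exact Hg|exact Hc]].
    intros N. symmetry. now apply midpoint_sum_ext.
Qed.

Lemma continuous_lin (f g : C -> C) (a w : C) :
  continuous f w -> continuous g w -> continuous (fun t => f t + a * g t)%C w.
Proof.
  intros Hf Hg.
  apply (continuous_plus (V := C_NormedModule) f (fun t => a * g t)%C w Hf).
  exact (continuous_scal_r (V := C_NormedModule) a g w Hg).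
Qed.

Lemma contour_int_lin (gamma : R -> C) (f g : C -> C) (a : C) :
  path gamma -> continuous_on_trace gamma f -> continuous_on_trace gamma g ->
  contour_int gamma (fun t => f t + a * g t)%C =
  (contour_int gamma f + a * contour_int gamma g)%C.
Proof.
  intros Hg Hf Hh. apply contour_int_unique; [exact Hg| |].
  - intros w Hw. apply continuous_lin; auto.
  - eapply filterlim_ext; [|apply Clim_lin; apply contour_int_lim; eassumption].
    intros N. unfold midpoint_sum. rewrite <- Csum_mult_l, <- Csum_plus.
    apply sum_n_ext. intros i. cbn. ring.
Qed.

Lemma contour_int_scal (gamma : R -> C) (f : C -> C) (a : C) :
  path gamma -> continuous_on_trace gamma f ->
  contour_int gamma (fun t => a * f t)%C = (a * contour_int gamma f)%C.
Proof.
  intros Hg Hf.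
  replace (a * contour_int gamma f)%C
    with (contour_int gamma f + (a - 1) * contour_int gamma f)%C by ring.
  rewrite <- contour_int_lin by assumption. apply contour_int_ext; [exact Hg| |].
  - intros w Hw. apply continuous_lin; auto.
  - intros w _. ring.
Qed.

Lemma Clim_bound (u : nat -> C) (l : C) (M : R) :
  filterlim u eventually (locally l) -> (forall n, Cmod (u n) <= M) -> Cmod l <= M.
Proof.
  intros H HM. apply Rnot_lt_le. intros Hlt.
  destruct (proj1 (filterlim_C u l) H (Cmod l - M)) as [N HN]; [lra|].
  specialize (HN N (Nat.le_refl N)). specialize (HM N).
  assert (E := Cmod_triangle (u N) (l - u N)). rewrite (Cmod_sub_sym l) in E.
  replace (u N + (l - u N))%C with l in E by ring. lra.
Qed.

Lemma midpoint_variation (gamma : R -> C) (L : R) (N : nat) :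
  length_bound gamma L ->
  sum_n (fun i => Cmod (gamma (node N (S i)) - gamma (node N i))) N <= L.
Proof.
  intros HL.
  rewrite (sum_n_ext_loc _ (fun i => Cmod (gamma (Rmin (node N (S i)) 1)
                                          - gamma (Rmin (node N i) 1)))).
  - apply (HL (fun i => Rmin (node N i) 1) N).
    + intros i. split; [|apply Rmin_r]. apply Rmin_glb; [|lra].
      apply Rdiv_le_0_compat; [apply pos_INR|apply INR_succ_pos].
    + intros i. apply Rle_min_compat_r. rewrite node_S. assert (H := inv_succ_pos N). lra.
  - intros i Hi. rewrite !Rmin_left; [reflexivity| |]; apply node_bounds; lia.
Qed.

Lemma contour_int_bound (gamma : R -> C) (f : C -> C) (M L : R) :
  path gamma -> continuous_on_trace gamma f -> length_bound gamma L ->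
  (forall w, trace gamma w -> Cmod (f w) <= M) -> Cmod (contour_int gamma f) <= M * L.
Proof.
  intros Hg Hf HL HM. eapply Clim_bound; [apply contour_int_lim; assumption|].
  intros N. assert (M0 : 0 <= M).
  { eapply Rle_trans; [apply Cmod_ge_0|apply (HM (gamma 0)), trace_at; lra]. }
  eapply Rle_trans; [|apply Rmult_le_compat_l; [exact M0|apply (midpoint_variation gamma L N HL)]].
  apply Csum_bound. intros i Hi. rewrite Cmod_mult, Rmult_comm.
  apply Rmult_le_compat_r; [apply Cmod_ge_0|]. apply HM, trace_at, midtag_bounds, Hi.
Qed.

Lemma trace_bounded (gamma : R -> C) (f : C -> C) :
  path gamma -> continuous_on_trace gamma f ->
  exists M, 0 < M /\ forall w, trace gamma w -> Cmod (f w) <= M.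
Proof.
  intros Hg Hf. apply continuous_on_trace_along in Hf; [|exact Hg].
  destruct (unit_interval_uniform (fun d u => d * Cmod (f (gamma u)) <= 1)) as [d [Hd H]].
  - intros d d' u Hd H. eapply Rle_trans; [|exact H].
    apply Rmult_le_compat_r; [apply Cmod_ge_0|exact Hd].
  - intros s Hs. destruct (Hf s Hs 1 Rlt_0_1) as [d [Hd H]].
    assert (P := Cmod_ge_0 (f (gamma s))).
    assert (P' : 0 < / (Cmod (f (gamma s)) + 1)) by (apply Rinv_0_lt_compat; lra).
    exists (Rmin d (/ (Cmod (f (gamma s)) + 1))). split; [now apply Rmin_glb_lt|].
    intros u Hu Hus. specialize (H u Hu (Rlt_le_trans _ _ _ Hus (Rmin_l _ _))).
    assert (E := Cmod_triangle (f (gamma s)) (f (gamma u) - f (gamma s))).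
    replace (f (gamma s) + (f (gamma u) - f (gamma s)))%C with (f (gamma u)) in E by ring.
    apply Rle_trans with (/ (Cmod (f (gamma s)) + 1) * (Cmod (f (gamma s)) + 1)).
    + apply Rmult_le_compat; try apply Cmod_ge_0; [|apply Rmin_r|lra].
      apply Rlt_le, Rmin_glb_lt; assumption.
    + right. field. lra.
  - exists (/ d). split; [now apply Rinv_0_lt_compat|]. intros w [u [Hu <-]].
    apply Rmult_le_reg_l with d; [exact Hd|]. rewrite Rinv_r by lra. now apply H.
Qed.

Lemma trace_distance (gamma : R -> C) (w : C) :
  path gamma -> ~ trace gamma w ->
  exists d, 0 < d /\ forall v, trace gamma v -> d <= Cmod (v - w).
Proof.
  intros Hg Hw.
  destruct (unit_interval_uniform (fun d u => d <= Cmod (gamma u - w))) as [d [Hd H]].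
  - intros d d' u Hd H. lra.
  - intros s Hs.
    assert (P : 0 < Cmod (gamma s - w)).
    { apply Cmod_gt_0, Csub_neq_0. intros E. apply Hw. now exists s. }
    destruct (path_continuous gamma Hg s Hs (Cmod (gamma s - w) / 2)) as [d [Hd H]]; [lra|].
    exists (Rmin d (Cmod (gamma s - w) / 2)). split; [apply Rmin_glb_lt; lra|].
    intros u Hu Hus. specialize (H u Hu (Rlt_le_trans _ _ _ Hus (Rmin_l _ _))).
    assert (E := Cmod_sub_triangle (gamma u) (gamma s) w).
    rewrite Cmod_sub_sym in H.
    eapply Rle_trans; [apply Rmin_r|]. lra.
  - exists d. split; [exact Hd|]. intros v [u [Hu <-]]. now apply H.
Qed.

Lemma lipschitz_length (gamma : R -> C) (K : R) :
  (forall s t, 0 <= s <= 1 -> 0 <= t <= 1 -> Cmod (gamma t - gamma s) <= K * Rabs (t - s)) ->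
  length_bound gamma K.
Proof.
  intros HK sigma n H1 H2.
  assert (K0 : 0 <= K).
  { assert (E := HK 0 1 ltac:(lra) ltac:(lra)). rewrite Rminus_0_r, Rabs_R1 in E.
    assert (P := Cmod_ge_0 (gamma 1 - gamma 0)). lra. }
  assert (E : sum_n (fun i => Cmod (gamma (sigma (S i)) - gamma (sigma i))) n <=
              K * (sigma (S n) - sigma 0%nat)).
  { induction n as [|n IH].
    - rewrite sum_O. eapply Rle_trans; [apply HK; apply H1|].
      rewrite Rabs_pos_eq; [lra|]. specialize (H2 0%nat). lra.
    - rewrite sum_Sn.
      assert (E := HK _ _ (H1 (S n)) (H1 (S (S n)))). specialize (H2 (S n)).
      rewrite Rabs_pos_eq in E by lra. 
      eapply Rle_trans; [apply (Rplus_le_compat _ _ _ _ IH E)|lra]. }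
  eapply Rle_trans; [exact E|]. assert (A := H1 (S n)). assert (B := H1 0%nat). nra.
Qed.

Lemma lipschitz_path (gamma : R -> C) (K : R) :
  (forall s t, 0 <= s <= 1 -> 0 <= t <= 1 -> Cmod (gamma t - gamma s) <= K * Rabs (t - s)) ->
  path gamma.
Proof.
  intros HK. split; [|exists K; now apply lipschitz_length]. intros t Ht.
  assert (FF : Filter (within (fun s => 0 <= s <= 1) (locally t)))
    by (apply within_filter, locally_filter).
  apply (filterlim_C gamma (gamma t)). intros eps He.
  assert (K0 : 0 <= K).
  { assert (E := HK 0 1 ltac:(lra) ltac:(lra)). rewrite Rminus_0_r, Rabs_R1 in E.
    assert (P := Cmod_ge_0 (gamma 1 - gamma 0)). lra. }
  assert (Hd : 0 < eps / (K + 1)) by (apply Rdiv_lt_0_compat; lra).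
  exists (mkposreal _ Hd). intros u Hu Hu1. change (Rabs (u - t) < eps / (K + 1)) in Hu.
  eapply Rle_lt_trans; [apply HK; assumption|]. assert (P := Rabs_pos (u - t)).
  apply Rle_lt_trans with (Rabs (u - t) * (K + 1)); [nra|].
  apply Rlt_le_trans with (eps / (K + 1) * (K + 1)).
  - apply Rmult_lt_compat_r; lra.
  - right. field. lra.
Qed.

(** ** Affine images of a path *)

Definition affine_path (c a : C) (gamma : R -> C) (s : R) : C := (c + a * gamma s)%C.

Lemma affine_path_path (c a : C) (gamma : R -> C) : path gamma -> path (affine_path c a gamma).
Proof.
  intros Hg. split.
  - intros t Ht.
    assert (FF : Filter (within (fun s => 0 <= s <= 1) (locally t)))
      by (apply within_filter, locally_filter).
    apply (filterlim_C (affine_path c a gamma) (affine_path c a gamma t)). intros eps He.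
    assert (Ha := Cmod_ge_0 a).
    destruct (path_continuous gamma Hg t Ht (eps / (Cmod a + 1))) as [d [Hd H]];
      [apply Rdiv_lt_0_compat; lra|].
    exists (mkposreal d Hd). intros u Hu1 Hu2. specialize (H u Hu2 Hu1). unfold affine_path.
    replace (c + a * gamma u - (c + a * gamma t))%C with (a * (gamma u - gamma t))%C by ring.
    rewrite Cmod_mult.
    apply Rle_lt_trans with (Cmod a * (eps / (Cmod a + 1))).
    + apply Rmult_le_compat_l; [exact Ha|lra].
    + apply Rmult_lt_reg_r with (Cmod a + 1); [lra|]. field_simplify; [nra|lra].
  - destruct (path_length_bound gamma Hg) as [L [_ HL]]. exists (Cmod a * L).
    intros sigma n H1 H2.
    eapply Rle_trans; [|apply Rmult_le_compat_l; [apply Cmod_ge_0|apply (HL sigma n H1 H2)]].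
    right. rewrite <- (sum_n_mult_l (K := R_Ring) (Cmod a)). apply sum_n_ext. intros i.
    change (mult (Cmod a)) with (Rmult (Cmod a)). rewrite <- Cmod_mult. f_equal.
    unfold affine_path. ring.
Qed.

Lemma affine_path_trace (c a : C) (gamma : R -> C) (v : C) :
  trace (affine_path c a gamma) v -> exists u, trace gamma u /\ v = (c + a * u)%C.
Proof. intros [s [Hs <-]]. exists (gamma s). split; [now apply trace_at|reflexivity]. Qed.

(** * Complex derivatives *)

Notation C_is_derive := (is_derive (K := C_AbsRing) (V := C_NormedModule)).

Lemma is_derive_eps {K : AbsRing} {V : NormedModule K} (f : K -> V) (x : K) (l : V) :
  is_derive f x l <-> forall eps, 0 < eps -> exists d, 0 < d /\
    forall y, abs (minus y x) < d ->
      norm (minus (minus (f y) (f x)) (scal (minus y x) l)) <= eps * abs (minus y x).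
Proof.
  split.
  - intros [_ H] eps He.
    destruct (H x (fun P HP => HP) (mkposreal eps He)) as [d K0].
    exists d. split; [apply cond_pos|]. intros y Hy. apply K0. exact Hy.
  - intros H. split; [apply is_linear_scal_l|]. intros y Hy eps.
    apply (is_filter_lim_locally_unique (V := AbsRing_NormedModule K)) in Hy. subst y.
    destruct (H eps (cond_pos eps)) as [d [Hd K0]]. exists (mkposreal d Hd).
    intros y Hy. apply K0. exact Hy.
Qed.

Lemma C_is_derive_eps (f : C -> C) (w l : C) :
  C_is_derive f w l <-> forall eps, 0 < eps -> exists d, 0 < d /\
    forall v, Cmod (v - w) < d -> Cmod (f v - f w - (v - w) * l) <= eps * Cmod (v - w).
Proof. exact (is_derive_eps (K := C_AbsRing) (V := C_NormedModule) f w l). Qed.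

(** Coquelicot's rules for functions into the scalars see [C] as a module over
    itself with the topology of the modulus instead of the product topology. *)
Lemma C_is_derive_scalar (f : C -> C) (w l : C) :
  is_derive (K := C_AbsRing) (V := AbsRing_NormedModule C_AbsRing) f w l <-> C_is_derive f w l.
Proof.
  rewrite C_is_derive_eps.
  exact (is_derive_eps (K := C_AbsRing) (V := AbsRing_NormedModule C_AbsRing) f w l).
Qed.

Lemma C_is_derive_ext_loc (f g : C -> C) (w l : C) (r : R) : 0 < r ->
  (forall v, Cmod (v - w) < r -> f v = g v) -> C_is_derive f w l -> C_is_derive g w l.
Proof.
  intros Hr Hfg. apply (is_derive_ext_loc (K := C_AbsRing) (V := C_NormedModule)).
  exists (mkposreal r Hr). intros v Hv. apply Hfg. exact Hv.
Qed.

Lemma C_is_derive_eq (f : C -> C) (w l l' : C) : l = l' -> C_is_derive f w l -> C_is_derive f w l'.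
Proof. now intros <-. Qed.

Lemma C_is_derive_unique (f : C -> C) (w l l' : C) :
  C_is_derive f w l -> C_is_derive f w l' -> l = l'.
Proof.
  intros H H'. rewrite <- (is_C_derive_unique f w l H). now apply is_C_derive_unique.
Qed.

Lemma C_is_derive_continuous (f : C -> C) (w l : C) : C_is_derive f w l -> continuous f w.
Proof.
  intros H. apply continuous_C. intros eps He.
  destruct (proj1 (C_is_derive_eps f w l) H 1 Rlt_0_1) as [d [Hd K]].
  assert (Hl := Cmod_ge_0 l).
  exists (Rmin d (eps / (Cmod l + 2))).
  assert (P : 0 < eps / (Cmod l + 2)) by (apply Rdiv_lt_0_compat; lra).
  split; [now apply Rmin_glb_lt|]. intros v Hv.
  assert (H1 := Rlt_le_trans _ _ _ Hv (Rmin_l _ _)).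
  assert (H2 := Rlt_le_trans _ _ _ Hv (Rmin_r _ _)).
  specialize (K v H1).
  replace (f v - f w)%C with ((f v - f w - (v - w) * l) + (v - w) * l)%C by ring.
  eapply Rle_lt_trans; [apply Cmod_triangle|]. rewrite Cmod_mult.
  assert (E : Cmod (v - w) * (Cmod l + 2) < eps).
  { apply Rlt_le_trans with (eps / (Cmod l + 2) * (Cmod l + 2)).
    - apply Rmult_lt_compat_r; lra.
    - right. field. lra. }
  assert (Hv0 := Cmod_ge_0 (v - w)). nra.
Qed.

Lemma C_is_derive_id (w : C) : C_is_derive (fun t => t) w (RtoC 1).
Proof. apply C_is_derive_scalar. exact (is_derive_id (K := C_AbsRing) w). Qed.

Lemma C_is_derive_const (a w : C) : C_is_derive (fun _ => a) w (RtoC 0).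
Proof. exact (is_derive_const (K := C_AbsRing) (V := C_NormedModule) a w). Qed.

Lemma C_is_derive_plus (f g : C -> C) (w l m : C) :
  C_is_derive f w l -> C_is_derive g w m -> C_is_derive (fun t => f t + g t)%C w (l + m)%C.
Proof. exact (is_derive_plus (K := C_AbsRing) (V := C_NormedModule) f g w l m). Qed.

Lemma C_is_derive_minus (f g : C -> C) (w l m : C) :
  C_is_derive f w l -> C_is_derive g w m -> C_is_derive (fun t => f t - g t)%C w (l - m)%C.
Proof. exact (is_derive_minus (K := C_AbsRing) (V := C_NormedModule) f g w l m). Qed.

Lemma C_is_derive_mult (f g : C -> C) (w l m : C) :
  C_is_derive f w l -> C_is_derive g w m ->
  C_is_derive (fun t => f t * g t)%C w (l * g w + f w * m)%C.
Proof.
  intros Hf Hg. apply C_is_derive_scalar in Hf, Hg. apply C_is_derive_scalar.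
  exact (is_derive_mult (K := C_AbsRing) f g w l m Hf Hg Cmult_comm).
Qed.

Lemma C_is_derive_scal (f : C -> C) (a w l : C) :
  C_is_derive f w l -> C_is_derive (fun t => a * f t)%C w (a * l)%C.
Proof.
  intros Hf. replace (a * l)%C with (0 * f w + a * l)%C by ring.
  apply (C_is_derive_mult (fun _ => a)); [apply C_is_derive_const|exact Hf].
Qed.

Lemma C_is_derive_comp (f g : C -> C) (w l m : C) :
  C_is_derive f (g w) l -> C_is_derive g w m -> C_is_derive (fun t => f (g t)) w (m * l)%C.
Proof.
  intros Hf Hg. apply C_is_derive_scalar in Hg.
  exact (is_derive_comp (K := C_AbsRing) (V := C_NormedModule) f g w l m Hf Hg).
Qed.

Lemma C_is_derive_affine (c a w : C) : C_is_derive (fun t => c + a * t)%C w a.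
Proof.
  apply (C_is_derive_eq _ _ (0 + a * 1)%C); [ring|].
  apply (C_is_derive_plus (fun _ => c)); [apply C_is_derive_const|].
  apply C_is_derive_scal, C_is_derive_id.
Qed.

Lemma C_is_derive_inv_id (w : C) : w <> 0%C -> C_is_derive (fun t => / t)%C w (- / (w * w))%C.
Proof.
  intros Hw. apply C_is_derive_eps. intros eps He.
  assert (P : 0 < Cmod w) by now apply Cmod_gt_0.
  exists (Rmin (Cmod w / 2) (eps * (Cmod w * Cmod w * Cmod w) / 2)). split.
  { apply Rmin_glb_lt; [lra|].
    apply Rdiv_lt_0_compat; [|lra]. repeat apply Rmult_lt_0_compat; lra. }
  intros v Hv.
  assert (H1 := Rlt_le_trans _ _ _ Hv (Rmin_l _ _)).
  assert (H2 := Rlt_le_trans _ _ _ Hv (Rmin_r _ _)).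
  assert (Pv : Cmod w / 2 <= Cmod v).
  { assert (E := Cmod_triangle v (w - v)). rewrite (Cmod_sub_sym w) in E.
    replace (v + (w - v))%C with w in E by ring. lra. }
  assert (Hv0 : v <> 0%C) by (apply Cmod_gt_0; lra).
  replace (/ v - / w - (v - w) * - / (w * w))%C
    with ((v - w) * ((v - w) * / (v * (w * w))))%C by (field; auto).
  rewrite Cmod_mult, Rmult_comm. apply Rmult_le_compat_r; [apply Cmod_ge_0|].
  assert (Hww : (w * w)%C <> 0%C) by now apply Cmult_neq_0.
  rewrite Cmod_mult, Cmod_inv, !Cmod_mult by now apply Cmult_neq_0.
  set (a := Cmod w) in *. set (b := Cmod v) in *. set (c := Cmod (v - w)) in *.
  apply Rmult_le_reg_r with (b * (a * a)).
  { repeat apply Rmult_lt_0_compat; lra. }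
  rewrite Rmult_assoc, Rinv_l by (apply Rgt_not_eq; repeat apply Rmult_lt_0_compat; lra).
  assert (0 < a * a) by nra.
  assert (eps * (a / 2 * (a * a)) <= eps * (b * (a * a))).
  { apply Rmult_le_compat_l; [lra|]. apply Rmult_le_compat_r; lra. }
  lra.
Qed.

Lemma C_is_derive_inv (f : C -> C) (w l : C) :
  f w <> 0%C -> C_is_derive f w l ->
  C_is_derive (fun t => / f t)%C w (- l / (f w * f w))%C.
Proof.
  intros Hw Hf. replace (- l / (f w * f w))%C with (l * - / (f w * f w))%C by (field; auto).
  apply (C_is_derive_comp (fun t => / t)%C); [now apply C_is_derive_inv_id|exact Hf].
Qed.

Fixpoint Cpow_inv (n : nat) (t : C) : C :=
  match n with O => 1%C | S n' => (/ t * Cpow_inv n' t)%C end.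

Lemma C_is_derive_pow_inv (n : nat) (w : C) : w <> 0%C ->
  C_is_derive (Cpow_inv n) w (- INR n * Cpow_inv (S n) w)%C.
Proof.
  intros Hw. induction n as [|n IH].
  - replace (- INR 0 * Cpow_inv 1 w)%C with (RtoC 0) by (cbn; ring). apply C_is_derive_const.
  - replace (- INR (S n) * Cpow_inv (S (S n)) w)%C
      with (- / (w * w) * Cpow_inv n w + / w * (- INR n * Cpow_inv (S n) w))%C.
    + apply (C_is_derive_mult (fun t => / t)%C); [now apply C_is_derive_inv_id|exact IH].
    + rewrite S_INR, RtoC_plus. cbn [Cpow_inv]. field. exact Hw.
Qed.

Lemma continuous_Cmult {X : UniformSpace} (f g : X -> C) (w : X) :
  continuous f w -> continuous g w -> continuous (fun t => f t * g t)%C w.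
Proof.
  intros Hf Hg. apply (filterlim_C (fun t => f t * g t)%C). intros eps He.
  assert (Pf := Cmod_ge_0 (f w)). assert (Pg := Cmod_ge_0 (g w)).
  set (e := Rmin 1 (eps / (Cmod (f w) + Cmod (g w) + 2))).
  assert (He' : 0 < e) by (apply Rmin_glb_lt; [lra|apply Rdiv_lt_0_compat; lra]).
  generalize (filter_and _ _ (proj1 (filterlim_C f (f w)) Hf e He')
                             (proj1 (filterlim_C g (g w)) Hg e He')).
  apply filter_imp. intros v [H1 H2].
  replace (f v * g v - f w * g w)%C
    with ((f v - f w) * (g v - g w) + ((f v - f w) * g w + f w * (g v - g w)))%C by ring.
  eapply Rle_lt_trans; [apply Cmod_triangle|].
  eapply Rle_lt_trans; [apply Rplus_le_compat_l, Cmod_triangle|]. rewrite !Cmod_mult.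
  assert (E1 : e <= 1) by apply Rmin_l.
  assert (E2 : e * (Cmod (f w) + Cmod (g w) + 2) <= eps).
  { apply Rle_trans with (eps / (Cmod (f w) + Cmod (g w) + 2) * (Cmod (f w) + Cmod (g w) + 2)).
    - apply Rmult_le_compat_r; [lra|apply Rmin_r].
    - right. field. lra. }
  assert (0 <= Cmod (f v - f w)) by apply Cmod_ge_0.
  assert (0 <= Cmod (g v - g w)) by apply Cmod_ge_0.
  nra.
Qed.

Lemma C_is_derive_sub (w t : C) : C_is_derive (fun t => t - w)%C t (RtoC 1).
Proof.
  apply (C_is_derive_eq _ _ (1 - 0)%C); [ring|].
  apply (C_is_derive_minus (fun t => t) (fun _ => w));
    [apply C_is_derive_id|apply C_is_derive_const].
Qed.

Lemma continuous_Cinv_sub (w t : C) : t <> w -> continuous (fun t => / (t - w))%C t.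
Proof.
  intros H. eapply C_is_derive_continuous, (C_is_derive_inv (fun t => t - w)%C);
    [now apply Csub_neq_0|apply C_is_derive_sub].
Qed.

Lemma C_is_derive_real (f : C -> C) (s : R) (l : C) : C_is_derive f (RtoC s) l ->
  is_derive (K := R_AbsRing) (V := C_R_NormedModule) (fun x : R => f x) s l.
Proof.
  intros H. apply is_derive_eps. intros eps He.
  destruct (proj1 (C_is_derive_eps f s l) H eps He) as [d [Hd K]].
  exists d. split; [exact Hd|]. intros y Hy. change (Rabs (y - s) < d) in Hy.
  specialize (K y). rewrite <- RtoC_minus, Cmod_R in K. specialize (K Hy).
  eapply Rle_trans; [right; symmetry; exact (Cmod_norm _)|].
  eapply Rle_trans; [right|exact K]. apply (f_equal Cmod).
  destruct (f y) as [y1 y2], (f s) as [s1 s2], l as [l1 l2].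
  apply (f_equal2 (@pair R R)); cbn;
    unfold minus, plus, opp, scal, mult; cbn; unfold mult; cbn; ring.
Qed.

Lemma is_derive_Re_Im (f : R -> C) (s : R) (l : C) :
  is_derive (K := R_AbsRing) (V := C_R_NormedModule) f s l ->
  is_derive (fun x => Re (f x)) s (Re l) /\ is_derive (fun x => Im (f x)) s (Im l).
Proof.
  intros H. split; apply is_derive_eps; intros eps He;
    destruct (proj1 (is_derive_eps f s l) H eps He) as [d [Hd K]];
    exists d; (split; [exact Hd|]); intros y Hy; specialize (K y Hy);
    (eapply Rle_trans; [|exact K]);
    (eapply Rle_trans; [|right; exact (Cmod_norm _)]);
    (eapply Rle_trans; [|apply Rmax_Cmod]).
  - eapply Rle_trans; [|apply Rmax_l]. apply Rle_refl.
  - eapply Rle_trans; [|apply Rmax_r]. apply Rle_refl.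
Qed.

(** The mean value theorem for one real variable is applied along the segment
    from [u] to [v] to the component of [G] in the direction of [G v - G u]. *)
Lemma C_mean_value (G g : C -> C) (c : C) (r M : R) :
  (forall v, Cmod (v - c) < r -> C_is_derive G v (g v) /\ Cmod (g v) <= M) ->
  forall u v, Cmod (u - c) < r -> Cmod (v - c) < r -> Cmod (G v - G u) <= M * Cmod (v - u).
Proof.
  intros H u v Hu Hv.
  set (e := (G v - G u)%C).
  set (p := fun s : C => (u + (v - u) * s)%C).
  assert (Hp : forall s : R, 0 <= s <= 1 -> Cmod (p s - c) < r).
  { intros s Hs. replace (p s - c)%C with ((1 - s)%R * (u - c) + s * (v - c))%C
      by (unfold p; rewrite RtoC_minus; ring).
    eapply Rle_lt_trans; [apply Cmod_triangle|]. rewrite !Cmod_mult, !Cmod_R, !Rabs_pos_eq by lra.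
    destruct (Rle_lt_dec s (1/2)); nra. }
  set (h := fun s : R => Re (Cconj e * G (p s))%C).
  set (dh := fun s : R => Re (Cconj e * ((v - u) * g (p s)))%C).
  assert (Hh : forall s, 0 <= s <= 1 -> is_derive h s (dh s)).
  { intros s Hs. apply (is_derive_Re_Im (fun s : R => Cconj e * G (p s))%C).
    apply (C_is_derive_real (fun s => Cconj e * G (p s))%C).
    apply C_is_derive_scal, C_is_derive_comp; [apply (H (p s) (Hp s Hs))|apply C_is_derive_affine]. }
  destruct (MVT_gen h 0 1 dh) as [s [Hs E]].
  - rewrite Rmin_left, Rmax_right by lra. intros s Hs. apply Hh. lra.
  - rewrite Rmin_left, Rmax_right by lra. intros s Hs. apply continuity_pt_filterlim.
    apply (ex_derive_continuous (V := R_NormedModule) h s). exists (dh s). now apply Hh.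
  - rewrite Rmin_left, Rmax_right in Hs by lra.
    destruct (H (p s) (Hp s Hs)) as [_ HM].
    assert (Eh : h 1 - h 0 = Cmod e * Cmod e).
    { unfold h. replace (p 1) with v by (unfold p; ring). replace (p 0) with u by (unfold p; ring).
      replace (Cmod e * Cmod e) with (Cmod e ^ 2) by ring. rewrite Cmod2_alt.
      unfold e. destruct (G v), (G u). unfold Re, Im. cbn. ring. }
    rewrite Eh in E. fold e.
    assert (B : dh s * (1 - 0) <= Cmod e * (M * Cmod (v - u))).
    { rewrite Rminus_0_r, Rmult_1_r. eapply Rle_trans; [apply Rle_abs|].
      eapply Rle_trans; [apply re_le_Cmod|]. rewrite !Cmod_mult, Cmod_conj.
      apply Rmult_le_compat_l; [apply Cmod_ge_0|]. rewrite Rmult_comm.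
      apply Rmult_le_compat_r; [apply Cmod_ge_0|exact HM]. }
    rewrite <- E in B.
    destruct (Rle_lt_or_eq_dec 0 (Cmod e) (Cmod_ge_0 e)) as [P|P].
    + apply Rmult_le_reg_l with (Cmod e); assumption.
    + rewrite <- P. apply Rmult_le_pos; [|apply Cmod_ge_0].
      eapply Rle_trans; [apply Cmod_ge_0|exact HM].
Qed.

(** The mean value inequality for [G - g c * id], whose derivative is small near
    [c]. *)
Lemma C_strict_derivative (G g : C -> C) (c : C) (r : R) :
  0 < r -> (forall v, Cmod (v - c) < r -> C_is_derive G v (g v)) -> continuous g c ->
  forall eps, 0 < eps -> exists d, 0 < d /\ forall u v, Cmod (u - c) < d -> Cmod (v - c) < d ->
    Cmod (G v - G u - (v - u) * g c) <= eps * Cmod (v - u).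
Proof.
  intros Hr HG Hg eps He.
  destruct (proj1 (continuous_C g c) Hg eps He) as [d [Hd K]].
  exists (Rmin r d). split; [now apply Rmin_glb_lt|]. intros u v Hu Hv.
  replace (G v - G u - (v - u) * g c)%C with ((G v - g c * v) - (G u - g c * u))%C by ring.
  apply (C_mean_value (fun t => G t - g c * t)%C (fun t => g t - g c)%C c (Rmin r d));
    [|exact Hu|exact Hv].
  intros t Ht. split.
  - apply C_is_derive_minus.
    + apply HG. eapply Rlt_le_trans; [exact Ht|apply Rmin_l].
    + apply (C_is_derive_eq _ _ (g c * 1)%C); [ring|]. apply C_is_derive_scal, C_is_derive_id.
  - apply Rlt_le, K. eapply Rlt_le_trans; [exact Ht|apply Rmin_r].
Qed.

Definition has_primitive_near (G g : C -> C) (w : C) : Prop :=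
  exists r, 0 < r /\ forall v, Cmod (v - w) < r -> C_is_derive G v (g v).

(** Strict differentiability is uniform along a path; this drives both the
    fundamental theorem and differentiation under the integral sign. *)
Lemma strict_derivative_along (gamma : R -> C) (G g : C -> C) :
  path gamma -> (forall w, trace gamma w -> has_primitive_near G g w) ->
  continuous_on_trace gamma g ->
  forall eps, 0 < eps -> exists d, 0 < d /\ forall s, 0 <= s <= 1 ->
    forall u v, Cmod (u - gamma s) < d -> Cmod (v - gamma s) < d ->
    Cmod (G v - G u - (v - u) * g (gamma s)) <= eps * Cmod (v - u).
Proof.
  intros Hg HG Hc eps He.
  apply (unit_interval_uniform (fun d s =>
    forall u v, Cmod (u - gamma s) < d -> Cmod (v - gamma s) < d ->
    Cmod (G v - G u - (v - u) * g (gamma s)) <= eps * Cmod (v - u))).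
  { intros d d' s Hd H u v Hu Hv. apply H; lra. }
  intros s Hs. destruct (HG _ (trace_at gamma s Hs)) as [r [Hr HGs]].
  destruct (C_strict_derivative G g (gamma s) r Hr HGs (Hc _ (trace_at gamma s Hs)) (eps / 2))
    as [d1 [Hd1 K1]]; [lra|].
  destruct (proj1 (continuous_C g (gamma s)) (Hc _ (trace_at gamma s Hs)) (eps / 2))
    as [d2 [Hd2 K2]]; [lra|].
  destruct (path_continuous gamma Hg s Hs (Rmin (d1 / 2) d2)) as [d [Hd K]];
    [apply Rmin_glb_lt; lra|].
  exists (Rmin d (d1 / 2)). split; [apply Rmin_glb_lt; lra|]. intros t Ht Hts u v Hu Hv.
  assert (K0 := K t Ht (Rlt_le_trans _ _ _ Hts (Rmin_l _ _))).
  assert (K01 := Rlt_le_trans _ _ _ K0 (Rmin_l _ _)).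
  assert (K02 := K2 _ (Rlt_le_trans _ _ _ K0 (Rmin_r _ _))).
  assert (Hu1 : Cmod (u - gamma s) < d1).
  { eapply Rle_lt_trans; [apply (Cmod_sub_triangle (gamma t))|].
    assert (E := Rlt_le_trans _ _ _ Hu (Rmin_r _ _)). lra. }
  assert (Hv1 : Cmod (v - gamma s) < d1).
  { eapply Rle_lt_trans; [apply (Cmod_sub_triangle (gamma t))|].
    assert (E := Rlt_le_trans _ _ _ Hv (Rmin_r _ _)). lra. }
  specialize (K1 u v Hu1 Hv1).
  replace (G v - G u - (v - u) * g (gamma t))%C
    with ((G v - G u - (v - u) * g (gamma s)) + (v - u) * (g (gamma s) - g (gamma t)))%C by ring.
  eapply Rle_trans; [apply Cmod_triangle|]. rewrite Cmod_mult, (Cmod_sub_sym (g (gamma s))).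
  assert (P := Cmod_ge_0 (v - u)). nra.
Qed.

Lemma contour_int_primitive (gamma : R -> C) (G g : C -> C) :
  path gamma -> (forall w, trace gamma w -> has_primitive_near G g w) ->
  continuous_on_trace gamma g ->
  contour_int gamma g = (G (gamma 1) - G (gamma 0))%C.
Proof.
  intros Hg HG Hc. apply contour_int_unique; [exact Hg|exact Hc|].
  apply (filterlim_C (midpoint_sum gamma g)). intros eps He.
  destruct (path_length_bound gamma Hg) as [L [HL0 HL]].
  destruct (strict_derivative_along gamma G g Hg HG Hc (eps / (2 * L))) as [d [Hd K]];
    [apply Rdiv_lt_0_compat; lra|].
  destruct (unit_interval_uniform (fun e s => forall u, 0 <= u <= 1 -> Rabs (u - s) < e ->
              Cmod (gamma u - gamma s) < d)) as [e [Hpe Ke]].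
  { intros e e' s Hee H u Hu Hus. apply H; lra. }
  { intros s Hs. destruct (path_continuous gamma Hg s Hs (d / 2)) as [e [Hpe Ke]]; [lra|].
    exists (e / 2). split; [lra|]. intros t Ht Hts u Hu Hut.
    assert (K1 := Ke t Ht ltac:(lra)). rewrite Cmod_sub_sym in K1.
    assert (Rabs (u - s) < e).
    { replace (u - s) with ((u - t) + (t - s)) by ring.
      eapply Rle_lt_trans; [apply Rabs_triang|]. lra. }
    assert (K2 := Ke u Hu ltac:(assumption)).
    eapply Rle_lt_trans; [apply (Cmod_sub_triangle (gamma s))|]. lra. }
  destruct (inv_succ_small e Hpe) as [N0 HN0]. exists N0. intros N HN. specialize (HN0 N HN).
  assert (ET : (G (gamma 1) - G (gamma 0))%C =
      sum_n (fun i => G (gamma (node N (S i))) - G (gamma (node N i)))%C N).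
  { rewrite (Csum_telescope (fun i => G (gamma (node N i))) N). now rewrite node_0, node_last. }
  rewrite Cmod_sub_sym, ET.
  assert (ES : (sum_n (fun i => G (gamma (node N (S i))) - G (gamma (node N i)))%C N
                - midpoint_sum gamma g N)%C =
     sum_n (fun i => G (gamma (node N (S i))) - G (gamma (node N i))
       - (gamma (node N (S i)) - gamma (node N i)) * g (gamma (midtag N i)))%C N).
  { unfold midpoint_sum. now rewrite <- Csum_minus. }
  rewrite ES.
  apply Rle_lt_trans with (eps / (2 * L) * L); [|field_simplify; lra].
  eapply Rle_trans; [|apply Rmult_le_compat_l;
    [apply Rlt_le, Rdiv_lt_0_compat; lra|apply (midpoint_variation gamma L N HL)]].
  apply Csum_bound. intros i Hi.
  assert (Hb := midtag_bounds N i Hi). assert (Hm := midtag_between N i).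
  assert (HS := node_S N i). assert (Hp := inv_succ_pos N).
  apply K; [exact Hb| |]; apply Ke; try exact Hb; try (apply node_bounds; lia);
    apply Rabs_def1; lra.
Qed.

Lemma contour_int_closed_primitive (gamma : R -> C) (G g : C -> C) :
  path gamma -> gamma 0 = gamma 1 -> (forall w, trace gamma w -> has_primitive_near G g w) ->
  continuous_on_trace gamma g -> contour_int gamma g = 0%C.
Proof.
  intros Hg E HG Hc. rewrite (contour_int_primitive gamma G g Hg HG Hc), E. ring.
Qed.

(** * Goursat's lemma and local primitives *)

Definition segment (a b : C) (s : R) : C := (a + s * (b - a))%C.

Lemma segment_lipschitz (a b : C) (s t : R) :
  Cmod (segment a b t - segment a b s) <= Cmod (b - a) * Rabs (t - s).
Proof.
  replace (segment a b t - segment a b s)%C with ((b - a) * (t - s)%R)%C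
    by (unfold segment; rewrite RtoC_minus; ring).
  rewrite Cmod_mult, Cmod_R. apply Rle_refl.
Qed.

Lemma segment_length (a b : C) : length_bound (segment a b) (Cmod (b - a)).
Proof. apply lipschitz_length. intros s t _ _. apply segment_lipschitz. Qed.

Lemma segment_path (a b : C) : path (segment a b).
Proof. apply (lipschitz_path _ (Cmod (b - a))). intros s t _ _. apply segment_lipschitz. Qed.

Lemma segment_0 (a b : C) : segment a b 0 = a.
Proof. unfold segment. ring. Qed.

Lemma segment_1 (a b : C) : segment a b 1 = b.
Proof. unfold segment. ring. Qed.

Lemma segment_in_disc (c a b v : C) (r : R) :
  Cmod (a - c) < r -> Cmod (b - c) < r -> trace (segment a b) v -> Cmod (v - c) < r.
Proof.
  intros Ha Hb [s [Hs <-]].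
  replace (segment a b s - c)%C with ((1 - s)%R * (a - c) + s * (b - c))%C
    by (unfold segment; rewrite RtoC_minus; ring).
  eapply Rle_lt_trans; [apply Cmod_triangle|].
  rewrite !Cmod_mult, !Cmod_R, !Rabs_pos_eq by lra.
  destruct (Rle_lt_dec s (1/2)); nra.
Qed.

Lemma segment_distance (a b v : C) : trace (segment a b) v -> Cmod (v - a) <= Cmod (b - a).
Proof.
  intros [s [Hs <-]]. replace (segment a b s - a)%C with (s * (b - a))%C
    by (unfold segment; ring).
  rewrite Cmod_mult, Cmod_R, Rabs_pos_eq by lra. assert (P := Cmod_ge_0 (b - a)). nra.
Qed.

Lemma segment_int_rev (f : C -> C) (a b : C) :
  continuous_on_trace (segment a b) f ->
  contour_int (segment b a) f = (- contour_int (segment a b) f)%C.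
Proof.
  intros Hf. assert (E : forall s, segment b a s = segment a b (1 - s)).
  { intros s. unfold segment. rewrite RtoC_minus. ring. }
  apply contour_int_unique; [apply segment_path| |].
  - intros w [s [Hs <-]]. rewrite E. apply Hf, trace_at. lra.
  - apply filterlim_ext with (fun N => (0 + - (1) * midpoint_sum (segment a b) f N)%C).
    + intros N. rewrite Cplus_0_l. unfold midpoint_sum.
      rewrite (Csum_rev (fun i => ((segment a b (node N (S i)) - _) * _)%C)), <- Csum_mult_l.
      apply sum_n_ext_loc. intros i Hi. rewrite !E.
      assert (P := INR_succ_pos N).
      replace (1 - node N (S i)) with (node N (N - i)).
      2:{ unfold node. rewrite S_INR, minus_INR by lia. field. lra. }
      replace (1 - node N i) with (node N (S (N - i))).
      2:{ unfold node. rewrite S_INR, minus_INR by lia. field. lra. }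
      replace (1 - midtag N i) with (midtag N (N - i)).
      2:{ unfold midtag. rewrite minus_INR by lia. field. lra. }
      C_ring.
    + replace (- contour_int (segment a b) f)%C
        with (0 + - (1) * contour_int (segment a b) f)%C by ring.
      apply Clim_lin; [apply filterlim_const|].
      apply contour_int_lim; [apply segment_path|exact Hf].
Qed.

Definition middle (a b : C) : C := ((a + b) / 2)%C.

Lemma segment_int_halve (f : C -> C) (a b : C) :
  continuous_on_trace (segment a b) f ->
  contour_int (segment a b) f =
  (contour_int (segment a (middle a b)) f + contour_int (segment (middle a b) b) f)%C.
Proof.
  intros Hf.
  assert (H2 : RtoC 2 <> 0%C) by (intros E; apply RtoC_inj in E; lra).
  assert (E1 : forall s, segment a (middle a b) s = segment a b (s / 2)).
  { intros s. unfold segment, middle. rewrite RtoC_div by lra. field. }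
  assert (E2 : forall s, segment (middle a b) b s = segment a b ((s + 1) / 2)).
  { intros s. unfold segment, middle. rewrite RtoC_div, RtoC_plus by lra. field. }
  assert (C1 : continuous_on_trace (segment a (middle a b)) f).
  { intros w [s [Hs <-]]. rewrite E1. apply Hf, trace_at. lra. }
  assert (C2 : continuous_on_trace (segment (middle a b) b) f).
  { intros w [s [Hs <-]]. rewrite E2. apply Hf, trace_at. lra. }
  apply (Clim_unique (fun N => midpoint_sum (segment a b) f (N + S N))).
  - apply (filterlim_comp _ _ _ (fun N => N + S N)%nat (midpoint_sum (segment a b) f)
             eventually eventually).
    + intros P [N0 HP]. exists N0. intros N HN. apply HP. lia.
    + apply contour_int_lim; [apply segment_path|exact Hf].
  - apply filterlim_ext with (fun N => (midpoint_sum (segment a (middle a b)) f N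
             + 1 * midpoint_sum (segment (middle a b) b) f N)%C).
    2:{ replace (contour_int (segment (middle a b) b) f)
          with (1 * contour_int (segment (middle a b) b) f)%C by ring.
        apply Clim_lin; apply contour_int_lim; auto using segment_path. }
    intros N. unfold midpoint_sum. rewrite Csum_split, Cmult_1_l.
    assert (P := pos_INR N).
    f_equal; apply sum_n_ext; intros i; rewrite ?E1, ?E2.
    + replace (node (N + S N) (S i)) with (node N (S i) / 2).
      2:{ unfold node. rewrite plus_INR, !S_INR. field. lra. }
      replace (node (N + S N) i) with (node N i / 2).
      2:{ unfold node. rewrite plus_INR, !S_INR. field. lra. }
      replace (midtag (N + S N) i) with (midtag N i / 2); [reflexivity|].
      unfold midtag. rewrite plus_INR, !S_INR. field. lra.
    + replace (node (N + S N) (S (S N + i))) with ((node N (S i) + 1) / 2).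
      2:{ unfold node. rewrite !S_INR, !plus_INR, !S_INR. field. lra. }
      replace (node (N + S N) (S N + i)) with ((node N i + 1) / 2).
      2:{ unfold node. rewrite !plus_INR, !S_INR. field. lra. }
      replace (midtag (N + S N) (S N + i)) with ((midtag N i + 1) / 2); [reflexivity|].
      unfold midtag. rewrite !plus_INR, !S_INR. field. lra.
Qed.

Definition triangle_int (f : C -> C) (a b c : C) : C :=
  (contour_int (segment a b) f + contour_int (segment b c) f + contour_int (segment c a) f)%C.

Definition perimeter (a b c : C) : R := Cmod (b - a) + Cmod (c - b) + Cmod (a - c).

Lemma continuous_in_disc_on_segment (f : C -> C) (z a b : C) (r : R) :
  (forall v, Cmod (v - z) < r -> continuous f v) ->
  Cmod (a - z) < r -> Cmod (b - z) < r -> continuous_on_trace (segment a b) f.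
Proof. intros Hf Ha Hb w Hw. exact (Hf w (segment_in_disc z a b w r Ha Hb Hw)). Qed.

Lemma Cmod_middle (a b v : C) : Cmod (middle a b - v) <= (Cmod (a - v) + Cmod (b - v)) / 2.
Proof.
  assert (H2 : RtoC 2 <> 0%C) by (intros E; apply RtoC_inj in E; lra).
  replace (middle a b - v)%C with (((a - v) + (b - v)) / 2)%C by (unfold middle; field; exact H2).
  rewrite Cmod_div, Cmod_R, Rabs_pos_eq by (auto; lra).
  apply Rmult_le_compat_r; [lra|apply Cmod_triangle].
Qed.

Lemma Cmod_half (a b : C) : Cmod (a / 2 - b / 2) = Cmod (a - b) / 2.
Proof.
  assert (H2 : RtoC 2 <> 0%C) by (intros E; apply RtoC_inj in E; lra).
  replace (a / 2 - b / 2)%C with ((a - b) / 2)%C by (field; exact H2).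
  now rewrite Cmod_div, Cmod_R, Rabs_pos_eq by (auto; lra).
Qed.

Lemma triangle_int_split (f : C -> C) (z : C) (r : R) (a b c : C) :
  (forall v, Cmod (v - z) < r -> continuous f v) ->
  Cmod (a - z) < r -> Cmod (b - z) < r -> Cmod (c - z) < r ->
  triangle_int f a b c =
  (triangle_int f a (middle a b) (middle c a) + triangle_int f (middle a b) b (middle b c)
   + triangle_int f (middle c a) (middle b c) c
   + triangle_int f (middle b c) (middle c a) (middle a b))%C.
Proof.
  intros Hf Ha Hb Hc.
  assert (M : forall p q, Cmod (p - z) < r -> Cmod (q - z) < r -> Cmod (middle p q - z) < r).
  { intros p q Hp Hq. assert (E := Cmod_middle p q z). lra. }
  assert (Hc' : forall p q, Cmod (p - z) < r -> Cmod (q - z) < r ->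
                 continuous_on_trace (segment p q) f).
  { intros p q Hp Hq. now apply (continuous_in_disc_on_segment f z p q r). }
  assert (Hr : forall p q, Cmod (p - z) < r -> Cmod (q - z) < r ->
    contour_int (segment q p) f = (- contour_int (segment p q) f)%C).
  { intros p q Hp Hq. apply segment_int_rev. auto. }
  unfold triangle_int.
  rewrite (segment_int_halve f a b), (segment_int_halve f b c), (segment_int_halve f c a) by auto.
  rewrite (Hr (middle a b) (middle b c)), (Hr (middle b c) (middle c a)),
    (Hr (middle c a) (middle a b)) by auto.
  ring.
Qed.

Lemma triangle_int_affine (a b c p m l : C) :
  triangle_int (fun t => m + (t - p) * l)%C a b c = 0%C.
Proof.
  assert (E : forall u v, contour_int (segment u v) (fun t => m + (t - p) * l)%C =
     ((m * (v - p) + l / 2 * ((v - p) * (v - p)))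
      - (m * (u - p) + l / 2 * ((u - p) * (u - p))))%C).
  { intros u v. assert (HD : forall w, C_is_derive
       (fun t => m * (t - p) + l / 2 * ((t - p) * (t - p)))%C w (m + (w - p) * l)%C).
    { intros w.
      apply (C_is_derive_eq _ _ (m * 1 + l / 2 * (1 * (w - p) + (w - p) * 1))%C).
      { field. }
      apply (C_is_derive_plus (fun t => m * (t - p))%C).
      - apply C_is_derive_scal, C_is_derive_sub.
      - apply C_is_derive_scal.
        apply (C_is_derive_mult (fun t => t - p)%C (fun t => t - p)%C); apply C_is_derive_sub. }
    rewrite (contour_int_primitive (segment u v)
             (fun t => m * (t - p) + l / 2 * ((t - p) * (t - p)))%C);
      [now rewrite segment_0, segment_1|apply segment_path| |].
    - intros w _. exists 1. split; [lra|auto].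
    - intros w _. eapply C_is_derive_continuous.
      apply (C_is_derive_plus (fun _ => m)); [apply C_is_derive_const|].
      apply (C_is_derive_mult (fun t => t - p)%C (fun _ => l));
        [apply C_is_derive_sub|apply C_is_derive_const]. }
  unfold triangle_int. rewrite !E. ring.
Qed.

Lemma segment_int_bound (f : C -> C) (a b : C) (M : R) :
  continuous_on_trace (segment a b) f ->
  (forall v, trace (segment a b) v -> Cmod (f v) <= M) ->
  Cmod (contour_int (segment a b) f) <= M * Cmod (b - a).
Proof.
  intros Hf HM. apply contour_int_bound; auto using segment_path, segment_length.
Qed.

(** The bound is quadratic in the perimeter because bisection then preserves it:
    each of the four parts has half the perimeter and a quarter of the bound. *)
Definition small_triangle (f : C -> C) (eps : R) (a b c : C) : Prop :=
  Cmod (triangle_int f a b c) <= eps * (perimeter a b c * perimeter a b c).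

(** An affine function integrates to zero over a triangle, so only the remainder
    of the differential at [p] contributes. *)
Lemma small_triangle_local (f : C -> C) (z : C) (r : R) (p l : C) :
  (forall v, Cmod (v - z) < r -> continuous f v) -> C_is_derive f p l ->
  forall eps, 0 < eps -> exists d, 0 < d /\ forall a b c,
    Cmod (a - z) < r -> Cmod (b - z) < r -> Cmod (c - z) < r ->
    perimeter a b c < d -> Cmod (a - p) <= 2 * perimeter a b c -> small_triangle f eps a b c.
Proof.
  intros Hf Hl eps He.
  destruct (proj1 (C_is_derive_eps f p l) Hl (eps / 4)) as [d [Hd K]]; [lra|].
  exists (d / 4). split; [lra|]. intros a b c Ha Hb Hc Hper Hap.
  assert (P1 := Cmod_ge_0 (b - a)). assert (P2 := Cmod_ge_0 (c - b)).
  assert (P3 := Cmod_ge_0 (a - c)).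
  set (rem := fun t => (f t - (f p + (t - p) * l))%C).
  assert (Caff : forall v, continuous (fun t => f p + (t - p) * l)%C v).
  { intros v. eapply C_is_derive_continuous.
    apply (C_is_derive_plus (fun _ => f p)); [apply C_is_derive_const|].
    apply (C_is_derive_mult (fun t => t - p)%C (fun _ => l));
      [apply C_is_derive_sub|apply C_is_derive_const]. }
  assert (Crem : forall v, Cmod (v - z) < r -> continuous rem v).
  { intros v Hv. apply (continuous_ext (fun t => f t + - (1) * (f p + (t - p) * l))%C).
    - intros t. unfold rem. C_ring.
    - apply continuous_lin; auto. }
  assert (Hseg : forall u v, Cmod (u - z) < r -> Cmod (v - z) < r ->
     Cmod (u - p) <= 2 * perimeter a b c + Cmod (u - a) ->
     Cmod (u - a) + Cmod (v - u) <= perimeter a b c ->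
     contour_int (segment u v) f =
       (contour_int (segment u v) (fun t => f p + (t - p) * l) + contour_int (segment u v) rem)%C
     /\ Cmod (contour_int (segment u v) rem) <= eps * perimeter a b c * Cmod (v - u)).
  { intros u v Hu Hv Hup Hua. assert (Hcr : continuous_on_trace (segment u v) rem).
    { now apply (continuous_in_disc_on_segment rem z u v r). }
    split.
    - rewrite <- (Cmult_1_l (contour_int (segment u v) rem)), <- contour_int_lin;
        auto using segment_path.
      + apply contour_int_ext; [apply segment_path| |].
        * intros w Hw. apply continuous_lin; auto.
        * intros w _. unfold rem. ring.
      + intros w _. apply Caff.
    - apply segment_int_bound; [exact Hcr|]. intros w Hw.
      assert (Ew : Cmod (w - p) <= 4 * perimeter a b c).
      { eapply Rle_trans; [apply (Cmod_sub_triangle u)|].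
        assert (E := segment_distance u v w Hw). assert (Pu := Cmod_ge_0 (u - a)).
        assert (Puv := Cmod_ge_0 (v - u)). unfold perimeter in *. lra. }
      unfold rem. replace (f w - (f p + (w - p) * l))%C with (f w - f p - (w - p) * l)%C by ring.
      eapply Rle_trans; [apply K; lra|]. nra. }
  destruct (Hseg a b Ha Hb) as [E1 B1].
  { rewrite Cmod_sub_diag. lra. } { rewrite Cmod_sub_diag. unfold perimeter. lra. }
  destruct (Hseg b c Hb Hc) as [E2 B2].
  { eapply Rle_trans; [apply (Cmod_sub_triangle a)|]. lra. } { unfold perimeter. lra. }
  destruct (Hseg c a Hc Ha) as [E3 B3].
  { eapply Rle_trans; [apply (Cmod_sub_triangle a)|]. lra. }
  { assert (T := Cmod_sub_triangle b c a). unfold perimeter. lra. }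
  unfold small_triangle.
  assert (Z := triangle_int_affine a b c p (f p) l). unfold triangle_int in *.
  rewrite E1, E2, E3.
  match type of Z with (?x + ?y + ?w)%C = _ =>
    match goal with |- Cmod (_ + ?x' + (_ + ?y') + (_ + ?w')) <= _ =>
      replace (x + x' + (y + y') + (w + w'))%C with ((x + y + w) + (x' + y' + w'))%C by ring
    end
  end.
  rewrite Z, Cplus_0_l.
  eapply Rle_trans; [apply Cmod_triangle|].
  eapply Rle_trans; [apply Rplus_le_compat_r, Cmod_triangle|].
  unfold perimeter in *. nra.
Qed.

(** If the four triangles cut off by the midpoints of the sides all satisfied the
    quadratic bound, the four bounds would add up to the one for the whole. *)
Lemma triangle_bisect (f : C -> C) (z : C) (r eps : R) (a b c : C) :
  (forall v, Cmod (v - z) < r -> continuous f v) ->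
  Cmod (a - z) < r -> Cmod (b - z) < r -> Cmod (c - z) < r ->
  ~ small_triangle f eps a b c ->
  exists a' b' c', ~ small_triangle f eps a' b' c' /\
    perimeter a' b' c' = perimeter a b c / 2 /\
    Cmod (a' - a) <= perimeter a b c /\
    (forall v R0, Cmod (a - v) <= R0 -> Cmod (b - v) <= R0 -> Cmod (c - v) <= R0 ->
       Cmod (a' - v) <= R0 /\ Cmod (b' - v) <= R0 /\ Cmod (c' - v) <= R0).
Proof.
  intros Hf Ha Hb Hc Hbad.
  assert (P1 := Cmod_ge_0 (b - a)). assert (P2 := Cmod_ge_0 (c - b)).
  assert (P3 := Cmod_ge_0 (a - c)).
  assert (H2 : RtoC 2 <> 0%C) by (intros E; apply RtoC_inj in E; lra).
  assert (M : forall p q v R0, Cmod (p - v) <= R0 -> Cmod (q - v) <= R0 ->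
     Cmod (middle p q - v) <= R0).
  { intros p q v R0 Hp Hq. assert (E := Cmod_middle p q v). lra. }
  assert (Hh : forall u v p q, ((u - v) = p / 2 - q / 2)%C -> Cmod (u - v) = Cmod (p - q) / 2).
  { intros u v p q ->. apply Cmod_half. }
  assert (Q1 : perimeter a (middle a b) (middle c a) = perimeter a b c / 2).
  { unfold perimeter. rewrite (Hh (middle a b) a b a), (Hh (middle c a) (middle a b) c b),
      (Hh a (middle c a) a c) by (unfold middle; field; exact H2). lra. }
  assert (Q2 : perimeter (middle a b) b (middle b c) = perimeter a b c / 2).
  { unfold perimeter. rewrite (Hh b (middle a b) b a), (Hh (middle b c) b c b),
      (Hh (middle a b) (middle b c) a c) by (unfold middle; field; exact H2). lra. }
  assert (Q3 : perimeter (middle c a) (middle b c) c = perimeter a b c / 2).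
  { unfold perimeter. rewrite (Hh (middle b c) (middle c a) b a), (Hh c (middle b c) c b),
      (Hh (middle c a) c a c) by (unfold middle; field; exact H2). lra. }
  assert (Q4 : perimeter (middle b c) (middle c a) (middle a b) = perimeter a b c / 2).
  { unfold perimeter. rewrite (Hh (middle c a) (middle b c) a b), (Hh (middle a b) (middle c a) b c),
      (Hh (middle b c) (middle a b) c a) by (unfold middle; field; exact H2).
    rewrite (Cmod_sub_sym a b), (Cmod_sub_sym b c), (Cmod_sub_sym c a). lra. }
  destruct (classic (small_triangle f eps a (middle a b) (middle c a))) as [S1|S1].
  2:{ exists a, (middle a b), (middle c a). split; [exact S1|]. split; [exact Q1|].
      split; [rewrite Cmod_sub_diag; unfold perimeter; lra|]. auto. }
  destruct (classic (small_triangle f eps (middle a b) b (middle b c))) as [S2|S2].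
  2:{ exists (middle a b), b, (middle b c). split; [exact S2|]. split; [exact Q2|].
      split; [|auto]. eapply Rle_trans; [apply Cmod_middle|]. rewrite Cmod_sub_diag.
      unfold perimeter. lra. }
  destruct (classic (small_triangle f eps (middle c a) (middle b c) c)) as [S3|S3].
  2:{ exists (middle c a), (middle b c), c. split; [exact S3|]. split; [exact Q3|].
      split; [|auto]. eapply Rle_trans; [apply Cmod_middle|].
      rewrite Cmod_sub_diag, (Cmod_sub_sym c). unfold perimeter. lra. }
  destruct (classic (small_triangle f eps (middle b c) (middle c a) (middle a b))) as [S4|S4].
  2:{ exists (middle b c), (middle c a), (middle a b). split; [exact S4|]. split; [exact Q4|].
      split; [|auto 6]. eapply Rle_trans; [apply Cmod_middle|].
      rewrite (Cmod_sub_sym c). unfold perimeter. lra. }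
  exfalso. apply Hbad. unfold small_triangle in *. rewrite Q1 in S1. rewrite Q2 in S2.
  rewrite Q3 in S3. rewrite Q4 in S4.
  rewrite (triangle_int_split f z r) by assumption.
  eapply Rle_trans; [apply Cmod_triangle|].
  eapply Rle_trans; [apply Rplus_le_compat_r, Cmod_triangle|].
  eapply Rle_trans; [apply Rplus_le_compat_r, Rplus_le_compat_r, Cmod_triangle|].
  lra.
Qed.

Lemma halving_sequence_limit (a : nat -> C) (q : nat -> R) :
  (forall n, q (S n) = q n / 2) -> (forall n, Cmod (a (S n) - a n) <= q n) ->
  exists p, forall n, Cmod (a n - p) <= 2 * q n.
Proof.
  intros Hq Ha.
  assert (Hq0 : forall n, 0 <= q n).
  { intros n. eapply Rle_trans; [apply Cmod_ge_0|apply Ha]. }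
  assert (Hm : forall n m, Cmod (a (n + m)%nat - a n) <= 2 * q n - 2 * q (n + m)%nat).
  { intros n m. induction m as [|m IH].
    - rewrite Nat.add_0_r, Cmod_sub_diag. lra.
    - rewrite Nat.add_succ_r. eapply Rle_trans; [apply (Cmod_sub_triangle (a (n + m)%nat))|].
      specialize (Ha (n + m)%nat). rewrite (Hq (n + m)%nat). lra. }
  assert (Hz : forall eps, 0 < eps -> exists N, q N < eps).
  { intros eps He.
    assert (Hn : forall n, q n * INR (S n) <= 2 * q 0%nat).
    { assert (Hn : forall n, q n * INR (S (S n)) <= 2 * q 0%nat).
      { induction n as [|n IH]; [cbn; lra|]. rewrite Hq. rewrite (S_INR (S (S n))).
        rewrite (S_INR (S n)) in *. rewrite S_INR in *. assert (P := pos_INR n).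
        specialize (Hq0 n). nra. }
      intros n. specialize (Hn n). rewrite (S_INR (S n)) in Hn. specialize (Hq0 n). lra. }
    destruct (inv_succ_small (eps / (2 * q 0%nat + 1))) as [N HN].
    { specialize (Hq0 0%nat). apply Rdiv_lt_0_compat; lra. }
    exists N. specialize (HN N (Nat.le_refl N)). specialize (Hn N). rewrite S_INR in Hn.
    assert (P := INR_succ_pos N). specialize (Hq0 0%nat).
    apply Rmult_lt_reg_r with (INR N + 1); [exact P|].
    apply Rmult_lt_compat_r with (r := (INR N + 1) * (2 * q 0%nat + 1)) in HN; [|nra].
    replace (/ (INR N + 1) * ((INR N + 1) * (2 * q 0%nat + 1))) with (2 * q 0%nat + 1) in HN
      by (field; lra).
    replace (eps / (2 * q 0%nat + 1) * ((INR N + 1) * (2 * q 0%nat + 1)))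
      with (eps * (INR N + 1)) in HN by (field; lra).
    lra. }
  destruct (proj1 (filterlim_locally_cauchy (U := C_R_CompleteNormedModule)
                     (F := eventually) a)) as [p Hp].
  { intros eps. destruct (Hz (eps / 4)) as [N HN]; [assert (P := cond_pos eps); lra|].
    exists (fun n => (N <= n)%nat). split; [now exists N|]. intros u v Hu Hv.
    apply C_NormedModule_mixin_compat1. change (Cmod (a v - a u) < eps).
    replace u with (N + (u - N))%nat by lia. replace v with (N + (v - N))%nat by lia.
    eapply Rle_lt_trans; [apply (Cmod_sub_triangle (a N))|]. rewrite (Cmod_sub_sym (a N)).
    assert (E1 := Hm N (u - N)%nat). assert (E2 := Hm N (v - N)%nat).
    assert (Q1 := Hq0 (N + (u - N))%nat). assert (Q2 := Hq0 (N + (v - N))%nat). lra. }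
  exists p. intros n. apply le_epsilon. intros eps He.
  destruct (proj1 (filterlim_C a p) Hp eps He) as [N HN].
  specialize (HN (n + N)%nat ltac:(lia)).
  eapply Rle_trans; [apply (Cmod_sub_triangle (a (n + N)%nat))|].
  rewrite (Cmod_sub_sym (a n)). specialize (Hm n N). specialize (Hq0 (n + N)%nat). lra.
Qed.

(** A triangle violating the quadratic bound for some [eps] would contain a
    nested sequence of such triangles; their limit point lies in the disc, and
    differentiability there excludes the small ones. *)
Lemma goursat (f : C -> C) (z : C) (r : R) (a b c : C) :
  (forall v, Cmod (v - z) < r -> exists l, C_is_derive f v l) ->
  Cmod (a - z) < r -> Cmod (b - z) < r -> Cmod (c - z) < r ->
  triangle_int f a b c = 0%C.
Proof.
  intros Hf Ha Hb Hc.
  assert (Hcont : forall v, Cmod (v - z) < r -> continuous f v).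
  { intros v Hv. destruct (Hf v Hv) as [l Hl]. eapply C_is_derive_continuous, Hl. }
  assert (Hsmall : forall eps, 0 < eps -> small_triangle f eps a b c).
  { intros eps He. apply NNPP. intros Hbad.
    set (R0 := Rmax (Cmod (a - z)) (Rmax (Cmod (b - z)) (Cmod (c - z)))).
    assert (HR0 : R0 < r) by (apply Rmax_lub_lt; [|apply Rmax_lub_lt]; assumption).
    set (inv := fun T : C * C * C =>
       ~ small_triangle f eps (fst (fst T)) (snd (fst T)) (snd T) /\
       Cmod (fst (fst T) - z) <= R0 /\ Cmod (snd (fst T) - z) <= R0 /\ Cmod (snd T - z) <= R0).
    set (per := fun T : C * C * C => perimeter (fst (fst T)) (snd (fst T)) (snd T)).
    assert (Hstep : forall T, exists T', inv T -> inv T' /\ per T' = per T / 2 /\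
              Cmod (fst (fst T') - fst (fst T)) <= per T).
    { intros [[p q] s]. destruct (classic (inv (p, q, s))) as [HI|HI]; [|exists (p, q, s); tauto].
      destruct HI as [H1 [H2 [H3 H4]]]. cbn in *.
      destruct (triangle_bisect f z r eps p q s) as [p' [q' [s' [K1 [K2 [K3 K4]]]]]];
        try assumption; try lra.
      exists (p', q', s'). intros _. unfold inv, per; cbn.
      destruct (K4 z R0 H2 H3 H4) as [L1 [L2 L3]]. auto. }
    destruct (functional_choice _ Hstep) as [step Hs].
    set (T := nat_rect (fun _ => (C * C * C)%type) (a, b, c) (fun _ U => step U)).
    assert (HT : forall n, inv (T n)).
    { induction n as [|n IH]; [|apply (Hs (T n) IH)]. unfold inv; cbn.
      split; [exact Hbad|]. unfold R0. split; [apply Rmax_l|].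
      split; (eapply Rle_trans; [|apply Rmax_r]); [apply Rmax_l|apply Rmax_r]. }
    destruct (halving_sequence_limit (fun n => fst (fst (T n))) (fun n => per (T n)))
      as [p Hp]; try (intros n; apply (Hs (T n) (HT n))).
    assert (Hper : forall n, per (T n) = per (T 0%nat) * (/ 2) ^ n).
    { induction n as [|n IH]; [cbn; ring|].
      destruct (Hs (T n) (HT n)) as [_ [E _]]. change (per (step (T n))) with (per (T (S n))) in E.
      rewrite E, IH. cbn [pow]. field. }
    assert (Hper0 : 0 <= per (T 0%nat)).
    { unfold per, perimeter. assert (X := Cmod_ge_0). repeat apply Rplus_le_le_0_compat; auto. }
    assert (Hlim : forall d, 0 < d -> exists n, per (T n) < d).
    { intros d Hd. destruct (pow_lt_1_zero (/ 2)) with (y := d / (per (T 0%nat) + 1))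
        as [n Hn]; [rewrite Rabs_pos_eq; lra|apply Rdiv_lt_0_compat; lra|].
      exists n. specialize (Hn n (Nat.le_refl n)). rewrite Hper.
      rewrite Rabs_pos_eq in Hn by (apply pow_le; lra).
      assert (0 <= (/ 2) ^ n) by (apply pow_le; lra).
      apply Rle_lt_trans with ((/ 2) ^ n * (per (T 0%nat) + 1)); [nra|].
      apply Rlt_le_trans with (d / (per (T 0%nat) + 1) * (per (T 0%nat) + 1)).
      - apply Rmult_lt_compat_r; lra.
      - right. field. lra. }
    assert (Hpz : Cmod (p - z) < r).
    { destruct (Hlim ((r - R0) / 4)) as [n Hn]; [lra|].
      destruct (HT n) as [_ [E _]]. specialize (Hp n). cbn in Hp.
      rewrite Cmod_sub_sym in Hp.
      eapply Rle_lt_trans; [apply (Cmod_sub_triangle (fst (fst (T n))))|]. lra. }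
    destruct (Hf p Hpz) as [l Hl].
    destruct (small_triangle_local f z r p l Hcont Hl eps He) as [d [Hd K]].
    destruct (Hlim d Hd) as [n Hn].
    destruct (HT n) as [B [V1 [V2 V3]]]. apply B.
    apply K; try lra; [exact Hn|apply (Hp n)]. }
  assert (Z := Cmod_sub_eq (triangle_int f a b c) 0).
  apply Z. intros eps He. replace (triangle_int f a b c - 0)%C with (triangle_int f a b c) by ring.
  set (q := perimeter a b c * perimeter a b c).
  assert (Hq : 0 <= q) by (unfold q; nra).
  eapply Rle_trans; [apply (Hsmall (eps / (q + 1))); apply Rdiv_lt_0_compat; lra|].
  fold q. apply Rmult_le_reg_r with (q + 1); [lra|]. field_simplify; nra.
Qed.

(** The integral along the segment from the centre; its increments are integrals
    along segments by Goursat's lemma for triangles with a vertex at the centre. *)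
Lemma primitive_on_disc (f : C -> C) (z : C) (r : R) :
  (forall v, Cmod (v - z) < r -> exists l, C_is_derive f v l) ->
  exists G, forall v, Cmod (v - z) < r -> C_is_derive G v (f v).
Proof.
  intros Hf.
  assert (Hcont : forall v, Cmod (v - z) < r -> continuous f v).
  { intros v Hv. destruct (Hf v Hv) as [l Hl]. eapply C_is_derive_continuous, Hl. }
  exists (fun v => contour_int (segment z v) f). intros w Hw.
  assert (Hr : 0 < r) by (eapply Rle_lt_trans; [apply Cmod_ge_0|exact Hw]).
  assert (Hz : Cmod (z - z) < r) by (rewrite Cmod_sub_diag; exact Hr).
  apply C_is_derive_eps. intros eps He.
  destruct (proj1 (continuous_C f w) (Hcont w Hw) eps He) as [d [Hd K]].
  exists (Rmin d (r - Cmod (w - z))). split; [apply Rmin_glb_lt; lra|]. intros v Hv.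
  assert (Hvz : Cmod (v - z) < r).
  { eapply Rle_lt_trans; [apply (Cmod_sub_triangle w)|].
    assert (E := Rlt_le_trans _ _ _ Hv (Rmin_r _ _)). lra. }
  assert (Hvd := Rlt_le_trans _ _ _ Hv (Rmin_l _ _)).
  assert (T := goursat f z r z w v Hf Hz Hw Hvz). unfold triangle_int in T.
  rewrite (segment_int_rev f z v) in T
    by (eapply continuous_in_disc_on_segment with (1 := Hcont); eassumption).
  assert (Hc : continuous_on_trace (segment w v) f)
    by (eapply continuous_in_disc_on_segment with (1 := Hcont); eassumption).
  assert (Hk : forall u, continuous (fun _ : C => f w) u).
  { intros u. apply continuous_const. }
  assert (E : contour_int (segment w v) (fun _ => f w) = ((v - w) * f w)%C).
  { rewrite (contour_int_primitive (segment w v) (fun t => f w * t)%C).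
    - rewrite segment_0, segment_1. ring.
    - apply segment_path.
    - intros u _. exists 1. split; [lra|]. intros t _.
      apply (C_is_derive_eq _ _ (f w * 1)%C); [ring|]. apply C_is_derive_scal, C_is_derive_id.
    - intros u _. apply Hk. }
  replace (contour_int (segment z v) f - contour_int (segment z w) f - (v - w) * f w)%C
    with (contour_int (segment w v) (fun t => f t + - (1) * f w)%C).
  - apply segment_int_bound.
    + intros u Hu. apply continuous_lin; [now apply Hc|apply Hk].
    + intros u Hu. replace (f u + - (1) * f w)%C with (f u - f w)%C by ring.
      apply Rlt_le, K. eapply Rle_lt_trans; [apply (segment_distance w v u Hu)|exact Hvd].
  - rewrite contour_int_lin by (try apply segment_path; try exact Hc; intros u _; apply Hk).
    rewrite E.
    replace (contour_int (segment z v) f)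
      with (contour_int (segment z w) f + contour_int (segment w v) f)%C; [ring|].
    rewrite <- (Cplus_0_r (contour_int (segment z v) f)), <- T. ring.
Qed.

Lemma cauchy_disc (gamma : R -> C) (f : C -> C) (z : C) (r : R) :
  path gamma -> gamma 0 = gamma 1 ->
  (forall v, trace gamma v -> Cmod (v - z) < r) ->
  (forall v, Cmod (v - z) < r -> exists l, C_is_derive f v l) ->
  contour_int gamma f = 0%C.
Proof.
  intros Hg E Ht Hf. destruct (primitive_on_disc f z r Hf) as [G HG].
  apply (contour_int_closed_primitive gamma G); [exact Hg|exact E| |].
  - intros w Hw. specialize (Ht w Hw). exists (r - Cmod (w - z)). split; [lra|].
    intros v Hv. apply HG. eapply Rle_lt_trans; [apply (Cmod_sub_triangle w)|]. lra.
  - intros w Hw. destruct (Hf w (Ht w Hw)) as [l Hl]. eapply C_is_derive_continuous, Hl.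
Qed.

(** * Cauchy's integral formula in a disc *)

Definition loop (gamma : R -> C) : Prop := path gamma /\ gamma 0 = gamma 1.

Lemma derive_under_integral (gamma : R -> C) (K : C -> C -> C) (K' : C -> C) (w : C) (r : R) :
  path gamma -> 0 < r ->
  (forall v, Cmod (v - w) < r -> continuous_on_trace gamma (K v)) ->
  continuous_on_trace gamma K' ->
  (forall eps, 0 < eps -> exists d, 0 < d /\ forall v, Cmod (v - w) < d ->
     forall t, trace gamma t -> Cmod (K v t - K w t - (v - w) * K' t) <= eps * Cmod (v - w)) ->
  C_is_derive (fun v => contour_int gamma (K v)) w (contour_int gamma K').
Proof.
  intros Hg Hr HK HK' Hunif. apply C_is_derive_eps. intros eps He.
  destruct (path_length_bound gamma Hg) as [L [HL0 HL]].
  destruct (Hunif (eps / L)) as [d [Hd H]]; [apply Rdiv_lt_0_compat; lra|].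
  exists (Rmin d r). split; [now apply Rmin_glb_lt|]. intros v Hv.
  assert (Hw : continuous_on_trace gamma (K w)) by (apply HK; rewrite Cmod_sub_diag; exact Hr).
  assert (Hv' : continuous_on_trace gamma (K v)).
  { apply HK. eapply Rlt_le_trans; [exact Hv|apply Rmin_r]. }
  specialize (H v (Rlt_le_trans _ _ _ Hv (Rmin_l _ _))).
  assert (Hvw : continuous_on_trace gamma (fun t => K v t + - (1) * K w t)%C).
  { intros t Ht. apply continuous_lin; auto. }
  replace (contour_int gamma (K v) - contour_int gamma (K w) - (v - w) * contour_int gamma K')%C
    with (contour_int gamma (fun t => (K v t + - (1) * K w t) + - (v - w) * K' t)%C)
    by (rewrite !contour_int_lin by assumption; ring).
  replace (eps * Cmod (v - w)) with (eps / L * Cmod (v - w) * L) by (field; lra).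
  apply contour_int_bound; [exact Hg| |exact HL|].
  - intros t Ht. apply (continuous_lin (fun t => K v t + - (1) * K w t)%C); auto.
  - intros t Ht.
    replace (K v t + - (1) * K w t + - (v - w) * K' t)%C
      with (K v t - K w t - (v - w) * K' t)%C by ring.
    auto.
Qed.

Lemma continuous_pow_inv_sub (n : nat) (w t : C) :
  t <> w -> continuous (fun t => Cpow_inv n (t - w))%C t.
Proof.
  intros H. eapply C_is_derive_continuous.
  apply (C_is_derive_comp (Cpow_inv n) (fun t => t - w)%C);
    [apply C_is_derive_pow_inv; now apply Csub_neq_0|apply C_is_derive_sub].
Qed.

(** The difference quotients in [v] of the kernel are those of a power function
    along the translated path, hence converge uniformly. *)
Lemma cauchy_kernel_derive (gamma : R -> C) (phi : C -> C) (n : nat) (w : C) :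
  path gamma -> continuous_on_trace gamma phi -> ~ trace gamma w ->
  C_is_derive (fun v => contour_int gamma (fun t => phi t * Cpow_inv n (t - v))%C) w
    (INR n * contour_int gamma (fun t => phi t * Cpow_inv (S n) (t - w))%C)%C.
Proof.
  intros Hg Hphi Hw.
  destruct (trace_distance gamma w Hg Hw) as [r [Hr Hdist]].
  assert (Hne : forall v t, Cmod (v - w) < r -> trace gamma t -> t <> v).
  { intros v t Hv Ht ->. specialize (Hdist v Ht). lra. }
  assert (Hww : Cmod (w - w) < r) by (rewrite Cmod_sub_diag; exact Hr).
  assert (Hcont : forall m v, Cmod (v - w) < r ->
            continuous_on_trace gamma (fun t => phi t * Cpow_inv m (t - v))%C).
  { intros m v Hv t Ht. apply continuous_Cmult; [now apply Hphi|].
    apply continuous_pow_inv_sub. now apply Hne. }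
  rewrite <- contour_int_scal by auto.
  apply (derive_under_integral gamma (fun v t => phi t * Cpow_inv n (t - v))%C _ w r);
    [exact Hg|exact Hr|auto| |].
  { intros t Ht. apply (continuous_Cmult (fun _ => RtoC (INR n))); [|now apply Hcont].
    apply continuous_const. }
  intros eps He.
  destruct (trace_bounded gamma phi Hg Hphi) as [M [HM0 HM]].
  destruct (strict_derivative_along (affine_path (- w) 1 gamma) (Cpow_inv n)
              (fun u => - INR n * Cpow_inv (S n) u)%C) with (eps := eps / M)
    as [d [Hd K]].
  - now apply affine_path_path.
  - intros u Hu. apply affine_path_trace in Hu. destruct Hu as [t [Ht ->]].
    exists r. split; [exact Hr|]. intros v Hv. apply C_is_derive_pow_inv.
    intros ->. specialize (Hdist t Ht). rewrite Cmod_sub_sym in Hv.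
    replace (- w + 1 * t - 0)%C with (t - w)%C in Hv by ring. lra.
  - intros u Hu. apply affine_path_trace in Hu. destruct Hu as [t [Ht ->]].
    assert (Hu0 : (- w + 1 * t)%C <> 0%C).
    { replace (- w + 1 * t)%C with (t - w)%C by ring. apply Csub_neq_0. now apply Hne. }
    apply (continuous_Cmult (fun _ => - INR n)%C).
    + apply continuous_const.
    + eapply C_is_derive_continuous, C_is_derive_pow_inv, Hu0.
  - apply Rdiv_lt_0_compat; lra.
  - exists d. split; [exact Hd|]. intros v Hv t Ht.
    destruct Ht as [s [Hs <-]]. specialize (K s Hs (gamma s - w)%C (gamma s - v)%C).
    unfold affine_path in K.
    replace (gamma s - w - (- w + 1 * gamma s))%C with (RtoC 0) in K by ring.
    replace (gamma s - v - (- w + 1 * gamma s))%C with (w - v)%C in K by ring.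
    replace (gamma s - v - (gamma s - w))%C with (w - v)%C in K by ring.
    replace (- w + 1 * gamma s)%C with (gamma s - w)%C in K by ring.
    rewrite Cmod_0, (Cmod_sub_sym w) in K. specialize (K Hd Hv).
    replace (phi (gamma s) * Cpow_inv n (gamma s - v) - phi (gamma s) * Cpow_inv n (gamma s - w)
      - (v - w) * (INR n * (phi (gamma s) * Cpow_inv (S n) (gamma s - w))))%C
      with (phi (gamma s) * (Cpow_inv n (gamma s - v) - Cpow_inv n (gamma s - w)
             - (w - v) * (- INR n * Cpow_inv (S n) (gamma s - w))))%C by ring.
    rewrite Cmod_mult.
    apply Rle_trans with (M * (eps / M * Cmod (v - w))); [|right; field; lra].
    apply Rmult_le_compat; try apply Cmod_ge_0; [|exact K].
    apply HM. now apply trace_at.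
Qed.

(** Over sufficiently many equal steps, the increments of [h] add up to at most
    [eps]. *)
Lemma telescoping_constant (h : R -> C) :
  (forall s, 0 <= s <= 1 -> forall eps, 0 < eps -> exists d, 0 < d /\
     forall u v, 0 <= u <= 1 -> 0 <= v <= 1 -> Rabs (u - s) < d -> Rabs (v - s) < d ->
     Cmod (h v - h u) <= eps * Rabs (v - u)) ->
  h 1 = h 0.
Proof.
  intros H. apply Cmod_sub_eq. intros eps He.
  destruct (unit_interval_uniform (fun d s =>
     forall u v, 0 <= u <= 1 -> 0 <= v <= 1 -> Rabs (u - s) < d -> Rabs (v - s) < d ->
     Cmod (h v - h u) <= eps * Rabs (v - u))) as [d [Hd K]].
  { intros d d' s Hd K u v Hu Hv Hus Hvs. apply K; lra. }
  { intros s Hs. destruct (H s Hs eps He) as [d [Hd K]]. exists (d / 2). split; [lra|].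
    intros t Ht Hts u v Hu Hv Hut Hvt. apply K; try assumption.
    - replace (u - s) with ((u - t) + (t - s)) by ring.
      eapply Rle_lt_trans; [apply Rabs_triang|]. lra.
    - replace (v - s) with ((v - t) + (t - s)) by ring.
      eapply Rle_lt_trans; [apply Rabs_triang|]. lra. }
  destruct (inv_succ_small d Hd) as [N HN]. specialize (HN N (Nat.le_refl N)).
  assert (P := inv_succ_pos N).
  rewrite <- (node_last N), <- (node_0 N).
  rewrite <- (Csum_telescope (fun i => h (node N i)) N).
  eapply Rle_trans; [apply (Csum_bound _ (fun _ => / (INR N + 1)) eps)|].
  - intros i Hi. assert (HS := node_S N i).
    rewrite <- (Rabs_pos_eq (/ (INR N + 1))) by lra.
    replace (/ (INR N + 1)) with (node N (S i) - node N i) by lra.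
    apply (K (node N i) (node_bounds N i ltac:(lia))); try (apply node_bounds; lia).
    + rewrite Rminus_diag, Rabs_R0. exact Hd.
    + rewrite HS. replace (node N i + / (INR N + 1) - node N i) with (/ (INR N + 1)) by ring.
      rewrite Rabs_pos_eq; lra.
  - rewrite sum_n_const, S_INR. right. field. assert (Q := INR_succ_pos N). lra.
Qed.

(** The integral of [G (w + s * (t - w)) / (t - w)] is the left-hand side for
    [s = 1] and the right-hand side for [s = 0]. Its derivative in [s] is the
    integral of [g (w + s * (t - w))], which has a primitive in [t] and therefore
    integrates to zero along the closed path. *)
Lemma cauchy_formula_C1 (gamma : R -> C) (G g : C -> C) (z w : C) (r : R) :
  loop gamma -> (forall v, trace gamma v -> Cmod (v - z) < r) ->
  (forall v, Cmod (v - z) < r -> C_is_derive G v (g v)) ->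
  (forall v, Cmod (v - z) < r -> continuous g v) ->
  Cmod (w - z) < r -> ~ trace gamma w ->
  contour_int gamma (fun t => G t * / (t - w))%C =
  (G w * contour_int gamma (fun t => / (t - w)))%C.
Proof.
  intros [Hg Hclosed] Ht HG Hgc Hw Hnt.
  assert (Hne : forall t, trace gamma t -> (t - w)%C <> 0%C).
  { intros t Ht' E. apply Hnt. replace w with t; [exact Ht'|].
    replace t with ((t - w) + w)%C by ring. rewrite E. ring. }
  assert (Hneq : forall t, trace gamma t -> t <> w) by (intros t Ht' ->; contradiction).
  set (D := fun (s : R) (t : C) => (w + s * (t - w))%C).
  assert (HD : forall s t, 0 <= s <= 1 -> trace gamma t -> Cmod (D s t - z) < r).
  { intros s t Hs Ht'. apply (segment_in_disc z w t); auto. now exists s. }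
  assert (Hkc : continuous_on_trace gamma (fun t => / (t - w))%C).
  { intros t Ht'. apply continuous_Cinv_sub. now apply Hneq. }
  assert (HDd : forall s t, C_is_derive (D s) t (RtoC s)).
  { intros s t. apply (C_is_derive_ext_loc (fun t => (w - s * w) + s * t)%C (D s) t (RtoC s) 1);
      [lra|intros v _; unfold D; ring|apply C_is_derive_affine]. }
  assert (HGc : forall s, 0 <= s <= 1 -> continuous_on_trace gamma (fun t => G (D s t) * / (t - w))%C).
  { intros s Hs t Ht'. apply continuous_Cmult; [|now apply Hkc].
    eapply C_is_derive_continuous, C_is_derive_comp; [apply HG; now apply HD|apply HDd]. }
  assert (Hgc' : forall s, 0 <= s <= 1 -> continuous_on_trace gamma (fun t => g (D s t))).
  { intros s Hs t Ht'. apply (continuous_comp (D s) g).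
    - eapply C_is_derive_continuous, HDd.
    - apply Hgc. now apply HD. }
  assert (Hzero : forall s, 0 <= s <= 1 -> contour_int gamma (fun t => g (D s t)) = 0%C).
  { intros s Hs. destruct (Req_dec s 0) as [Es|Es].
    - apply (contour_int_closed_primitive gamma (fun t => g w * t)%C); auto.
      intros t Ht'. exists 1. split; [lra|]. intros v _.
      apply (C_is_derive_eq _ _ (g w * 1)%C).
      + rewrite Es. unfold D. replace (w + 0 * (v - w))%C with w by ring. ring.
      + apply C_is_derive_scal, C_is_derive_id.
    - apply (contour_int_closed_primitive gamma (fun t => / s * G (D s t))%C); auto.
      intros t Ht'. specialize (HD s t Hs Ht').
      (* [D s v] stays in the disc for [v] near [t], by continuity. *)
      destruct (proj1 (continuous_C (D s) t) (C_is_derive_continuous _ _ _ (HDd s t))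
                  (r - Cmod (D s t - z))) as [d [Hd K]]; [lra|].
      exists d. split; [exact Hd|]. intros v Hv. specialize (K v Hv).
      assert (Hv' : Cmod (D s v - z) < r).
      { eapply Rle_lt_trans; [apply (Cmod_sub_triangle (D s t))|]. lra. }
      assert (Es' : RtoC s <> 0%C) by (intros E; apply RtoC_inj in E; contradiction).
      apply (C_is_derive_eq _ _ (/ s * (s * g (D s v)))%C); [field; exact Es'|].
      apply C_is_derive_scal, C_is_derive_comp; [now apply HG|apply HDd]. }
  set (I := fun s : R => contour_int gamma (fun t => G (D s t) * / (t - w))%C).
  assert (E1 : contour_int gamma (fun t => G t * / (t - w))%C = I 1).
  { apply contour_int_ext; [exact Hg|apply HGc; lra|]. intros t _. unfold D.
    f_equal. f_equal. ring. }
  assert (E0 : I 0 = (G w * contour_int gamma (fun t => / (t - w)))%C).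
  { unfold I. rewrite <- contour_int_scal by assumption. apply contour_int_ext; [exact Hg| |].
    - intros t Ht'. apply (continuous_Cmult (fun _ => G w)); [|now apply Hkc].
      apply continuous_const.
    - intros t _. unfold D. f_equal. f_equal. ring. }
  rewrite E1, <- E0. apply telescoping_constant. intros s Hs eps He.
  destruct (path_length_bound gamma Hg) as [L [HL0 HL]].
  destruct (trace_bounded gamma (fun t => t - w)%C Hg) as [B [HB0 HB]].
  { intros t _. eapply C_is_derive_continuous, C_is_derive_sub. }
  destruct (strict_derivative_along (affine_path (w - s * w) s gamma) G g) with (eps := eps / L)
    as [d [Hd K]].
  - now apply affine_path_path.
  - intros u Hu. apply affine_path_trace in Hu. destruct Hu as [t [Ht' ->]].
    specialize (HD s t Hs Ht').
    replace (w - s * w + s * t)%C with (D s t) by (unfold D; ring).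
    exists (r - Cmod (D s t - z)). split; [lra|]. intros v Hv. apply HG.
    eapply Rle_lt_trans; [apply (Cmod_sub_triangle (D s t))|]. lra.
  - intros u Hu. apply affine_path_trace in Hu. destruct Hu as [t [Ht' ->]].
    replace (w - s * w + s * t)%C with (D s t) by (unfold D; ring). apply Hgc. auto.
  - apply Rdiv_lt_0_compat; lra.
  - exists (d / B). split; [apply Rdiv_lt_0_compat; lra|].
    intros u v Hu Hv Hus Hvs. unfold I.
    replace (contour_int gamma (fun t => G (D v t) * / (t - w))
             - contour_int gamma (fun t => G (D u t) * / (t - w)))%C
      with (contour_int gamma (fun t => (G (D v t) * / (t - w) + - (1) * (G (D u t) * / (t - w)))
               + - (v - u) * g (D s t)))%C.
    2:{ rewrite (contour_int_lin gamma
          (fun t => G (D v t) * / (t - w) + - (1) * (G (D u t) * / (t - w)))%C); auto.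
        - rewrite contour_int_lin, Hzero by auto. ring.
        - intros t Ht'. apply continuous_lin; now apply HGc. }
    replace (eps * Rabs (v - u)) with (eps / L * Rabs (v - u) * L) by (field; lra).
    apply contour_int_bound; [exact Hg| |exact HL|].
    + intros t Ht'.
      apply (continuous_lin (fun t => G (D v t) * / (t - w) + - (1) * (G (D u t) * / (t - w)))%C).
      * apply continuous_lin; now apply HGc.
      * now apply Hgc'.
    + intros t Ht'. assert (Hn := Hne t Ht'). specialize (HB t Ht'). destruct Ht' as [x [Hx <-]].
      assert (Hclose : forall y, Rabs (y - s) < d / B ->
                Cmod (D y (gamma x) - affine_path (w - s * w) s gamma x) < d).
      { intros y Hy. unfold D, affine_path.
        replace (w + y * (gamma x - w) - (w - s * w + s * gamma x))%C
          with ((y - s)%R * (gamma x - w))%C by (rewrite RtoC_minus; ring).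
        rewrite Cmod_mult, Cmod_R. assert (P := Rabs_pos (y - s)).
        apply Rle_lt_trans with (Rabs (y - s) * B).
        - apply Rmult_le_compat_l; lra.
        - apply Rlt_le_trans with (d / B * B); [apply Rmult_lt_compat_r; lra|].
          right. field. lra. }
      specialize (K x Hx _ _ (Hclose u Hus) (Hclose v Hvs)).
      replace (affine_path (w - s * w) s gamma x) with (D s (gamma x)) in K
        by (unfold affine_path, D; ring).
      assert (EvR : (D v (gamma x) - D u (gamma x))%C = ((v - u)%R * (gamma x - w))%C)
        by (unfold D; rewrite RtoC_minus; ring).
      rewrite EvR in K.
      replace (G (D v (gamma x)) * / (gamma x - w) + - (1) * (G (D u (gamma x)) * / (gamma x - w))
               + - (v - u) * g (D s (gamma x)))%C
        with ((G (D v (gamma x)) - G (D u (gamma x)) - (v - u)%R * (gamma x - w) * g (D s (gamma x)))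
               * / (gamma x - w))%C by (rewrite RtoC_minus; field; exact Hn).
      rewrite Cmod_mult, Cmod_inv by exact Hn.
      rewrite (Cmod_mult (v - u)%R), Cmod_R in K.
      assert (P : 0 < Cmod (gamma x - w)) by now apply Cmod_gt_0.
      apply Rmult_le_reg_r with (Cmod (gamma x - w)); [exact P|].
      rewrite Rmult_assoc, Rinv_l by lra. lra.
Qed.

(** ** The unit circle *)

Definition cis (x : R) : C := (cos x, sin x).

Lemma cis_plus (x y : R) : cis (x + y) = (cis x * cis y)%C.
Proof. unfold cis. rewrite cos_plus, sin_plus. unfold Cmult; cbn. f_equal; ring. Qed.

Lemma cis_chord (x h : R) : (cis (x + h) - cis (x - h))%C = (cis x * (2 * sin h * Ci))%C.
Proof.
  unfold Rminus. rewrite !cis_plus. unfold cis. rewrite cos_neg, sin_neg.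
  unfold Cmult, Cminus, Cplus, Copp, Ci, RtoC; cbn. f_equal; ring.
Qed.

Lemma Cmod_cis (x : R) : Cmod (cis x) = 1.
Proof.
  unfold Cmod, cis; cbn. rewrite !Rmult_1_r. assert (E := sin2_cos2 x). unfold Rsqr in E.
  replace (cos x * cos x + sin x * sin x) with 1 by lra. apply sqrt_1.
Qed.

Lemma Rabs_sin_le (x : R) : Rabs (sin x) <= Rabs x.
Proof.
  assert (P : forall y, 0 < y -> Rabs (sin y) <= y).
  { intros y Hy. destruct (Rle_lt_dec y 1) as [H1|H1].
    - rewrite Rabs_pos_eq; [apply Rlt_le, sin_lt_x, Hy|]. apply Rlt_le, sin_gt_0; [exact Hy|].
      assert (E := PI2_1). lra.
    - apply Rabs_le. assert (E := SIN_bound y). lra. }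
  destruct (Rtotal_order x 0) as [H|[->|H]].
  - rewrite <- (Rabs_Ropp x), (Rabs_pos_eq (- x)), <- Rabs_Ropp, <- sin_neg by lra.
    apply P. lra.
  - rewrite sin_0. lra.
  - rewrite (Rabs_pos_eq x) by lra. now apply P.
Qed.

Definition circle (c : C) (r : R) (s : R) : C := (c + r * cis (2 * PI * s))%C.

Lemma circle_lipschitz (c : C) (r s t : R) :
  Cmod (circle c r t - circle c r s) <= Rabs r * (2 * PI) * Rabs (t - s).
Proof.
  replace (circle c r t - circle c r s)%C
    with (r * (cis (PI * (t + s)) * (2 * sin (PI * (t - s)) * Ci)))%C.
  2:{ rewrite <- cis_chord. unfold circle.
      replace (PI * (t + s) + PI * (t - s)) with (2 * PI * t) by ring.
      replace (PI * (t + s) - PI * (t - s)) with (2 * PI * s) by ring. ring. }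
  rewrite !Cmod_mult, Cmod_cis, !Cmod_R, Cmod_Ci, (Rabs_pos_eq 2) by lra.
  assert (E := Rabs_sin_le (PI * (t - s))).
  rewrite Rabs_mult, (Rabs_pos_eq PI) in E by (apply Rlt_le, PI_RGT_0).
  assert (P := Rabs_pos r).
  apply Rle_trans with (Rabs r * (2 * (PI * Rabs (t - s)))); [|right; ring].
  apply Rmult_le_compat_l; [exact P|]. lra.
Qed.

Lemma circle_loop (c : C) (r : R) : loop (circle c r).
Proof.
  split.
  - apply (lipschitz_path _ (Rabs r * (2 * PI))). intros s t _ _. apply circle_lipschitz.
  - unfold circle. do 2 f_equal. unfold cis.
    rewrite Rmult_0_r, Rmult_1_r, cos_0, sin_0, cos_2PI, sin_2PI. reflexivity.
Qed.

Lemma circle_length (c : C) (r : R) : 0 <= r -> length_bound (circle c r) (r * (2 * PI)).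
Proof.
  intros Hr. rewrite <- (Rabs_pos_eq r) at 2 by exact Hr.
  apply lipschitz_length. intros s t _ _. apply circle_lipschitz.
Qed.

Lemma circle_trace (c : C) (r : R) (v : C) : 0 <= r -> trace (circle c r) v -> Cmod (v - c) = r.
Proof.
  intros Hr [s [_ <-]]. unfold circle.
  replace (c + r * cis (2 * PI * s) - c)%C with (r * cis (2 * PI * s))%C by ring.
  rewrite Cmod_mult, Cmod_R, Cmod_cis, Rabs_pos_eq by exact Hr. ring.
Qed.

(** With midpoint tags every cell contributes [2 i sin (PI / (N + 1))], the chord
    divided by the midpoint of the arc. *)
Lemma circle_index (c : C) (r : R) : 0 < r ->
  contour_int (circle c r) (fun t => / (t - c))%C = (2 * PI * Ci)%C.
Proof.
  intros Hr. apply contour_int_unique; [apply circle_loop| |].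
  - intros t Ht. apply continuous_Cinv_sub. intros ->.
    apply circle_trace in Ht; [|lra]. rewrite Cmod_sub_diag in Ht. lra.
  - assert (Hr0 : RtoC r <> 0%C) by (intros E; apply RtoC_inj in E; lra).
    assert (Hsum : forall N, midpoint_sum (circle c r) (fun t => / (t - c))%C N =
              ((INR N + 1)%R * (2 * sin (PI * / (INR N + 1)) * Ci))%C).
    { intros N. unfold midpoint_sum. assert (PN := INR_succ_pos N).
      rewrite (sum_n_ext _ (fun _ => (2 * sin (PI * / (INR N + 1)) * Ci)%C)).
      - generalize (2 * sin (PI * / (INR N + 1)) * Ci)%C. clear. intros a. rewrite <- S_INR.
        induction N as [|N IH].
        + rewrite sum_O. cbn. C_ring.
        + rewrite Csum_Sn, IH, (S_INR (S N)), RtoC_plus. C_ring.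
      - intros i. set (x := 2 * PI * midtag N i). set (h := PI * / (INR N + 1)).
        assert (Hx : cis x <> 0%C) by (apply Cmod_gt_0; rewrite Cmod_cis; lra).
        replace (circle c r (midtag N i) - c)%C with (r * cis x)%C by (unfold circle, x; ring).
        replace (circle c r (node N (S i)) - circle c r (node N i))%C
          with (r * (cis (x + h) - cis (x - h)))%C.
        + rewrite cis_chord. match goal with |- ?p = ?q => change (@eq C p q) end. field. auto.
        + unfold circle.
          replace (2 * PI * node N (S i)) with (x + h)
            by (unfold x, h; rewrite node_S, midtag_node; field; lra).
          replace (2 * PI * node N i) with (x - h)
            by (unfold x, h; rewrite midtag_node; field; lra).
          ring. }
    apply (filterlim_C (midpoint_sum (circle c r) (fun t => / (t - c))%C)). intros eps He.
    assert (HPI := PI_RGT_0).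
    destruct (proj1 (is_derive_eps sin 0 1)) with (eps := eps / (4 * PI)) as [d [Hd K]].
    { rewrite <- cos_0. apply is_derive_sin. }
    { apply Rdiv_lt_0_compat; lra. }
    destruct (inv_succ_small (d / PI)) as [N0 HN0]; [apply Rdiv_lt_0_compat; lra|].
    exists N0. intros N HN. specialize (HN0 N HN). rewrite Hsum.
    assert (PN := INR_succ_pos N). assert (PI' := inv_succ_pos N).
    set (h := PI * / (INR N + 1)) in *. assert (Hh : 0 < h) by (unfold h; nra).
    assert (Hhd : h < d).
    { unfold h. apply Rlt_le_trans with (PI * (d / PI)); [nra|]. right. field. lra. }
    specialize (K h).
    change (Rabs (h - 0) < d -> Rabs (sin h - sin 0 - (h - 0) * 1) <= eps / (4 * PI) * Rabs (h - 0))
      in K.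
    rewrite sin_0, !Rminus_0_r, (Rabs_pos_eq h) in K by lra. specialize (K Hhd).
    replace ((INR N + 1)%R * (2 * sin h * Ci) - 2 * PI * Ci)%C
      with (((INR N + 1) * 2 * (sin h - h))%R * Ci)%C.
    + rewrite Cmod_mult, Cmod_Ci, Cmod_R, !Rabs_mult, (Rabs_pos_eq 2), (Rabs_pos_eq (INR N + 1))
        by lra.
      rewrite Rmult_1_r in *. apply Rle_lt_trans with ((INR N + 1) * 2 * (eps / (4 * PI) * h)).
      * apply Rmult_le_compat_l; [nra|exact K].
      * unfold h. replace ((INR N + 1) * 2 * (eps / (4 * PI) * (PI * / (INR N + 1))))
          with (eps / 2) by (field; lra). lra.
    + replace (2 * PI * Ci)%C with (((INR N + 1) * 2 * h)%R * Ci)%C.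
      * rewrite !RtoC_mult, RtoC_minus. ring.
      * f_equal. rewrite <- RtoC_mult. f_equal. unfold h. field. lra.
Qed.

(** ** Index and higher Cauchy kernels *)

Definition index (gamma : R -> C) (w : C) : C := contour_int gamma (fun t => / (t - w))%C.

Definition cauchy_integral (gamma : R -> C) (phi : C -> C) (n : nat) (w : C) : C :=
  contour_int gamma (fun t => phi t * Cpow_inv n (t - w))%C.

Lemma off_trace_neq (gamma : R -> C) (t w : C) : trace gamma t -> ~ trace gamma w -> t <> w.
Proof. now intros Ht Hw ->. Qed.

Lemma inv_sub_continuous_on_trace (gamma : R -> C) (w : C) :
  ~ trace gamma w -> continuous_on_trace gamma (fun t => / (t - w))%C.
Proof. intros Hw t Ht. apply continuous_Cinv_sub. eapply off_trace_neq; eassumption. Qed.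

Lemma kernel_continuous_on_trace (gamma : R -> C) (phi : C -> C) (n : nat) (w : C) :
  continuous_on_trace gamma phi -> ~ trace gamma w ->
  continuous_on_trace gamma (fun t => phi t * Cpow_inv n (t - w))%C.
Proof.
  intros Hphi Hw t Ht. apply continuous_Cmult; [now apply Hphi|].
  apply continuous_pow_inv_sub. eapply off_trace_neq; eassumption.
Qed.

Lemma cauchy_integral_1 (gamma : R -> C) (phi : C -> C) (w : C) :
  path gamma -> continuous_on_trace gamma phi -> ~ trace gamma w ->
  contour_int gamma (fun t => phi t * / (t - w))%C = cauchy_integral gamma phi 1 w.
Proof.
  intros Hg Hphi Hw. apply contour_int_ext; [exact Hg|now apply kernel_continuous_on_trace|].
  intros t _. cbn. now rewrite Cmult_1_r.
Qed.

Lemma off_trace_open (gamma : R -> C) (w : C) : path gamma -> ~ trace gamma w ->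
  exists r, 0 < r /\ forall v, Cmod (v - w) < r -> ~ trace gamma v.
Proof.
  intros Hg Hw. destruct (trace_distance gamma w Hg Hw) as [r [Hr H]].
  exists r. split; [exact Hr|]. intros v Hv Ht. specialize (H v Ht). lra.
Qed.

(** The derivative is the integral of [1 / (t - w)^2], which has a primitive. *)
Lemma index_derive (gamma : R -> C) (w : C) :
  loop gamma -> ~ trace gamma w -> C_is_derive (index gamma) w (RtoC 0).
Proof.
  intros [Hg Hc] Hw. assert (H1 : continuous_on_trace gamma (fun _ => RtoC 1))
    by (intros t _; apply continuous_const).
  destruct (off_trace_open gamma w Hg Hw) as [r [Hr Hoff]].
  apply (C_is_derive_ext_loc (cauchy_integral gamma (fun _ => RtoC 1) 1) _ w _ r Hr).
  - intros v Hv. unfold index. rewrite <- cauchy_integral_1 by auto.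
    apply contour_int_ext; [exact Hg|apply inv_sub_continuous_on_trace; auto|].
    intros t _. ring.
  - apply (C_is_derive_eq _ _
      (INR 1 * contour_int gamma (fun t => RtoC 1 * Cpow_inv 2 (t - w))%C)%C).
    2:{ now apply cauchy_kernel_derive. }
    rewrite (contour_int_closed_primitive gamma (fun t => - (1) * / (t - w))%C); auto.
    + ring.
    + intros t Ht. assert (Htw := Csub_neq_0 _ _ (off_trace_neq gamma t w Ht Hw)).
      exists (Cmod (t - w)). split; [now apply Cmod_gt_0|]. intros v Hv.
      assert (Hvw : (v - w)%C <> 0%C).
      { apply Csub_neq_0. intros ->. rewrite Cmod_sub_sym in Hv. lra. }
      apply (C_is_derive_eq _ _ (- (1) * (- (1) / ((v - w) * (v - w))))%C).
      { cbn. field. exact Hvw. }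
      apply C_is_derive_scal. apply (C_is_derive_inv (fun t => t - w)%C); [exact Hvw|].
      apply C_is_derive_sub.
    + now apply kernel_continuous_on_trace.
Qed.

Lemma constant_on_disc (f : C -> C) (c : C) (r : R) :
  (forall v, Cmod (v - c) < r -> C_is_derive f v (RtoC 0)) ->
  forall v, Cmod (v - c) < r -> f v = f c.
Proof.
  intros Hf v Hv. apply Cmod_sub_eq. intros eps He.
  assert (Hr : 0 < r) by (eapply Rle_lt_trans; [apply Cmod_ge_0|exact Hv]).
  eapply Rle_trans; [apply (C_mean_value f (fun _ => RtoC 0) c r 0)|].
  - intros u Hu. split; [now apply Hf|]. rewrite Cmod_0. lra.
  - rewrite Cmod_sub_diag. exact Hr.
  - exact Hv.
  - lra.
Qed.

Lemma index_locally_constant (gamma : R -> C) (w : C) (r : R) :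
  loop gamma -> (forall v, Cmod (v - w) < r -> ~ trace gamma v) ->
  forall v, Cmod (v - w) < r -> index gamma v = index gamma w.
Proof. intros Hl Hoff. apply constant_on_disc. intros v Hv. apply index_derive; auto. Qed.

Lemma circle_off_trace (c w : C) (r : R) : Cmod (w - c) < r -> ~ trace (circle c r) w.
Proof.
  intros Hw Ht. assert (P := Cmod_ge_0 (w - c)). apply circle_trace in Ht; lra.
Qed.

Lemma circle_index_inside (c w : C) (r : R) :
  Cmod (w - c) < r -> index (circle c r) w = (2 * PI * Ci)%C.
Proof.
  intros Hw. assert (P := Cmod_ge_0 (w - c)).
  rewrite (index_locally_constant (circle c r) c r (circle_loop c r)); [|..|exact Hw].
  - apply circle_index. lra.
  - intros v Hv. now apply circle_off_trace.
Qed.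

Lemma two_pi_i_neq_0 : (2 * PI * Ci)%C <> 0%C.
Proof.
  assert (P := PI_RGT_0). apply Cmod_gt_0. rewrite !Cmod_mult, !Cmod_R, Cmod_Ci, !Rabs_pos_eq; lra.
Qed.

(** ** Holomorphic functions are smooth *)

Lemma cauchy_integral_derive (gamma : R -> C) (phi : C -> C) (n : nat) (w : C) :
  path gamma -> continuous_on_trace gamma phi -> ~ trace gamma w ->
  C_is_derive (cauchy_integral gamma phi n) w (INR n * cauchy_integral gamma phi (S n) w)%C.
Proof. apply cauchy_kernel_derive. Qed.

Lemma circle_formula_C1 (G g : C -> C) (c : C) (r rho : R) :
  0 < rho < r ->
  (forall v, Cmod (v - c) < r -> C_is_derive G v (g v)) ->
  (forall v, Cmod (v - c) < r -> continuous g v) ->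
  forall w, Cmod (w - c) < rho ->
  G w = (/ (2 * PI * Ci) * cauchy_integral (circle c rho) G 1 w)%C.
Proof.
  intros Hrho HG Hg w Hw. assert (H2 := two_pi_i_neq_0).
  assert (Ht : forall v, trace (circle c rho) v -> Cmod (v - c) < r).
  { intros v Hv. apply circle_trace in Hv; lra. }
  rewrite <- cauchy_integral_1.
  - rewrite (cauchy_formula_C1 (circle c rho) G g c w r); auto using circle_loop, circle_off_trace.
    + fold (index (circle c rho) w). rewrite circle_index_inside by exact Hw.
      revert H2. generalize (2 * PI * Ci)%C. intros k Hk. field. exact Hk.
    + lra.
  - apply circle_loop.
  - intros v Hv. eapply C_is_derive_continuous, HG. auto.
  - now apply circle_off_trace.
Qed.

(** A primitive [G] is continuously differentiable, hence equal to its Cauchy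
    integral over a circle around [c]; the derivatives of that integral exhibit
    [f] and [C_derive f] as Cauchy integrals with density [G] near [c]. *)
Lemma holomorphic_smooth_disc (f : C -> C) (c : C) (r : R) :
  0 < r -> (forall v, Cmod (v - c) < r -> exists l, C_is_derive f v l) ->
  exists l, C_is_derive (C_derive f) c l.
Proof.
  intros Hr Hf. destruct (primitive_on_disc f c r Hf) as [G HG].
  assert (Hfc : forall v, Cmod (v - c) < r -> continuous f v).
  { intros v Hv. destruct (Hf v Hv) as [l Hl]. eapply C_is_derive_continuous, Hl. }
  set (gamma := circle c (r / 2)).
  assert (Hg : path gamma) by apply circle_loop.
  assert (Hoff : forall v, Cmod (v - c) < r / 2 -> ~ trace gamma v)
    by (intros v; apply circle_off_trace).
  assert (Hphi : continuous_on_trace gamma G).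
  { intros v Hv. apply circle_trace in Hv; [|lra]. eapply C_is_derive_continuous, HG. lra. }
  set (k := (/ (2 * PI * Ci))%C).
  set (F := fun n w => (k * cauchy_integral gamma G n w)%C).
  assert (HF : forall n w, Cmod (w - c) < r / 2 -> C_is_derive (F n) w (INR n * F (S n) w)%C).
  { intros n w Hw.
    apply (C_is_derive_eq _ _ (k * (INR n * cauchy_integral gamma G (S n) w))%C).
    - unfold F. ring.
    - apply C_is_derive_scal, cauchy_integral_derive; auto. }
  assert (Hin : forall w v, Cmod (w - c) < r / 2 -> Cmod (v - w) < r / 2 - Cmod (w - c) ->
            Cmod (v - c) < r / 2).
  { intros w v Hw Hv. eapply Rle_lt_trans; [apply (Cmod_sub_triangle w)|]. lra. }
  assert (E1 : forall w, Cmod (w - c) < r / 2 -> f w = (INR 1 * F 2%nat w)%C).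
  { intros w Hw. apply (C_is_derive_unique G w); [apply HG; lra|].
    apply (C_is_derive_ext_loc (F 1%nat) G w _ (r / 2 - Cmod (w - c))); [lra| |now apply HF].
    intros v Hv. symmetry. apply (circle_formula_C1 G f c r (r / 2)); auto; [lra|].
    now apply (Hin w). }
  assert (E2 : forall w, Cmod (w - c) < r / 2 -> C_derive f w = (INR 1 * (INR 2 * F 3%nat w))%C).
  { intros w Hw. apply is_C_derive_unique.
    apply (C_is_derive_ext_loc (fun v => INR 1 * F 2%nat v)%C f w _ (r / 2 - Cmod (w - c))); [lra| |].
    - intros v Hv. symmetry. apply E1. now apply (Hin w).
    - apply C_is_derive_scal. now apply HF. }
  eexists. apply (C_is_derive_ext_loc (fun v => INR 1 * (INR 2 * F 3%nat v))%C _ c _ (r / 2)); [lra| |].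
  - intros v Hv. symmetry. now apply E2.
  - apply C_is_derive_scal, C_is_derive_scal, HF. rewrite Cmod_sub_diag. lra.
Qed.

Lemma domain_disc (D : C -> Prop) (w : C) : open D -> D w ->
  exists r, 0 < r /\ forall v, Cmod (v - w) < r -> D v.
Proof. intros HD Hw. apply locally_C. exact (HD w Hw). Qed.

Lemma holomorphic_is_derive (D : C -> Prop) (f : C -> C) (w : C) :
  holomorphic_on D f -> D w -> C_is_derive f w (C_derive f w).
Proof. intros Hf Hw. apply C_derive_correct; [exact w|now apply Hf]. Qed.

Lemma holomorphic_continuous (D : C -> Prop) (f : C -> C) (w : C) :
  holomorphic_on D f -> D w -> continuous f w.
Proof. intros Hf Hw. eapply C_is_derive_continuous, holomorphic_is_derive; eassumption. Qed.

Lemma holomorphic_derive (D : C -> Prop) (f : C -> C) :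
  open D -> holomorphic_on D f -> holomorphic_on D (C_derive f).
Proof.
  intros HD Hf w Hw. destruct (domain_disc D w HD Hw) as [r [Hr Hdisc]].
  apply (holomorphic_smooth_disc f w r Hr). intros v Hv. apply Hf. auto.
Qed.

Lemma disc_open (c : C) (r : R) : open (fun v => Cmod (v - c) < r).
Proof.
  intros w Hw. apply locally_C. exists (r - Cmod (w - c)). split; [lra|].
  intros v Hv. eapply Rle_lt_trans; [apply (Cmod_sub_triangle w)|]. lra.
Qed.

Lemma circle_formula (f : C -> C) (c : C) (r rho : R) :
  0 < rho < r -> holomorphic_on (fun v => Cmod (v - c) < r) f ->
  forall w, Cmod (w - c) < rho ->
  f w = (/ (2 * PI * Ci) * cauchy_integral (circle c rho) f 1 w)%C.
Proof.
  intros Hrho Hf. apply (circle_formula_C1 f (C_derive f) c r rho Hrho).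
  - intros v Hv. exact (holomorphic_is_derive _ f v Hf Hv).
  - intros v Hv. apply (holomorphic_continuous _ _ v
      (holomorphic_derive _ f (disc_open c r) Hf) Hv).
Qed.

Lemma circle_formula_derive (f : C -> C) (c : C) (r rho : R) :
  0 < rho < r -> holomorphic_on (fun v => Cmod (v - c) < r) f ->
  C_derive f c = (/ (2 * PI * Ci) * cauchy_integral (circle c rho) f 2 c)%C.
Proof.
  intros Hrho Hf. apply is_C_derive_unique.
  apply (C_is_derive_ext_loc (fun w => / (2 * PI * Ci) * cauchy_integral (circle c rho) f 1 w)%C
           f c _ rho); [lra| |].
  - intros w Hw. symmetry. now apply (circle_formula f c r rho).
  - apply (C_is_derive_eq _ _ (/ (2 * PI * Ci) *
              (INR 1 * cauchy_integral (circle c rho) f 2 c))%C); [cbn; ring|].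
    apply C_is_derive_scal, cauchy_integral_derive.
    + apply circle_loop.
    + intros v Hv. apply circle_trace in Hv; [|lra]. apply (holomorphic_continuous _ f v Hf). lra.
    + apply circle_off_trace. rewrite Cmod_sub_diag. lra.
Qed.

(** ** The difference quotient, with its removable singularity filled in *)

Definition diff_quotient (f : C -> C) (w t : C) : C :=
  if Ceq_dec t w then C_derive f w else ((f t - f w) / (t - w))%C.

Lemma diff_quotient_diag (f : C -> C) (w : C) : diff_quotient f w w = C_derive f w.
Proof. unfold diff_quotient. destruct (Ceq_dec w w); [reflexivity|contradiction]. Qed.

Lemma diff_quotient_neq (f : C -> C) (w t : C) :
  t <> w -> diff_quotient f w t = ((f t - f w) / (t - w))%C.
Proof. intros H. unfold diff_quotient. destruct (Ceq_dec t w); [contradiction|reflexivity]. Qed.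

Lemma diff_quotient_sym (f : C -> C) (w t : C) : diff_quotient f w t = diff_quotient f t w.
Proof.
  destruct (Ceq_dec t w) as [->|H]; [reflexivity|].
  rewrite !diff_quotient_neq by congruence. field.
  split; apply Csub_neq_0; congruence.
Qed.

Lemma diff_quotient_derive_off (f : C -> C) (w t l : C) :
  t <> w -> C_is_derive f t l ->
  C_is_derive (diff_quotient f w) t ((l - (f t - f w) / (t - w)) / (t - w))%C.
Proof.
  intros H Hf. assert (Htw := Csub_neq_0 _ _ H).
  apply (C_is_derive_ext_loc (fun t => (f t - f w) * / (t - w))%C _ t _ (Cmod (t - w))).
  - now apply Cmod_gt_0.
  - intros v Hv. rewrite diff_quotient_neq; [reflexivity|]. intros ->.
    rewrite Cmod_sub_sym in Hv. lra.
  - apply (C_is_derive_eq _ _ ((l - 0) * / (t - w)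
       + (f t - f w) * (- (1) / ((t - w) * (t - w))))%C).
    + field. exact Htw.
    + apply (C_is_derive_mult (fun t => f t - f w)%C (fun t => / (t - w))%C).
      * apply C_is_derive_minus; [exact Hf|apply C_is_derive_const].
      * apply (C_is_derive_inv (fun t => t - w)%C); [exact Htw|apply C_is_derive_sub].
Qed.

(** At [w] itself the quotient is a Cauchy-type integral with density
    [f / (t - w)], hence differentiable. *)
Lemma diff_quotient_holomorphic (D : C -> Prop) (f : C -> C) (w : C) :
  open D -> holomorphic_on D f -> D w -> holomorphic_on D (diff_quotient f w).
Proof.
  intros HD Hf Hw t Ht. destruct (Ceq_dec t w) as [->|Htw].
  2:{ eexists. apply diff_quotient_derive_off; [exact Htw|].
      now apply (holomorphic_is_derive D). }
  destruct (domain_disc D w HD Hw) as [r [Hr Hdisc]].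
  assert (Hfr : holomorphic_on (fun v => Cmod (v - w) < r) f) by (intros v Hv; apply Hf; auto).
  set (rho := r / 2). assert (Hrho : 0 < rho < r) by (unfold rho; lra).
  set (gamma := circle w rho). assert (Hg : path gamma) by apply circle_loop.
  assert (Hfc : continuous_on_trace gamma f).
  { intros v Hv. apply circle_trace in Hv; [|lra]. apply (holomorphic_continuous _ f v Hfr). lra. }
  assert (Hww : Cmod (w - w) < rho) by (rewrite Cmod_sub_diag; lra).
  assert (Hoff : forall v, Cmod (v - w) < rho -> ~ trace gamma v)
    by (intros v; apply circle_off_trace).
  assert (Hphi : continuous_on_trace gamma (fun t => f t * / (t - w))%C).
  { intros v Hv. apply continuous_Cmult; [now apply Hfc|].
    apply (inv_sub_continuous_on_trace gamma w); auto. }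
  exists (/ (2 * PI * Ci) * (INR 1 * cauchy_integral gamma (fun t => f t * / (t - w)) 2 w))%C.
  apply (C_is_derive_ext_loc
    (fun v => / (2 * PI * Ci) * cauchy_integral gamma (fun t => f t * / (t - w)) 1 v)%C _ w _ rho).
  - lra.
  - intros v Hv. destruct (Ceq_dec v w) as [->|Hvw].
    + rewrite diff_quotient_diag, (circle_formula_derive f w r rho Hrho Hfr). f_equal.
      apply contour_int_ext; [exact Hg|apply kernel_continuous_on_trace; auto|].
      intros t _. cbn. ring.
    + rewrite (diff_quotient_neq f w v Hvw).
      rewrite (circle_formula f w r rho Hrho Hfr v Hv), (circle_formula f w r rho Hrho Hfr w Hww).
      fold gamma.
      assert (E : cauchy_integral gamma (fun t => f t * / (t - w))%C 1 v =
         (/ (v - w) * (cauchy_integral gamma f 1 v + - (1) * cauchy_integral gamma f 1 w))%C).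
      { unfold cauchy_integral. rewrite <- contour_int_lin, <- contour_int_scal; auto.
        - apply contour_int_ext; [exact Hg| |].
          + intros t Ht'. apply (continuous_Cmult (fun _ => / (v - w))%C); [apply continuous_const|].
            apply continuous_lin; apply (kernel_continuous_on_trace gamma f); auto.
          + intros t Ht'. cbn. field. repeat split; apply Csub_neq_0; auto.
            * exact (off_trace_neq gamma t w Ht' (Hoff w Hww)).
            * exact (off_trace_neq gamma t v Ht' (Hoff v Hv)).
        - intros t Ht'. apply continuous_lin; apply (kernel_continuous_on_trace gamma f); auto.
        - apply (kernel_continuous_on_trace gamma f); auto.
        - apply (kernel_continuous_on_trace gamma f); auto. }
      rewrite E. unfold Cdiv. ring.
  - apply C_is_derive_scal, cauchy_integral_derive; auto.
Qed.

(** The uniformity of [K] in [f] allows differentiation under an integral over a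
    bounded family of holomorphic functions. *)
Lemma taylor_estimate (rho : R) : 0 < rho -> exists K, 0 < K /\
  forall (f : C -> C) (c : C) (r M : R), rho < r ->
  holomorphic_on (fun v => Cmod (v - c) < r) f ->
  (forall v, Cmod (v - c) = rho -> Cmod (f v) <= M) ->
  forall v, Cmod (v - c) < rho / 2 ->
  Cmod (f v - f c - (v - c) * C_derive f c) <= K * M * (Cmod (v - c) * Cmod (v - c)).
Proof.
  intros Hrho. assert (HPI := PI_RGT_0).
  exists (2 / (rho * rho)). split; [apply Rdiv_lt_0_compat; nra|].
  intros f c r M Hr Hf HM v Hv.
  set (gamma := circle c rho). assert (Hg : path gamma) by apply circle_loop.
  assert (Hcc : Cmod (c - c) < rho) by (rewrite Cmod_sub_diag; lra).
  assert (Hvr : Cmod (v - c) < rho) by lra.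
  assert (Hoff : forall v, Cmod (v - c) < rho -> ~ trace gamma v)
    by (intros u; apply circle_off_trace).
  assert (Hfc : continuous_on_trace gamma f).
  { intros u Hu. apply circle_trace in Hu; [|lra]. apply (holomorphic_continuous _ f u Hf). lra. }
  rewrite (circle_formula_derive f c r rho) by auto.
  rewrite (circle_formula f c r rho ltac:(lra) Hf v Hvr), (circle_formula f c r rho ltac:(lra) Hf c Hcc).
  fold gamma.
  assert (C1 := kernel_continuous_on_trace gamma f 1 v Hfc (Hoff v Hvr)).
  assert (C2 := kernel_continuous_on_trace gamma f 1 c Hfc (Hoff c Hcc)).
  assert (C3 := kernel_continuous_on_trace gamma f 2 c Hfc (Hoff c Hcc)).
  assert (E : (cauchy_integral gamma f 1 v + - (1) * cauchy_integral gamma f 1 c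
              + - (v - c) * cauchy_integral gamma f 2 c)%C =
    contour_int gamma (fun t => (f t * Cpow_inv 1 (t - v) + - (1) * (f t * Cpow_inv 1 (t - c)))
       + - (v - c) * (f t * Cpow_inv 2 (t - c)))%C).
  { unfold cauchy_integral. rewrite <- !contour_int_lin; auto.
    intros t Ht. apply continuous_lin; auto. }
  replace (/ (2 * PI * Ci) * cauchy_integral gamma f 1 v - / (2 * PI * Ci) * cauchy_integral gamma f 1 c
    - (v - c) * (/ (2 * PI * Ci) * cauchy_integral gamma f 2 c))%C
    with (/ (2 * PI * Ci) * (cauchy_integral gamma f 1 v + - (1) * cauchy_integral gamma f 1 c
              + - (v - c) * cauchy_integral gamma f 2 c))%C by ring.
  rewrite E, Cmod_mult, Cmod_inv by apply two_pi_i_neq_0.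
  rewrite !Cmod_mult, Cmod_Ci, !Cmod_R, !Rabs_pos_eq by lra.
  assert (B := contour_int_bound gamma (fun t =>
     (f t * Cpow_inv 1 (t - v) + - (1) * (f t * Cpow_inv 1 (t - c)))
       + - (v - c) * (f t * Cpow_inv 2 (t - c)))%C
     (M * (Cmod (v - c) * Cmod (v - c)) * (2 / (rho * rho * rho))) (rho * (2 * PI)) Hg).
  eapply Rle_trans; [apply Rmult_le_compat_l; [apply Rlt_le, Rinv_0_lt_compat; lra|apply B]|].
  - intros t Ht. apply (continuous_lin (fun t =>
      f t * Cpow_inv 1 (t - v) + - (1) * (f t * Cpow_inv 1 (t - c)))%C); [|now apply C3].
    apply continuous_lin; auto.
  - apply circle_length. lra.
  - intros t Ht. assert (Etc := circle_trace c rho t ltac:(lra) Ht).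
    assert (Htc : (t - c)%C <> 0%C) by (apply Cmod_gt_0; lra).
    assert (Ptv : rho / 2 < Cmod (t - v)).
    { assert (T := Cmod_sub_triangle v t c). lra. }
    assert (Htv : (t - v)%C <> 0%C) by (apply Cmod_gt_0; lra).
    (* This is the exact second-order remainder of the Cauchy kernel. *)
    replace (f t * Cpow_inv 1 (t - v) + - (1) * (f t * Cpow_inv 1 (t - c))
             + - (v - c) * (f t * Cpow_inv 2 (t - c)))%C
      with (f t * ((v - c) * (v - c)) * / ((t - v) * ((t - c) * (t - c))))%C
      by (cbn; field; auto).
    rewrite Cmod_mult, Cmod_inv, !Cmod_mult, Etc by (repeat apply Cmult_neq_0; assumption).
    assert (Pvc := Cmod_ge_0 (v - c)).
    apply Rmult_le_compat.
    + apply Rmult_le_pos; [apply Cmod_ge_0|nra].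
    + apply Rlt_le, Rinv_0_lt_compat. apply Rmult_lt_0_compat; nra.
    + apply Rmult_le_compat_r; [nra|]. now apply HM.
    + apply Rle_trans with (/ (rho / 2 * (rho * rho))).
      * apply Rinv_le_contravar; [apply Rmult_lt_0_compat; nra|]. apply Rmult_le_compat_r; nra.
      * right. field. lra.
  - right. field. lra.
Qed.

(** * Cauchy's integral formula for cycles homologous to zero *)

(** Cauchy's formula over circles of growing radius around [w]; this is the form
    of Liouville's theorem that Dixon's argument uses. *)
Lemma entire_vanishing_at_infinity (h : C -> C) :
  (forall v, exists l, C_is_derive h v l) ->
  (forall eps, 0 < eps -> exists B, forall v, B < Cmod v -> Cmod (h v) <= eps) ->
  forall w, h w = 0%C.
Proof.
  intros Hh Hlim w. apply Cmod_sub_eq. intros eps He.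
  replace (h w - 0)%C with (h w) by ring.
  destruct (Hlim eps He) as [B HB]. assert (HPI := PI_RGT_0).
  assert (Pw := Cmod_ge_0 w).
  set (rho := Rmax (B + Cmod w + 1) 1).
  assert (H1 : B + Cmod w + 1 <= rho) by apply Rmax_l. assert (H2 : 1 <= rho) by apply Rmax_r.
  assert (Hd : holomorphic_on (fun v => Cmod (v - w) < rho + 1) h).
  { intros v _. destruct (Hh v) as [l Hl]. now exists l. }
  assert (Hww : Cmod (w - w) < rho) by (rewrite Cmod_sub_diag; lra).
  rewrite (circle_formula h w (rho + 1) rho ltac:(lra) Hd w Hww).
  rewrite Cmod_mult, Cmod_inv by apply two_pi_i_neq_0.
  rewrite !Cmod_mult, Cmod_Ci, !Cmod_R, !Rabs_pos_eq by lra.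
  assert (Hc : continuous_on_trace (circle w rho) h).
  { intros v _. destruct (Hh v) as [l Hl]. eapply C_is_derive_continuous, Hl. }
  eapply Rle_trans; [apply Rmult_le_compat_l; [apply Rlt_le, Rinv_0_lt_compat; lra|]|].
  - apply (contour_int_bound (circle w rho) _ (eps * / rho) (rho * (2 * PI))).
    + apply circle_loop.
    + apply kernel_continuous_on_trace; [exact Hc|]. now apply circle_off_trace.
    + apply circle_length. lra.
    + intros t Ht. assert (E := circle_trace w rho t ltac:(lra) Ht).
      assert (Htw : (t - w)%C <> 0%C) by (apply Cmod_gt_0; lra).
      cbn. rewrite Cmult_1_r, Cmod_mult, Cmod_inv, E by exact Htw.
      apply Rmult_le_compat_r; [apply Rlt_le, Rinv_0_lt_compat; lra|]. apply HB.
      assert (T := Cmod_triangle t (- w)). rewrite Cmod_opp in T.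
      change (t + - w)%C with (t - w)%C in T. lra.
  - right. field. lra.
Qed.

(** Near the diagonal the mean value inequality bounds the quotient by the
    derivative of [f]; away from it the denominator is bounded below. *)
Lemma diff_quotient_bounded (D : C -> Prop) (f : C -> C) (gamma : R -> C) (c : C) :
  open D -> holomorphic_on D f -> path gamma -> (forall t, trace gamma t -> D t) -> D c ->
  exists rho M, 0 < rho /\ (forall v, Cmod (v - c) < 3 * rho -> D v) /\
    forall t v, trace gamma t -> Cmod (v - c) <= rho -> Cmod (diff_quotient f t v) <= M.
Proof.
  intros HD Hf Hg Ht Hc.
  destruct (domain_disc D c HD Hc) as [r [Hr Hdisc]].
  destruct (proj1 (continuous_C f c) (holomorphic_continuous D f c Hf Hc) 1 Rlt_0_1)
    as [d1 [Hd1 K1]].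
  destruct (proj1 (continuous_C (C_derive f) c)
      (holomorphic_continuous D _ c (holomorphic_derive D f HD Hf) Hc) 1 Rlt_0_1) as [d2 [Hd2 K2]].
  set (rho := Rmin r (Rmin d1 d2) / 3).
  assert (H0 : 0 < Rmin r (Rmin d1 d2)) by (repeat apply Rmin_glb_lt; assumption).
  assert (Hrho : 0 < rho) by (unfold rho; lra).
  assert (E3 : 3 * rho = Rmin r (Rmin d1 d2)) by (unfold rho; field).
  assert (L1 : 3 * rho <= r) by (rewrite E3; apply Rmin_l).
  assert (L2 : 3 * rho <= d1) by (rewrite E3; eapply Rle_trans; [apply Rmin_r|apply Rmin_l]).
  assert (L3 : 3 * rho <= d2) by (rewrite E3; eapply Rle_trans; [apply Rmin_r|apply Rmin_r]).
  set (M1 := Cmod (C_derive f c) + 1). set (M2 := Cmod (f c) + 1).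
  assert (B1 : forall v, Cmod (v - c) < 3 * rho -> Cmod (C_derive f v) <= M1).
  { intros v Hv. specialize (K2 v ltac:(lra)).
    assert (T := Cmod_triangle (C_derive f v - C_derive f c) (C_derive f c)).
    replace (C_derive f v - C_derive f c + C_derive f c)%C with (C_derive f v) in T by ring.
    unfold M1. lra. }
  assert (B2 : forall v, Cmod (v - c) < 3 * rho -> Cmod (f v) <= M2).
  { intros v Hv. specialize (K1 v ltac:(lra)).
    assert (T := Cmod_triangle (f v - f c) (f c)).
    replace (f v - f c + f c)%C with (f v) in T by ring. unfold M2. lra. }
  destruct (trace_bounded gamma f Hg) as [M3 [HM3 B3]].
  { intros t Ht'. apply (holomorphic_continuous D); auto. }
  exists rho, (Rmax M1 ((M2 + M3) / rho)). split; [exact Hrho|]. split.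
  { intros v Hv. apply Hdisc. lra. }
  intros t v Ht' Hv. destruct (Rlt_le_dec (Cmod (t - c)) (3 * rho)) as [Hn|Hn].
  - eapply Rle_trans; [|apply Rmax_l]. destruct (Ceq_dec v t) as [->|Hvt].
    + rewrite diff_quotient_diag. now apply B1.
    + rewrite diff_quotient_neq by exact Hvt.
      rewrite Cmod_div by now apply Csub_neq_0.
      assert (P : 0 < Cmod (v - t)) by now apply Cmod_gt_0, Csub_neq_0.
      apply Rmult_le_reg_r with (Cmod (v - t)); [exact P|].
      unfold Rdiv. rewrite Rmult_assoc, Rinv_l, Rmult_1_r by lra.
      apply (C_mean_value f (C_derive f) c (3 * rho) M1); [|exact Hn|lra].
      intros u Hu. split; [|now apply B1]. apply (holomorphic_is_derive D); [exact Hf|].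
      apply Hdisc. lra.
  - eapply Rle_trans; [|apply Rmax_r].
    assert (P : rho <= Cmod (v - t)).
    { assert (T := Cmod_sub_triangle v t c). rewrite (Cmod_sub_sym t v) in T. lra. }
    assert (Hvt : v <> t).
    { intros ->. rewrite Cmod_sub_diag in P. lra. }
    rewrite diff_quotient_neq by exact Hvt. rewrite Cmod_div by now apply Csub_neq_0.
    unfold Rdiv. apply Rmult_le_compat.
    + apply Cmod_ge_0.
    + apply Rlt_le, Rinv_0_lt_compat. lra.
    + assert (T := Cmod_triangle (f v) (- f t)). rewrite Cmod_opp in T.
      change (f v + - f t)%C with (f v - f t)%C in T.
      specialize (B3 t Ht'). specialize (B2 v ltac:(lra)). lra.
    + apply Rinv_le_contravar; lra.
Qed.

Lemma diff_quotient_derive (D : C -> Prop) (f : C -> C) (c t : C) :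
  open D -> holomorphic_on D f -> D c -> D t ->
  C_is_derive (diff_quotient f t) c (diff_quotient (diff_quotient f c) c t).
Proof.
  intros HD Hf Hc Ht. destruct (Ceq_dec t c) as [->|Htc].
  - rewrite diff_quotient_diag. apply (holomorphic_is_derive D); [|exact Hc].
    now apply diff_quotient_holomorphic.
  - assert (Hct : c <> t) by congruence.
    apply (C_is_derive_eq _ _ ((C_derive f c - (f c - f t) / (c - t)) / (c - t))%C).
    + rewrite diff_quotient_neq, diff_quotient_neq, diff_quotient_diag by exact Htc.
      field. split; now apply Csub_neq_0.
    + apply diff_quotient_derive_off; [exact Hct|]. now apply (holomorphic_is_derive D).
Qed.

(** For fixed [t] the quotient is holomorphic in its base point [v], as it is
    symmetric in [v] and [t], and bounded uniformly in [t]; [taylor_estimate]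
    then allows differentiation under the integral, also when [c] is on the
    path. *)
Lemma dixon_derive_inside (D : C -> Prop) (f : C -> C) (gamma : R -> C) (c : C) :
  open D -> holomorphic_on D f -> path gamma -> (forall t, trace gamma t -> D t) -> D c ->
  exists l, C_is_derive (fun v => contour_int gamma (diff_quotient f v)) c l.
Proof.
  intros HD Hf Hg Ht Hc.
  destruct (diff_quotient_bounded D f gamma c HD Hf Hg Ht Hc) as [rho [M [Hrho [Hdisc HM]]]].
  destruct (taylor_estimate rho Hrho) as [K [HK Htaylor]].
  assert (Hhol : forall v, D v -> continuous_on_trace gamma (diff_quotient f v)).
  { intros v Hv t Ht'. apply (holomorphic_continuous D); [|now apply Ht].
    now apply diff_quotient_holomorphic. }
  assert (HM0 : 0 <= M).
  { eapply Rle_trans; [apply Cmod_ge_0|]. apply (HM (gamma 0) c); [apply trace_at; lra|].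
    rewrite Cmod_sub_diag. lra. }
  eexists. apply (derive_under_integral gamma (fun v => diff_quotient f v)
                    (diff_quotient (diff_quotient f c) c) c rho); auto.
  - intros v Hv. apply Hhol, Hdisc. lra.
  - intros t Ht'. apply (holomorphic_continuous D); [|now apply Ht].
    apply diff_quotient_holomorphic; auto. now apply diff_quotient_holomorphic.
  - intros eps He. exists (Rmin (rho / 2) (eps / (K * M + 1))).
    assert (HKM : 0 <= K * M) by (apply Rmult_le_pos; lra).
    split; [apply Rmin_glb_lt; [lra|apply Rdiv_lt_0_compat; lra]|].
    intros v Hv t Ht'.
    assert (Hv1 := Rlt_le_trans _ _ _ Hv (Rmin_l _ _)).
    assert (Hv2 := Rlt_le_trans _ _ _ Hv (Rmin_r _ _)).
    rewrite (diff_quotient_sym f v t), (diff_quotient_sym f c t).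
    rewrite <- (is_C_derive_unique _ _ _ (diff_quotient_derive D f c t HD Hf Hc (Ht t Ht'))).
    eapply Rle_trans.
    + apply (Htaylor (diff_quotient f t) c (3 * rho) M); [lra| | |exact Hv1].
      * intros u Hu. apply (diff_quotient_holomorphic D); auto.
      * intros u Hu. apply HM; [exact Ht'|lra].
    + assert (P := Cmod_ge_0 (v - c)). rewrite <- Rmult_assoc.
      apply Rmult_le_compat_r; [exact P|].
      apply Rle_trans with ((K * M + 1) * (eps / (K * M + 1))); [nra|]. right. field. lra.
Qed.

Lemma diff_quotient_int (D : C -> Prop) (f : C -> C) (gamma : R -> C) (w : C) :
  holomorphic_on D f -> path gamma -> (forall t, trace gamma t -> D t) -> ~ trace gamma w ->
  contour_int gamma (diff_quotient f w) =
  (contour_int gamma (fun t => f t * / (t - w)) - f w * index gamma w)%C.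
Proof.
  intros Hf Hg Ht Hw.
  assert (Hi := inv_sub_continuous_on_trace gamma w Hw).
  assert (Hfi : continuous_on_trace gamma (fun t => f t * / (t - w))%C).
  { intros t Ht'. apply continuous_Cmult; [|now apply Hi].
    apply (holomorphic_continuous D); auto. }
  replace (contour_int gamma (fun t => f t * / (t - w)) - f w * index gamma w)%C
    with (contour_int gamma (fun t => f t * / (t - w)) + - f w * index gamma w)%C by ring.
  unfold index. rewrite <- contour_int_lin by auto.
  apply contour_int_ext; [exact Hg| |].
  - intros t Ht'. apply (continuous_lin (fun t => f t * / (t - w))%C); auto.
  - intros t Ht'. assert (Htw := off_trace_neq gamma t w Ht' Hw).
    rewrite diff_quotient_neq by exact Htw. unfold Cdiv. ring.
Qed.

Lemma index_far (gamma : R -> C) (B : R) (w : C) :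
  loop gamma -> (forall t, trace gamma t -> Cmod t <= B) -> B < Cmod w -> index gamma w = 0%C.
Proof.
  intros [Hg Hc] HB Hw.
  apply (cauchy_disc gamma _ 0 (Cmod w) Hg Hc).
  - intros t Ht. specialize (HB t Ht). replace (t - 0)%C with t by ring. lra.
  - intros v Hv. replace (v - 0)%C with v in Hv by ring.
    eexists. apply (C_is_derive_inv (fun t => t - w)%C); [|apply C_is_derive_sub].
    apply Csub_neq_0. intros ->. lra.
Qed.

(** Dixon's argument. The integral of the difference quotient, as a function of
    its base point in [D], and the Cauchy integral of [f] outside [D] glue to an
    entire function, because the index vanishes outside [D]; it tends to zero at
    infinity, hence is zero. *)
Theorem cauchy_formula_homology (D : C -> Prop) (f : C -> C) (gamma : R -> C) :
  open D -> holomorphic_on D f -> loop gamma -> (forall t, trace gamma t -> D t) ->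
  (forall w, ~ D w -> index gamma w = 0%C) ->
  forall w, D w -> ~ trace gamma w ->
  contour_int gamma (fun t => f t * / (t - w))%C = (f w * index gamma w)%C.
Proof.
  intros HD Hf Hl Ht Hout w Hw Hwt. assert (Hg := proj1 Hl).
  assert (Hfc : continuous_on_trace gamma f).
  { intros t Ht'. apply (holomorphic_continuous D); auto. }
  assert (Hcauchy : forall v, ~ trace gamma v -> index gamma v = 0%C -> D v ->
     contour_int gamma (diff_quotient f v) = contour_int gamma (fun t => f t * / (t - v))%C).
  { intros v Hv E HDv. rewrite (diff_quotient_int D f gamma v) by auto. rewrite E. ring. }
  assert (Hh : exists h : C -> C,
     (forall v, D v -> h v = contour_int gamma (diff_quotient f v)) /\
     (forall v, ~ D v -> h v = contour_int gamma (fun t => f t * / (t - v))%C)).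
  { destruct (functional_choice (fun v y =>
        (D v -> y = contour_int gamma (diff_quotient f v)) /\
        (~ D v -> y = contour_int gamma (fun t => f t * / (t - v))%C))) as [h H].
    - intros v. destruct (classic (D v)); eexists; split; intros; try contradiction; reflexivity.
    - exists h. split; intros v; apply H. }
  destruct Hh as [h [Hin Hex]].
  assert (Hh0 : h w = 0%C).
  { apply entire_vanishing_at_infinity.
    - intros v. destruct (classic (D v)) as [Hv|Hv].
      + destruct (dixon_derive_inside D f gamma v HD Hf Hg Ht Hv) as [l H]. exists l.
        destruct (domain_disc D v HD Hv) as [r [Hr Hdisc]].
        apply (C_is_derive_ext_loc (fun u => contour_int gamma (diff_quotient f u)) h v l r Hr);
          [|exact H].
        intros u Hu. symmetry. auto.
      + assert (Hvt : ~ trace gamma v) by (intros H; apply Hv; auto).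
        destruct (off_trace_open gamma v Hg Hvt) as [r [Hr Hoff]].
        eexists. apply (C_is_derive_ext_loc (cauchy_integral gamma f 1) h v _ r Hr).
        * intros u Hu. rewrite <- cauchy_integral_1 by auto. symmetry.
          destruct (classic (D u)) as [HDu|HDu]; [|auto].
          rewrite Hin by exact HDu. apply Hcauchy; auto.
          rewrite (index_locally_constant gamma v r) by auto. auto.
        * apply cauchy_integral_derive; auto.
    - destruct (trace_bounded gamma (fun t => t) Hg) as [B [HB0 HB]].
      { intros t _. eapply C_is_derive_continuous, C_is_derive_id. }
      destruct (trace_bounded gamma f Hg Hfc) as [M [HM0 HM]].
      destruct (path_length_bound gamma Hg) as [L [HL0 HL]].
      intros eps He. exists (B + M * L / eps). intros v Hv.
      assert (Pq : 0 < M * L / eps) by (apply Rdiv_lt_0_compat; [nra|exact He]).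
      assert (Hvt : ~ trace gamma v) by (intros H; specialize (HB v H); lra).
      assert (E : h v = contour_int gamma (fun t => f t * / (t - v))%C).
      { destruct (classic (D v)) as [HDv|HDv]; [|auto].
        rewrite Hin by exact HDv. apply Hcauchy; auto. apply (index_far gamma B); auto. lra. }
      rewrite E.
      apply Rle_trans with (M * / (M * L / eps) * L); [|right; field; lra].
      apply contour_int_bound; auto.
      + intros t Ht'. apply continuous_Cmult; [now apply Hfc|].
        now apply (inv_sub_continuous_on_trace gamma v).
      + intros t Ht'. assert (Htv := off_trace_neq gamma t v Ht' Hvt).
        rewrite Cmod_mult, Cmod_inv by now apply Csub_neq_0.
        apply Rmult_le_compat; [apply Cmod_ge_0| |now apply HM|].
        * apply Rlt_le, Rinv_0_lt_compat, Cmod_gt_0. now apply Csub_neq_0.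
        * apply Rinv_le_contravar; [exact Pq|].
          specialize (HB t Ht'). assert (T := Cmod_triangle (v - t) t).
          replace (v - t + t)%C with v in T by ring. rewrite Cmod_sub_sym in T. lra. }
  rewrite Hin, (diff_quotient_int D f gamma w) in Hh0 by auto.
  replace (contour_int gamma (fun t => f t * / (t - w)))%C
    with ((contour_int gamma (fun t => f t * / (t - w)) - f w * index gamma w)
          + f w * index gamma w)%C by ring.
  rewrite Hh0. ring.
Qed.

(** ** Jordan curves surrounding a point *)

(** Being locally constant, the index separates [S] into two open parts if it
    takes two values. *)
Lemma index_connected (gamma : R -> C) (S : C -> Prop) (v w : C) :
  loop gamma -> connected_in_C S -> (forall u, S u -> ~ trace gamma u) ->
  S v -> S w -> index gamma v = index gamma w.
Proof.
  intros Hl HS Hoff Hv Hw. apply NNPP. intros Hne.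
  assert (Hopen : forall P : C -> Prop, open (fun u => ~ trace gamma u /\ P (index gamma u))).
  { intros P u [Hu HP]. apply locally_C.
    destruct (off_trace_open gamma u (proj1 Hl) Hu) as [r [Hr H]].
    exists r. split; [exact Hr|]. intros t Htu. split; [auto|].
    now rewrite (index_locally_constant gamma u r). }
  destruct (HS _ _ (Hopen (fun i => i = index gamma w)) (Hopen (fun i => i <> index gamma w)))
    as [u [_ [[_ H1] [_ H2]]]].
  - intros u Hu. destruct (classic (index gamma u = index gamma w)); [left|right]; auto.
  - exists w. auto.
  - exists v. auto.
  - contradiction.
Qed.

(** A point that is not in the interior is connected to points arbitrarily far
    away, where the index is zero by Cauchy's theorem in a disc. *)
Lemma index_exterior (gamma : R -> C) (w : C) :
  loop gamma -> ~ trace gamma w -> ~ jordan_interior gamma w -> index gamma w = 0%C.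
Proof.
  intros Hl Hw Hext.
  destruct (trace_bounded gamma (fun t => t) (proj1 Hl)) as [B [HB0 HB]].
  { intros t _. eapply C_is_derive_continuous, C_is_derive_id. }
  assert (H : exists S v, connected_in_C S /\ S w /\ (forall u, S u -> ~ trace gamma u) /\
                S v /\ B < Cmod v).
  { apply NNPP. intros Hno. apply Hext. split; [exact Hw|]. exists B.
    intros S HS HSw Hoff v Hv. apply Rnot_lt_le. intros HBv. apply Hno. now exists S, v. }
  destruct H as [S [v [HS [HSw [Hoff [HSv HBv]]]]]].
  rewrite (index_connected gamma S w v) by assumption.
  now apply (index_far gamma B).
Qed.

Lemma closed_jordan_loop (gamma : R -> C) : closed_jordan gamma -> rectifiable gamma -> loop gamma.
Proof. intros [H1 [H2 _]] H3. split; [now split|exact H2]. Qed.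

Lemma index_interior (gamma : R -> C) (w : C) :
  positively_oriented gamma -> jordan_interior gamma w -> index gamma w = (2 * PI * Ci)%C.
Proof.
  intros Hpos Hw. specialize (Hpos w Hw). unfold winding in Hpos. fold (index gamma w) in Hpos.
  assert (H2 := two_pi_i_neq_0). revert H2 Hpos. generalize (2 * PI * Ci)%C. intros k Hk H.
  replace (index gamma w) with (k * (/ k * index gamma w))%C by (field; exact Hk).
  rewrite H. ring.
Qed.

Fixpoint taylor_coefficient (f : C -> C) (j : nat) : C -> C :=
  match j with
  | O => f
  | S i => fun w => (/ INR (S i) * C_derive (taylor_coefficient f i) w)%C
  end.

Lemma INR_S_neq_0 (j : nat) : RtoC (INR (S j)) <> 0%C.
Proof. intros E. apply RtoC_inj in E. now apply (not_0_INR (S j)) in E. Qed.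

Lemma taylor_coefficient_holomorphic (D : C -> Prop) (f : C -> C) (j : nat) :
  open D -> holomorphic_on D f -> holomorphic_on D (taylor_coefficient f j).
Proof.
  intros HD Hf. induction j as [|j IH]; [exact Hf|].
  apply (holomorphic_derive D _ HD) in IH. intros w Hw.
  eexists. apply C_is_derive_scal, (holomorphic_is_derive D); [exact IH|exact Hw].
Qed.

Lemma taylor_coefficient_derive (D : C -> Prop) (f : C -> C) (j : nat) (w : C) :
  open D -> holomorphic_on D f -> D w ->
  C_is_derive (taylor_coefficient f j) w (INR (S j) * taylor_coefficient f (S j) w)%C.
Proof.
  intros HD Hf Hw. apply (C_is_derive_eq _ _ (C_derive (taylor_coefficient f j) w)).
  - cbn [taylor_coefficient]. field. apply INR_S_neq_0.
  - apply (holomorphic_is_derive D); [|exact Hw]. now apply taylor_coefficient_holomorphic.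
Qed.

(** Since the index is zero outside [D] and [2 PI i] near [w], this holds for
    [j = 0] at all points near [w]; differentiating both sides gives the next
    [j]. The right-hand side does not depend on the curve. *)
Lemma taylor_coefficient_integral (D : C -> Prop) (f : C -> C) (gamma : R -> C) (w : C) (j : nat) :
  open D -> holomorphic_on D f -> surrounding_curve D w gamma ->
  cauchy_integral gamma f (S j) w = (2 * PI * Ci * taylor_coefficient f j w)%C.
Proof.
  intros HD Hf [HJ [Hrect [Hpos [Hint [Ht Hin]]]]].
  assert (Hl := closed_jordan_loop gamma HJ Hrect). assert (Hg := proj1 Hl).
  assert (Hfc : continuous_on_trace gamma f).
  { intros t Ht'. apply (holomorphic_continuous D); auto. }
  assert (Hw := proj1 Hint). assert (HDw := Hin w Hint).
  destruct (off_trace_open gamma w Hg Hw) as [r1 [Hr1 Hoff]].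
  destruct (domain_disc D w HD HDw) as [r2 [Hr2 Hdisc]].
  set (r := Rmin r1 r2). assert (Hr : 0 < r) by now apply Rmin_glb_lt.
  assert (Hoff' : forall v, Cmod (v - w) < r -> ~ trace gamma v).
  { intros v Hv. apply Hoff. eapply Rlt_le_trans; [exact Hv|apply Rmin_l]. }
  assert (Hdisc' : forall v, Cmod (v - w) < r -> D v).
  { intros v Hv. apply Hdisc. eapply Rlt_le_trans; [exact Hv|apply Rmin_r]. }
  assert (Hout : forall v, ~ D v -> index gamma v = 0%C).
  { intros v Hv. apply index_exterior; [exact Hl| |]; intros H; apply Hv; auto. }
  assert (H : forall v, Cmod (v - w) < r ->
            cauchy_integral gamma f (S j) v = (2 * PI * Ci * taylor_coefficient f j v)%C).
  { induction j as [|j IH]; intros v Hv.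
    - rewrite <- cauchy_integral_1 by auto.
      rewrite (cauchy_formula_homology D f gamma) by auto.
      rewrite (index_locally_constant gamma w r) by auto.
      rewrite index_interior by assumption. cbn. ring.
    - assert (E : (INR (S j) * cauchy_integral gamma f (S (S j)) v)%C =
                  (2 * PI * Ci * (INR (S j) * taylor_coefficient f (S j) v))%C).
      { apply (C_is_derive_unique (cauchy_integral gamma f (S j)) v).
        - apply cauchy_integral_derive; auto.
        - apply (C_is_derive_ext_loc (fun u => 2 * PI * Ci * taylor_coefficient f j u)%C _ v _
                   (r - Cmod (v - w))); [lra| |].
          + intros u Hu. symmetry. apply IH.
            eapply Rle_lt_trans; [apply (Cmod_sub_triangle v)|]. lra.
          + apply C_is_derive_scal, (taylor_coefficient_derive D); auto. }
      assert (Hj := INR_S_neq_0 j).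
      replace (cauchy_integral gamma f (S (S j)) v)
        with (/ INR (S j) * (INR (S j) * cauchy_integral gamma f (S (S j)) v))%C
        by (field; exact Hj).
      rewrite E. field. exact Hj. }
  apply H. rewrite Cmod_sub_diag. exact Hr.
Qed.

(** * The convolution algebra of sequences *)

Lemma Csum_zero (a : nat -> C) (n : nat) :
  (forall i, (i <= n)%nat -> a i = 0%C) -> sum_n a n = RtoC 0.
Proof.
  induction n as [|n IH]; intros H; [rewrite sum_O; auto|].
  rewrite Csum_Sn, IH, H by auto. C_ring.
Qed.

Lemma Csum_extend (a : nat -> C) (n m : nat) :
  (n <= m)%nat -> (forall i, (n < i)%nat -> a i = 0%C) -> sum_n a n = sum_n a m.
Proof.
  intros Hm Ha. replace m with (n + (m - n))%nat by lia.
  destruct (m - n)%nat as [|d]; [now rewrite Nat.add_0_r|].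
  rewrite Csum_split, (Csum_zero (fun i => a (S n + i)%nat)); [C_ring|].
  intros i _. apply Ha. lia.
Qed.

Lemma conv_S (a b : nat -> C) (n : nat) :
  conv a b (S n) = (a 0%nat * b (S n) + conv (fun i => a (S i)) b n)%C.
Proof. unfold conv. now rewrite Csum_first. Qed.

Lemma conv_0 (a b : nat -> C) : conv a b 0 = (a 0%nat * b 0%nat)%C.
Proof. unfold conv. now rewrite sum_O. Qed.

Lemma conv_ext (a a' b b' : nat -> C) (n : nat) :
  (forall i, (i <= n)%nat -> a i = a' i) -> (forall i, (i <= n)%nat -> b i = b' i) ->
  conv a b n = conv a' b' n.
Proof.
  intros Ha Hb. apply sum_n_ext_loc. intros i Hi. rewrite Ha, Hb by lia. reflexivity.
Qed.

Lemma conv_comm (a b : nat -> C) (n : nat) : conv a b n = conv b a n.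
Proof.
  unfold conv. rewrite Csum_rev. apply sum_n_ext_loc. intros i Hi.
  replace (n - (n - i))%nat with i by lia. apply Cmult_comm.
Qed.

Lemma conv_lin_l (a a' b : nat -> C) (c : C) (n : nat) :
  conv (fun i => a i + c * a' i)%C b n = (conv a b n + c * conv a' b n)%C.
Proof.
  unfold conv. rewrite <- Csum_mult_l, <- Csum_plus. apply sum_n_ext. intros i. C_ring.
Qed.

Lemma conv_assoc (a b c : nat -> C) (n : nat) :
  conv (conv a b) c n = conv a (conv b c) n.
Proof.
  revert a. induction n as [|n IH]; intros a.
  - rewrite !conv_0. ring.
  - rewrite !conv_S, conv_0, <- IH.
    rewrite (conv_ext _ (fun i => conv (fun i => a (S i)) b i + a 0%nat * b (S i))%C c c n);
      [|intros i _; rewrite conv_S; ring|reflexivity].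
    rewrite (conv_lin_l (conv (fun i => a (S i)) b)). ring.
Qed.

Lemma conv_zero_l (a : nat -> C) (n : nat) : conv (fun _ => RtoC 0) a n = 0%C.
Proof. apply Csum_zero. intros i _. ring. Qed.

Definition conv_unit (n : nat) : C := match n with O => 1%C | S _ => 0%C end.

Lemma conv_unit_l (a : nat -> C) (n : nat) : conv conv_unit a n = a n.
Proof.
  destruct n as [|n]; [rewrite conv_0; cbn; ring|]. rewrite conv_S. cbn [conv_unit].
  change (fun i => conv_unit (S i)) with (fun _ : nat => RtoC 0). rewrite conv_zero_l. ring.
Qed.

Fixpoint conv_pow (e : nat -> C) (i : nat) : nat -> C :=
  match i with O => conv_unit | S i' => conv e (conv_pow e i') end.

Lemma conv_pow_order (e : nat -> C) (i n : nat) :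
  e 0%nat = 0%C -> (n < i)%nat -> conv_pow e i n = 0%C.
Proof.
  intros He. revert n. induction i as [|i IH]; intros n Hn; [lia|].
  cbn [conv_pow]. apply Csum_zero. intros j Hj. destruct j as [|j].
  - rewrite He. ring.
  - rewrite IH by lia. ring.
Qed.

Definition tail (zeta : nat -> C) (r : nat) : C := match r with O => 0%C | S _ => zeta r end.

(** This splits the derivative of [zeta_0 + eta] into its two parts. *)
Lemma conv_tail (kappa c : nat -> C) (n : nat) :
  conv kappa c n = (kappa 0%nat * c n + conv (tail kappa) c n)%C.
Proof.
  destruct n as [|n]; [rewrite !conv_0; cbn; ring|].
  rewrite !conv_S. cbn [tail].
  change (fun i => kappa (S i)) with (fun i => tail kappa (S i)). ring.
Qed.

(** The recurrence says that [A_0 + A_1 eps + ...] is the inverse of [u - eta]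
    with [eta = zeta_1 eps + zeta_2 eps^2 + ...]; the expansion is the geometric
    series of the [eta^i / u^(i+1)]. *)
Lemma coefficient_expansion (zeta A : nat -> C) (u : C) :
  A 0%nat = (/ u)%C ->
  (forall s, A (S s) = (/ u * sum_n (fun j => zeta (S s - j)%nat * A j)%C s)%C) ->
  forall n, A n = sum_n (fun i => conv_pow (tail zeta) i n * Cpow_inv (S i) u)%C n.
Proof.
  intros H0 HS n. induction n as [n IH] using (well_founded_induction Wf_nat.lt_wf).
  destruct n as [|s].
  - rewrite sum_O, H0. cbn. ring.
  - rewrite HS, Csum_first. cbn [conv_pow conv_unit]. rewrite Cmult_0_l, Cplus_0_l.
    rewrite (sum_n_ext_loc _ (fun j => sum_n (fun i => zeta (S s - j)%nat *
       (conv_pow (tail zeta) i j * Cpow_inv (S i) u))%C s)).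
    2:{ intros j Hj. rewrite IH, <- Csum_mult_l by lia.
        apply Csum_extend; [exact Hj|]. intros i Hi.
        rewrite conv_pow_order by (reflexivity || lia). ring. }
    rewrite sum_n_switch, <- Csum_mult_l. apply sum_n_ext. intros i.
    replace (conv (tail zeta) (conv_pow (tail zeta) i) (S s))
      with (sum_n (fun j => zeta (S s - j)%nat * conv_pow (tail zeta) i j)%C s).
    + change (Cpow_inv (S (S i)) u) with (/ u * Cpow_inv (S i) u)%C.
      generalize (Cpow_inv (S i) u). intros p.
      rewrite (sum_n_ext _ (fun j => p * (zeta (S s - j)%nat * conv_pow (tail zeta) i j))%C)
        by (intros j; C_ring).
      rewrite Csum_mult_l. C_ring.
    + rewrite conv_comm. unfold conv. rewrite Csum_Sn, Nat.sub_diag. cbn [tail].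
      rewrite Cmult_0_r, Cplus_0_r. apply sum_n_ext_loc. intros j Hj.
      replace (S s - j)%nat with (S (s - j)) by lia. cbn [tail]. C_ring.
Qed.

(** * Composition with a power series *)

(** [compose T n zeta] is the coefficient of [eps^n] in
    [sum_i T_i(zeta_0) (zeta_1 eps + zeta_2 eps^2 + ...)^i]; when [T] is the
    sequence of Taylor coefficients of [F] this is the expansion of
    [F (zeta_0 + zeta_1 eps + ...)]. *)
Definition compose (T : nat -> C -> C) (n : nat) (zeta : nat -> C) : C :=
  sum_n (fun i => conv_pow (tail zeta) i n * T i (zeta 0%nat))%C n.

(** The Taylor coefficients of [F'] in terms of those of [F]. *)
Definition shift_derive (T : nat -> C -> C) (i : nat) (w : C) : C := (INR (S i) * T (S i) w)%C.

Definition taylor_sequence (D : C -> Prop) (T : nat -> C -> C) : Prop :=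
  forall i w, D w -> C_is_derive (T i) w (shift_derive T i w).

Lemma shift_derive_taylor (D : C -> Prop) (T : nat -> C -> C) :
  taylor_sequence D T -> taylor_sequence D (shift_derive T).
Proof. intros H i w Hw. apply C_is_derive_scal. now apply (H (S i)). Qed.

Lemma C_is_derive_sum (f : nat -> C -> C) (l : nat -> C) (w : C) (n : nat) :
  (forall i, C_is_derive (f i) w (l i)) ->
  C_is_derive (fun t => sum_n (fun i => f i t) n) w (sum_n l n).
Proof.
  intros H. induction n as [|n IH].
  - apply (C_is_derive_ext_loc (f 0%nat) _ w _ 1); [lra|intros v _; now rewrite sum_O|].
    rewrite sum_O. apply H.
  - apply (C_is_derive_ext_loc (fun t => sum_n (fun i => f i t) n + f (S n) t)%C _ w _ 1);
      [lra|intros v _; now rewrite Csum_Sn|].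
    rewrite Csum_Sn. now apply C_is_derive_plus.
Qed.

Lemma C_is_derive_conv (a b : C -> nat -> C) (a' b' : nat -> C) (w : C) (n : nat) :
  (forall i, C_is_derive (fun t => a t i) w (a' i)) ->
  (forall i, C_is_derive (fun t => b t i) w (b' i)) ->
  C_is_derive (fun t => conv (a t) (b t) n) w (conv a' (b w) n + conv (a w) b' n)%C.
Proof.
  intros Ha Hb.
  apply (C_is_derive_eq _ _ (sum_n (fun i => a' i * b w (n - i)%nat + a w i * b' (n - i)%nat)%C n)).
  - unfold conv. apply Csum_plus.
  - apply (C_is_derive_sum (fun i t => a t i * b t (n - i)%nat)%C). intros i.
    apply (C_is_derive_mult (fun t => a t i) (fun t => b t (n - i)%nat)); auto.
Qed.

Lemma C_is_derive_conv_pow (e : C -> nat -> C) (e' : nat -> C) (w : C) (i n : nat) :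
  (forall r, C_is_derive (fun t => e t r) w (e' r)) ->
  C_is_derive (fun t => conv_pow (e t) (S i) n) w (INR (S i) * conv e' (conv_pow (e w) i) n)%C.
Proof.
  intros He. revert n. induction i as [|i IH]; intros n.
  - apply (C_is_derive_eq _ _ (conv e' conv_unit n + conv (e w) (fun _ => RtoC 0) n)%C).
    + rewrite (conv_comm (e w)), conv_zero_l. cbn. ring.
    + apply (C_is_derive_conv e (fun _ => conv_unit)); [exact He|].
      intros j. apply C_is_derive_const.
  - apply (C_is_derive_eq _ _ (conv e' (conv_pow (e w) (S i)) n
        + conv (e w) (fun m => INR (S i) * conv e' (conv_pow (e w) i) m)%C n)%C).
    + rewrite (conv_comm (e w) (fun m => _)).
      rewrite (conv_ext _ (fun m => 0 + INR (S i) * conv e' (conv_pow (e w) i) m)%C (e w) (e w) n);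
        [|intros m _; ring|reflexivity].
      rewrite (conv_lin_l (fun _ => RtoC 0)), conv_zero_l, conv_assoc.
      rewrite (conv_ext e' e' (conv (conv_pow (e w) i) (e w)) (conv_pow (e w) (S i)) n);
        [|reflexivity|intros m _; apply conv_comm].
      rewrite (S_INR (S i)), RtoC_plus. ring.
    + apply (C_is_derive_conv e (fun t => conv_pow (e t) (S i))); auto.
Qed.

Lemma compose_extend (T : nat -> C -> C) (n m : nat) (zeta : nat -> C) : (n <= m)%nat ->
  compose T n zeta = sum_n (fun i => conv_pow (tail zeta) i n * T i (zeta 0%nat))%C m.
Proof.
  intros Hm. apply Csum_extend; [exact Hm|]. intros i Hi.
  rewrite conv_pow_order by (reflexivity || lia). ring.
Qed.

(** The chain rule for [F (zeta_0 + eta)], coefficient by coefficient: the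
    velocity of [zeta_0] acts on the Taylor coefficients and that of [eta] on the
    powers of [eta]; after a shift of the index both produce [F' (zeta_0 + eta)]. *)
Lemma compose_derive (D : C -> Prop) (T : nat -> C -> C) (a kappa : nat -> C) (n : nat) (s : C) :
  taylor_sequence D T -> D (a 0%nat + kappa 0%nat * s)%C ->
  C_is_derive (fun s => compose T n (fun r => a r + kappa r * s)%C) s
    (conv kappa (fun m => compose (shift_derive T) m (fun r => a r + kappa r * s)%C) n).
Proof.
  intros HT HD. set (zeta := fun s r => (a r + kappa r * s)%C).
  change (D (zeta s 0%nat)) in HD.
  change (C_is_derive (fun s => compose T n (zeta s)) s
            (conv kappa (fun m => compose (shift_derive T) m (zeta s)) n)).
  assert (Hz : forall r, C_is_derive (fun s => zeta s r) s (kappa r)).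
  { intros r. apply C_is_derive_affine. }
  assert (Ht : forall r, C_is_derive (fun s => tail (zeta s) r) s (tail kappa r)).
  { intros [|r]; [exact (C_is_derive_const (RtoC 0) s)|apply Hz]. }
  set (p := fun i m => conv_pow (tail (zeta s)) i m).
  set (w := zeta s 0%nat) in *.
  set (dp := fun i => match i with O => RtoC 0
                      | S j => (INR (S j) * conv (tail kappa) (p j) n)%C end).
  apply (C_is_derive_ext_loc
    (fun s => sum_n (fun i => conv_pow (tail (zeta s)) i n * T i (zeta s 0%nat))%C (S n)) _ s _ 1);
    [lra|intros v _; symmetry; apply compose_extend; lia|].
  apply (C_is_derive_eq _ _
    (sum_n (fun i => dp i * T i w + p i n * (kappa 0%nat * shift_derive T i w))%C (S n))).
  2:{ apply (C_is_derive_sum (fun i s => conv_pow (tail (zeta s)) i n * T i (zeta s 0%nat))%C).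
      intros i. apply (C_is_derive_mult (fun s => conv_pow (tail (zeta s)) i n)
                         (fun s => T i (zeta s 0%nat))).
      - destruct i as [|i]; [exact (C_is_derive_const (conv_unit n) s)|].
        apply (C_is_derive_conv_pow (fun s => tail (zeta s))). exact Ht.
      - apply (C_is_derive_comp (T i) (fun s => zeta s 0%nat)); [now apply HT|apply Hz]. }
  rewrite Csum_plus.
  rewrite (Csum_first (fun i => dp i * T i w)%C), (Csum_Sn (fun i => p i n * _)%C).
  replace (p (S n) n) with (RtoC 0) by (symmetry; apply conv_pow_order; [reflexivity|lia]).
  cbn [dp]. unfold conv at 2.
  rewrite (sum_n_ext_loc (fun j => kappa j * compose (shift_derive T) (n - j) (zeta s))%C
    (fun j => sum_n (fun i => kappa j * (p i (n - j)%nat * shift_derive T i w))%C n)).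
  2:{ intros j Hj. rewrite (compose_extend _ (n - j) n) by lia. now rewrite <- Csum_mult_l. }
  rewrite sum_n_switch.
  rewrite (sum_n_ext (fun i => sum_n _ n)
    (fun i => INR (S i) * conv (tail kappa) (p i) n * T (S i) w
              + p i n * (kappa 0%nat * shift_derive T i w))%C).
  - rewrite Csum_plus. C_ring.
  - intros i.
    rewrite (sum_n_ext _ (fun j => shift_derive T i w * (kappa j * p i (n - j)%nat))%C)
      by (intros j; C_ring).
    rewrite Csum_mult_l. change (sum_n (fun j => kappa j * p i (n - j)%nat)%C n) with (conv kappa (p i) n).
    rewrite conv_tail. unfold shift_derive. C_ring.
Qed.

(** * Solutions of the biharmonic equation *)

Lemma CDerive_eq (f : R -> C) (s : R) (l : C) :
  is_derive (K := R_AbsRing) (V := C_R_NormedModule) f s l -> CDerive f s = l.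
Proof.
  intros H. apply is_derive_Re_Im in H. destruct H as [H1 H2]. unfold CDerive.
  apply is_derive_unique in H1, H2. rewrite (surjective_pairing l).
  exact (f_equal2 (@pair R R) H1 H2).
Qed.

Lemma continuous_Csum {X : UniformSpace} (f : nat -> X -> C) (x : X) (n : nat) :
  (forall i, continuous (f i) x) -> continuous (fun t => sum_n (fun i => f i t) n) x.
Proof.
  intros H. induction n as [|n IH].
  - apply (continuous_ext (f 0%nat)); [intros t; now rewrite sum_O|apply H].
  - apply (continuous_ext (fun t => sum_n (fun i => f i t) n + f (S n) t)%C);
      [intros t; now rewrite Csum_Sn|].
    exact (continuous_plus (V := C_NormedModule) _ _ x IH (H (S n))).
Qed.

Lemma continuous_conv {X : UniformSpace} (a b : X -> nat -> C) (x : X) (n : nat) :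
  (forall i, continuous (fun t => a t i) x) -> (forall i, continuous (fun t => b t i) x) ->
  continuous (fun t => conv (a t) (b t) n) x.
Proof.
  intros Ha Hb. apply (continuous_Csum (fun i t => a t i * b t (n - i)%nat)%C). intros i.
  apply continuous_Cmult; auto.
Qed.

Lemma continuous_RtoC (x : R) : continuous RtoC x.
Proof.
  apply (filterlim_C RtoC). intros eps He. exists (mkposreal eps He). intros y Hy.
  rewrite <- RtoC_minus, Cmod_R. exact Hy.
Qed.

Lemma continuous_conv_pow {X : UniformSpace} (e : X -> nat -> C) (x : X) (i n : nat) :
  (forall r, continuous (fun t => e t r) x) -> continuous (fun t => conv_pow (e t) i n) x.
Proof.
  intros He. revert n. induction i as [|i IH]; intros n.
  - apply continuous_const.
  - now apply (continuous_conv e (fun t => conv_pow (e t) i)).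
Qed.

Lemma continuous_compose {X : UniformSpace} (D : C -> Prop) (T : nat -> C -> C) (n : nat)
  (zeta : X -> nat -> C) (x : X) :
  taylor_sequence D T -> D (zeta x 0%nat) -> (forall r, continuous (fun t => zeta t r) x) ->
  continuous (fun t => compose T n (zeta t)) x.
Proof.
  intros HT Hx Hz.
  apply (continuous_Csum (fun i t => conv_pow (tail (zeta t)) i n * T i (zeta t 0%nat))%C).
  intros i. apply continuous_Cmult.
  - apply (continuous_conv_pow (fun t => tail (zeta t))).
    intros [|r]; [exact (continuous_const (RtoC 0) x)|apply Hz].
  - apply (continuous_comp (fun t => zeta t 0%nat) (T i)); [apply Hz|].
    eapply C_is_derive_continuous. now apply HT.
Qed.

Lemma continuous_xi {X : UniformSpace} (k m g : nat -> C) (r : nat) (a b c : X -> R) (x : X) :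
  continuous a x -> continuous b x -> continuous c x ->
  continuous (fun p => xi k m g r (a p) (b p) (c p)) x.
Proof.
  intros Ha Hb Hc.
  assert (H : forall (u : C) (f : X -> R), continuous f x -> continuous (fun p => u * f p)%C x).
  { intros u f Hf. apply continuous_Cmult; [apply continuous_const|].
    apply (continuous_comp f RtoC); [exact Hf|apply continuous_RtoC]. }
  apply (continuous_plus (V := C_NormedModule) (fun p => k r * a p + m r * b p)%C
           (fun p => g r * c p)%C); [|now apply H].
  apply (continuous_plus (V := C_NormedModule) (fun p => k r * a p)%C (fun p => m r * b p)%C);
    now apply H.
Qed.

Lemma compose_ext (T : nat -> C -> C) (n : nat) (zeta zeta' : nat -> C) :
  (forall r, zeta r = zeta' r) -> compose T n zeta = compose T n zeta'.
Proof.
  intros H. replace zeta' with zeta; [reflexivity|].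
  now apply FunctionalExtensionality.functional_extensionality.
Qed.

(** The functions generated by [compose T n] under partial derivatives: each
    derivative multiplies [c] by [k], [m] or [g] and passes from [F] to [F']. For
    [c = conv_unit] this is [compose T n] itself. *)
Definition solution (k m g c : nat -> C) (T : nat -> C -> C) (n : nat) (x y z : R) : C :=
  conv c (fun j => compose T j (fun r => xi k m g r x y z)) n.

Lemma solution_derive_line (D : C -> Prop) (c : nat -> C) (T : nat -> C -> C) (n : nat)
  (zeta : R -> nat -> C) (a kappa : nat -> C) (s : R) :
  taylor_sequence D T -> D (zeta s 0%nat) -> (forall s r, zeta s r = (a r + kappa r * s)%C) ->
  is_derive (K := R_AbsRing) (V := C_R_NormedModule)
    (fun s : R => conv c (fun j => compose T j (zeta s)) n) s
    (conv (conv c kappa) (fun j => compose (shift_derive T) j (zeta s)) n).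
Proof.
  intros HT Hs Hz.
  set (F := fun s => conv c (fun j => compose T j (fun r => a r + kappa r * s)%C) n).
  assert (E : forall S i t, compose S i (zeta t) = compose S i (fun r => a r + kappa r * t)%C).
  { intros S i t. apply compose_ext, Hz. }
  apply (is_derive_ext (K := R_AbsRing) (V := C_R_NormedModule) (fun s : R => F s)).
  { intros t. apply conv_ext; [reflexivity|]. intros i _. now rewrite E. }
  apply C_is_derive_real. unfold F. rewrite conv_assoc.
  apply (C_is_derive_eq _ _ (conv (fun _ => RtoC 0)
      (fun j => compose T j (fun r => a r + kappa r * s)%C) n
    + conv c (conv kappa (fun j => compose (shift_derive T) j (fun r => a r + kappa r * s)%C)) n)%C).
  - rewrite conv_zero_l, Cplus_0_l. apply conv_ext; [reflexivity|]. intros i _.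
    apply conv_ext; [reflexivity|]. intros j _. now rewrite E.
  - apply (C_is_derive_conv (fun _ => c)
             (fun s j => compose T j (fun r => a r + kappa r * s)%C)).
    + intros i. apply C_is_derive_const.
    + intros i. apply (compose_derive D); [exact HT|]. now rewrite <- Hz.
Qed.

Definition xi_domain (k m g : nat -> C) (D : C -> Prop) (x y z : R) : Prop := D (xi k m g 0 x y z).

Lemma xi_domain_near {X : UniformSpace} (k m g : nat -> C) (D : C -> Prop) (a b c : X -> R) (x : X) :
  open D -> continuous a x -> continuous b x -> continuous c x ->
  xi_domain k m g D (a x) (b x) (c x) -> locally x (fun p => xi_domain k m g D (a p) (b p) (c p)).
Proof.
  intros HD Ha Hb Hc Hx. exact (continuous_xi k m g 0 a b c x Ha Hb Hc D (HD _ Hx)).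
Qed.

Lemma solution_partial_derivatives (k m g c : nat -> C) (D : C -> Prop) (T : nat -> C -> C) (n : nat)
  (U : R -> R -> R -> C) :
  open D -> taylor_sequence D T ->
  (forall x y z, xi_domain k m g D x y z -> U x y z = solution k m g c T n x y z) ->
  forall x y z, xi_domain k m g D x y z ->
  is_derive (K := R_AbsRing) (V := C_R_NormedModule) (fun s => U s y z) x
    (solution k m g (conv c k) (shift_derive T) n x y z) /\
  is_derive (K := R_AbsRing) (V := C_R_NormedModule) (fun s => U x s z) y
    (solution k m g (conv c m) (shift_derive T) n x y z) /\
  is_derive (K := R_AbsRing) (V := C_R_NormedModule) (fun s => U x y s) z
    (solution k m g (conv c g) (shift_derive T) n x y z).
Proof.
  intros HD HT HU x y z Hxyz.
  assert (Hid : forall s : R, continuous (fun s : R => s) s) by (intros; apply continuous_id).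
  assert (Hcst : forall u s : R, continuous (fun _ : R => u) s) by (intros; apply continuous_const).
  split; [|split].
  - apply (is_derive_ext_loc (K := R_AbsRing) (V := C_R_NormedModule)
             (fun s => solution k m g c T n s y z)).
    + generalize (xi_domain_near k m g D (fun s => s) (fun _ => y) (fun _ => z) x
                    HD (Hid x) (Hcst y x) (Hcst z x) Hxyz).
      apply filter_imp. intros s Hs. symmetry. now apply HU.
    + apply (solution_derive_line D c T n (fun s r => xi k m g r s y z)
               (fun r => m r * y + g r * z)%C k); auto.
      intros s r. unfold xi. ring.
  - apply (is_derive_ext_loc (K := R_AbsRing) (V := C_R_NormedModule)
             (fun s => solution k m g c T n x s z)).
    + generalize (xi_domain_near k m g D (fun _ => x) (fun s => s) (fun _ => z) y
                    HD (Hcst x y) (Hid y) (Hcst z y) Hxyz).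
      apply filter_imp. intros s Hs. symmetry. now apply HU.
    + apply (solution_derive_line D c T n (fun s r => xi k m g r x s z)
               (fun r => k r * x + g r * z)%C m); auto.
      intros s r. unfold xi. ring.
  - apply (is_derive_ext_loc (K := R_AbsRing) (V := C_R_NormedModule)
             (fun s => solution k m g c T n x y s)).
    + generalize (xi_domain_near k m g D (fun _ => x) (fun _ => y) (fun s => s) z
                    HD (Hcst x z) (Hcst y z) (Hid z) Hxyz).
      apply filter_imp. intros s Hs. symmetry. now apply HU.
    + apply (solution_derive_line D c T n (fun s r => xi k m g r x y s)
               (fun r => k r * x + m r * y)%C g); auto.
Qed.

Lemma solution_dx (k m g c : nat -> C) (D : C -> Prop) (T : nat -> C -> C) (n : nat)
  (U : R -> R -> R -> C) :
  open D -> taylor_sequence D T ->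
  (forall x y z, xi_domain k m g D x y z -> U x y z = solution k m g c T n x y z) ->
  forall x y z, xi_domain k m g D x y z ->
  dx U x y z = solution k m g (conv c k) (shift_derive T) n x y z.
Proof.
  intros HD HT HU x y z Hxyz. apply CDerive_eq.
  apply (solution_partial_derivatives k m g c D T n U HD HT HU x y z Hxyz).
Qed.

Lemma solution_dy (k m g c : nat -> C) (D : C -> Prop) (T : nat -> C -> C) (n : nat)
  (U : R -> R -> R -> C) :
  open D -> taylor_sequence D T ->
  (forall x y z, xi_domain k m g D x y z -> U x y z = solution k m g c T n x y z) ->
  forall x y z, xi_domain k m g D x y z ->
  dy U x y z = solution k m g (conv c m) (shift_derive T) n x y z.
Proof.
  intros HD HT HU x y z Hxyz. apply CDerive_eq.
  apply (solution_partial_derivatives k m g c D T n U HD HT HU x y z Hxyz).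
Qed.

Lemma solution_dz (k m g c : nat -> C) (D : C -> Prop) (T : nat -> C -> C) (n : nat)
  (U : R -> R -> R -> C) :
  open D -> taylor_sequence D T ->
  (forall x y z, xi_domain k m g D x y z -> U x y z = solution k m g c T n x y z) ->
  forall x y z, xi_domain k m g D x y z ->
  dz U x y z = solution k m g (conv c g) (shift_derive T) n x y z.
Proof.
  intros HD HT HU x y z Hxyz. apply CDerive_eq.
  apply (solution_partial_derivatives k m g c D T n U HD HT HU x y z Hxyz).
Qed.

Lemma solution_continuous (k m g c : nat -> C) (D : C -> Prop) (T : nat -> C -> C) (n : nat)
  (U : R -> R -> R -> C) (x y z : R) :
  open D -> taylor_sequence D T ->
  (forall x y z, xi_domain k m g D x y z -> U x y z = solution k m g c T n x y z) ->
  xi_domain k m g D x y z ->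
  continuous (fun p : R * R * R => U (fst (fst p)) (snd (fst p)) (snd p)) ((x, y), z).
Proof.
  intros HD HT HU Hxyz.
  assert (H1 : continuous (fun p : R * R * R => fst (fst p)) ((x, y), z))
    by (apply (continuous_comp fst fst); apply continuous_fst).
  assert (H2 : continuous (fun p : R * R * R => snd (fst p)) ((x, y), z))
    by (apply (continuous_comp fst snd); [apply continuous_fst|apply continuous_snd]).
  assert (H3 : continuous (fun p : R * R * R => snd p) ((x, y), z)) by apply continuous_snd.
  apply (continuous_ext_loc _ (fun p : R * R * R =>
    solution k m g c T n (fst (fst p)) (snd (fst p)) (snd p))).
  - generalize (xi_domain_near k m g D _ _ _ ((x, y), z) HD H1 H2 H3 Hxyz).
    apply filter_imp. intros p Hp. symmetry. now apply HU.
  - apply (continuous_conv (fun _ => c) (fun (p : R * R * R) j =>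
      compose T j (fun r => xi k m g r (fst (fst p)) (snd (fst p)) (snd p)))).
    + intros i. apply continuous_const.
    + intros i. apply (continuous_compose D); [exact HT|exact Hxyz|].
      intros r. now apply continuous_xi.
Qed.

Lemma solution_class_C (N : nat) (k m g c : nat -> C) (D : C -> Prop) (T : nat -> C -> C) (n : nat)
  (U : R -> R -> R -> C) :
  open D -> taylor_sequence D T ->
  (forall x y z, xi_domain k m g D x y z -> U x y z = solution k m g c T n x y z) ->
  class_C N (xi_domain k m g D) U.
Proof.
  intros HD. revert c T U. induction N as [|N IH]; intros c T U HT HU;
    (split; [|try exact I]).
  1,2: intros x y z Hxyz; now apply (solution_continuous k m g c D T n U).
  split.
  - intros x y z Hxyz.
    destruct (solution_partial_derivatives k m g c D T n U HD HT HU x y z Hxyz) as [H1 [H2 H3]].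
    split; [|split]; eexists; eassumption.
  - assert (HT' := shift_derive_taylor D T HT). split; [|split].
    + apply (IH (conv c k) (shift_derive T)); [exact HT'|]. now apply solution_dx.
    + apply (IH (conv c m) (shift_derive T)); [exact HT'|]. now apply solution_dy.
    + apply (IH (conv c g) (shift_derive T)); [exact HT'|]. now apply solution_dz.
Qed.

Lemma conv_four (a b : nat -> C) (r : nat) :
  conv (conv (conv (conv conv_unit a) a) b) b r = conv (conv a a) (conv b b) r.
Proof.
  rewrite conv_assoc. apply conv_ext; [|reflexivity]. intros i _.
  apply conv_ext; [|reflexivity]. intros j _. apply conv_unit_l.
Qed.

(** Two derivatives along an axis multiply by the square of its coefficient
    series, so the biharmonic operator multiplies by [(k^2 + m^2 + g^2)^2]; the
    coefficients of this series are the left-hand sides of the system. *)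
Lemma solution_biharmonic (k m g : nat -> C) (D : C -> Prop) (T : nat -> C -> C) (n : nat)
  (U : R -> R -> R -> C) :
  characteristic_system k m g -> open D -> taylor_sequence D T ->
  (forall x y z, xi_domain k m g D x y z -> U x y z = solution k m g conv_unit T n x y z) ->
  forall x y z, xi_domain k m g D x y z -> biharmonic U x y z = RtoC 0.
Proof.
  intros Hsys HD HT0 HU x y z Hxyz.
  assert (HT1 := shift_derive_taylor D _ HT0). assert (HT2 := shift_derive_taylor D _ HT1).
  assert (HT3 := shift_derive_taylor D _ HT2).
  unfold biharmonic.
  rewrite (solution_dx k m g _ D _ n _ HD HT3 (solution_dx k m g _ D _ n _ HD HT2
    (solution_dx k m g _ D _ n _ HD HT1 (solution_dx k m g _ D _ n _ HD HT0 HU))) x y z Hxyz).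
  rewrite (solution_dy k m g _ D _ n _ HD HT3 (solution_dy k m g _ D _ n _ HD HT2
    (solution_dy k m g _ D _ n _ HD HT1 (solution_dy k m g _ D _ n _ HD HT0 HU))) x y z Hxyz).
  rewrite (solution_dz k m g _ D _ n _ HD HT3 (solution_dz k m g _ D _ n _ HD HT2
    (solution_dz k m g _ D _ n _ HD HT1 (solution_dz k m g _ D _ n _ HD HT0 HU))) x y z Hxyz).
  rewrite (solution_dx k m g _ D _ n _ HD HT3 (solution_dx k m g _ D _ n _ HD HT2
    (solution_dy k m g _ D _ n _ HD HT1 (solution_dy k m g _ D _ n _ HD HT0 HU))) x y z Hxyz).
  rewrite (solution_dx k m g _ D _ n _ HD HT3 (solution_dx k m g _ D _ n _ HD HT2
    (solution_dz k m g _ D _ n _ HD HT1 (solution_dz k m g _ D _ n _ HD HT0 HU))) x y z Hxyz).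
  rewrite (solution_dy k m g _ D _ n _ HD HT3 (solution_dy k m g _ D _ n _ HD HT2
    (solution_dz k m g _ D _ n _ HD HT1 (solution_dz k m g _ D _ n _ HD HT0 HU))) x y z Hxyz).
  unfold solution.
  set (V := fun j => compose _ j _).
  assert (E : forall a b, conv (conv (conv (conv conv_unit a) a) b) b =
                          conv (conv a a) (conv b b)).
  { intros a b. apply FunctionalExtensionality.functional_extensionality. apply conv_four. }
  rewrite !E.
  set (Bs := conv k k). set (Cs := conv m m). set (Ds := conv g g).
  assert (Z : conv (fun r => (((((conv Bs Bs r + 1 * conv Cs Cs r) + 1 * conv Ds Ds r)
    + 2 * conv Cs Bs r) + 2 * conv Ds Bs r) + 2 * conv Ds Cs r)%C) V n = 0%C).
  { rewrite <- (conv_zero_l V n). apply conv_ext; [|reflexivity]. intros r _.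
    rewrite <- (Hsys r). fold Bs Cs Ds.
    rewrite (conv_comm Cs Bs), (conv_comm Ds Bs), (conv_comm Ds Cs). ring. }
  rewrite !conv_lin_l in Z. rewrite <- Z. ring.
Qed.

(** ** From the contour integral to the expansion *)

Lemma contour_int_sum (gamma : R -> C) (f : nat -> C -> C) (c : nat -> C) (n : nat) :
  path gamma -> (forall i, continuous_on_trace gamma (f i)) ->
  continuous_on_trace gamma (fun t => sum_n (fun i => c i * f i t)%C n) /\
  contour_int gamma (fun t => sum_n (fun i => c i * f i t)%C n) =
  sum_n (fun i => c i * contour_int gamma (f i))%C n.
Proof.
  intros Hg Hf.
  assert (Hcont : forall n, continuous_on_trace gamma (fun t => sum_n (fun i => c i * f i t)%C n)).
  { intros j t Ht. apply (continuous_Csum (fun i t => c i * f i t)%C). intros i.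
    apply continuous_Cmult; [apply continuous_const|now apply Hf]. }
  split; [apply Hcont|]. induction n as [|n IH].
  - rewrite sum_O, <- contour_int_scal by auto. apply contour_int_ext; [exact Hg| |].
    + intros t Ht. apply continuous_Cmult; [apply continuous_const|now apply Hf].
    + intros t _. now rewrite sum_O.
  - rewrite Csum_Sn, <- IH, <- contour_int_lin by auto. apply contour_int_ext; [exact Hg| |].
    + intros t Ht. apply continuous_lin; [now apply Hcont|now apply Hf].
    + intros t _. apply Csum_Sn.
Qed.

Theorem mainTheorem1
    (k m g : nat -> C) (Hsys : characteristic_system k m g)
    (D : C -> Prop) (HD : domain_in_C D)
    (A : nat -> C -> R -> R -> R -> C) (HA : coefficient_recurrence k m g A)
    (Gamma : R -> R -> R -> (R -> C))
    (HGamma : forall x y z : R, D (xi k m g 0 x y z) ->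
       surrounding_curve D (xi k m g 0 x y z) (Gamma x y z)) :
  forall (n : nat) (F : C -> C), holomorphic_on D F ->
    biharmonic_solution
      (fun x y z => D (xi k m g 0 x y z))
      (fun x y z =>
         (/ (2 * PI * Ci) *
          contour_int (Gamma x y z) (fun t => F t * A n t x y z))%C).
Proof.
  intros n F HF. destruct HD as [_ [HDo _]].
  set (T := taylor_coefficient F).
  assert (HT : taylor_sequence D T).
  { intros i w Hw. now apply (taylor_coefficient_derive D). }
  assert (HU : forall x y z, xi_domain k m g D x y z ->
    (/ (2 * PI * Ci) * contour_int (Gamma x y z) (fun t => F t * A n t x y z))%C =
    solution k m g conv_unit T n x y z).
  { intros x y z Hxyz. assert (HG := HGamma x y z Hxyz).
    assert (HG' := HG). destruct HG' as [HJ [Hrect [_ [[Hoff _] [Htr _]]]]].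
    assert (Hg := proj1 (closed_jordan_loop _ HJ Hrect)).
    set (w := xi k m g 0 x y z) in *. set (gamma := Gamma x y z) in *.
    set (zeta := fun r => xi k m g r x y z).
    assert (HFc : continuous_on_trace gamma F).
    { intros t Ht. apply (holomorphic_continuous D); auto. }
    destruct (contour_int_sum gamma (fun i t => F t * Cpow_inv (S i) (t - w))%C
      (fun i => conv_pow (tail zeta) i n) n Hg) as [Hcont Hsum].
    { intros i. now apply (kernel_continuous_on_trace gamma F). }
    rewrite (contour_int_ext gamma _ _ Hg Hcont), Hsum.
    - unfold solution. rewrite conv_unit_l, <- Csum_mult_l. apply sum_n_ext. intros i.
      fold (cauchy_integral gamma F (S i) w).
      rewrite (taylor_coefficient_integral D F gamma w i HDo HF HG).
      fold T. assert (H2 := two_pi_i_neq_0). revert H2. generalize (2 * PI * Ci)%C. intros q Hq.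
      change (/ q * (conv_pow (tail zeta) i n * (q * T i w)) = conv_pow (tail zeta) i n * T i w)%C.
      field. exact Hq.
    - intros t Ht. assert (Htw := off_trace_neq gamma t w Ht Hoff).
      destruct (HA t x y z Htw) as [H0 HS].
      rewrite (coefficient_expansion zeta (fun s => A s t x y z) (t - w)%C H0 HS n).
      rewrite <- Csum_mult_l. apply sum_n_ext. intros i. C_ring. }
  split.
  - exact (solution_class_C 4 k m g conv_unit D T n _ HDo HT HU).
  - exact (solution_biharmonic k m g D T n _ Hsys HDo HT HU).
Qed.
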